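(* (a) For any even positive integer $n=2m$ and any integer $k>m^2$, there is a generic quadratic submanifold $M$ in $\mathbb{C}^{2k-m^2+2m-1}$ of codimension $k$ such that $n$-jets are required (and not less) to determine uniquely germs of biholomorphisms sending $M$ to $M$. (b) For any odd integer $n\ge 3$ and any integer $k>\frac{(n-1)n}{2}$, there is a generic quadratic submanifold $M$ in $\mathbb{C}^{2k-\frac12 n^2+\frac52 n-1}$ of codimension $k$ such that $n$-jets are required (and not less) to determine uniquely germs of biholomorphisms sending $M$ to $M$.
   Context: A quadratic submanifold of codimension $k$ in $\mathbb{C}^N$ is a real submanifold given, in coordinates $(z,w)\in\mathbb{C}^{N-k}\times\mathbb{C}^k$, by $\operatorname{Im} w_j=zH_jz^*$, $j=1,\dots,k$, where the $H_j$ are Hermitian matrices and $^*$ denotes conjugate transpose. Generic is used in the sense: Levi generating with non-degenerate Levi map, i.e. the $H_j$ are linearly independent over $\mathbb{R}$ and have trivial common kernel. ''$n$-jets are required (and not less) to determine uniquely germs of biholomorphisms sending $M$ to $M$'' means: any two germs at $0$ of biholomorphic maps of the ambient complex space sending $M$ into $M$ with the same $n$-jet at $0$ coincide, while there are two distinct such germs having the same $(n-1)$-jet at $0$. *)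

(* Defs.v *)
From HB Require Import structures.
From mathcomp Require Import all_boot all_order all_algebra.
From mathcomp Require Import sesquilinear spectral.
From mathcomp Require Import all_classical all_reals all_analysis.
Import Order.TTheory GRing.Theory Num.Theory.
Import numFieldNormedType.Exports.

Set Implicit Arguments.
Unset Strict Implicit.
Unset Printing Implicit Defensive.

Local Open Scope classical_set_scope.
Local Open Scope ring_scope.
Local Open Scope sesquilinear_scope.

(* Everything is stated over an arbitrary numClosedFieldType C, whose norm
   topology is already canonical in MathComp-Analysis; it is meant to be used
   with C = R[i] for a realType R.  Points of C^N are row vectors; the
   coordinates (z, w) of p : 'rV[C]_(d + k) are lsubmx p and rsubmx p. *)

Section Germs.
Context {C : numClosedFieldType} {N : nat}.
Implicit Types (F G : 'rV[C]_N -> 'rV[C]_N) (p : 'rV[C]_N) (M : set 'rV[C]_N).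

(* [differentiable] is over the scalar field C, i.e. complex differentiability. *)
Definition holomorphic_near p F : Prop :=
  \forall x \near p, differentiable F x.

Definition biholomorphic_near p F : Prop :=
  holomorphic_near p F /\
  exists G, [/\ holomorphic_near (F p) G,
                \forall x \near p, G (F x) = x
              & \forall y \near F p, F (G y) = y].

(* Germs at p are represented by functions that are total but constrained only
   near p. *)
Definition germ_eq p F G : Prop := \forall x \near p, F x = G x.

Definition sends_into p M F : Prop := \forall x \near p, M x -> M (F x).

Definition automorphism_germ p M F : Prop :=
  biholomorphic_near p F /\ sends_into p M F.

(* [partials [:: i1; ...; ir] F] is d/dx_i1 (... (d/dx_ir F)). *)
Definition partials (s : seq 'I_N) F : 'rV[C]_N -> 'rV[C]_N :=
  foldr (fun (i : 'I_N) E x => 'D_(delta_mx 0 i) E x) F s.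

Definition same_jet (n : nat) p F G : Prop :=
  forall s : seq 'I_N, (size s <= n)%N -> partials s F p = partials s G p.

(* Intended for n >= 1. *)
Definition jets_exactly_required (n : nat) p M : Prop :=
  (forall F G, automorphism_germ p M F -> automorphism_germ p M G ->
     same_jet n p F G -> germ_eq p F G) /\
  (exists F G, [/\ automorphism_germ p M F, automorphism_germ p M G,
     same_jet n.-1 p F G & ~ germ_eq p F G]).

End Germs.

Section Quadrics.
Context {C : numClosedFieldType} {d k : nat}.
Implicit Types (H : 'I_k -> 'M[C]_d).

Definition quadric H : set 'rV[C]_(d + k) :=
  [set p | forall j : 'I_k,
     'Im (rsubmx p 0 j) = (lsubmx p *m H j *m (lsubmx p) ^t*) 0 0].

Definition hermitian_family H : Prop := forall j, H j \is hermsymmx.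

Definition real_independent H : Prop :=
  forall c : 'I_k -> C, (forall j, c j \is Num.real) ->
    \sum_j c j *: H j = 0 -> forall j, c j = 0.

(* z H_j = 0 iff H_j z^* = 0 for Hermitian H_j, so row and column kernels give
   the same condition. *)
Definition trivial_common_kernel H : Prop :=
  forall z : 'rV[C]_d, (forall j, z *m H j = 0) -> z = 0.

Definition generic H : Prop := real_independent H /\ trivial_common_kernel H.

End Quadrics.

(* Main.v *)
(** Uniqueness.  Let F and G be automorphism germs of a quadric with the same
    n-jet.  A translation of the quadric brings G(0) to 0.  In the weighted Taylor
    expansion where z has weight 1 and w has weight 2, the lowest part of F - G,
    read through the linear part of G, is a polynomial solution (p, q) of
    Im q = 2 Re <p, z> on the quadric, of order larger than n at 0.  Polarise this
    equation, with B(z, eta) = (z H_j eta^T)_j, replace (z, eta) by (l z, eta / l)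
    and compare the powers of l: the coefficients of p and q in z are polynomials
    of degree at most 2 in w along every direction B(x, y), hence of degree at most
    2r along the line spanned by a sum of r such vectors.  If every vector is a sum
    of r values of B and 2r <= n, they vanish (with some additional care for p when
    2r = n, where x is chosen so that the dependence on B(x, y) is affine).

    Sharpness.  Take z = (a, b, c) and w = (w_1, w_0, w_s), where the equations of
    w_1 are the entries of the hermitian matrix a^* a in case (a) and of its
    imaginary part in case (b), that of w_0 is Im w_0 = 2 Re (b a^* ), and those of
    w_s are Im w_s = |c_s|^2.  Write W for the matrix with entries w_1 and D(x, a, W)
    for the determinant of W bordered by x and a.  The shear adding
    (-det W D(e_j, a, W))_j to b and (det W)^2 to w_0 preserves the quadric in
    case (a); the shear adding (i D(e_j, a, W))_j to b does so in case (b).  Both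
    are the identity plus a homogeneous map of degree n.  Rank one matrices, resp.
    wedges of two vectors, express every W as a sum of r = m, resp. (n - 1) / 2
    terms. *)
Require Import Defs.
From HB Require Import structures.
From mathcomp Require Import all_boot all_order all_algebra.
From mathcomp Require Import sesquilinear spectral.
From mathcomp Require Import all_classical all_reals all_analysis.
From mathcomp Require Import complex.
From mathcomp Require Import ring lra zify.
Import Order.TTheory GRing.Theory Num.Theory.
Import numFieldNormedType.Exports.

Set Implicit Arguments.
Unset Strict Implicit.
Unset Printing Implicit Defensive.

Local Open Scope classical_set_scope.
Local Open Scope ring_scope.
Local Open Scope complex_scope.

(** A holomorphic germ is only known to be complex differentiable near the origin, so its Taylor
    expansion has to be built first, from Goursat's argument and Cauchy's formula.

    The uniqueness proof plays a degree bound against an order of vanishing. The order is taken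
    along the lines t -> (t z, t u), where z and w scale alike, and every weighted component of F -
    G inherits order at least n + 1 there. Against this, 2r <= n suffices for q and for the part of
    p at z = 0. Once these vanish, p is linear in z: one factor t is spent on z and only order n
    remains for the dependence on w. This is why 2r = n is a borderline case that asks for more than
    filling the space with sums of r values.

    Sharpness is a matter of low-rank perturbation. On the quadric, W and its conjugate (transposed
    in case (a)) differ by a matrix of rank at most two built from a and its conjugate, and a
    bordered determinant is designed to absorb or to measure such a change. The variables c_s take
    no part in the shears: each raises d and k by one, which reaches every admissible k. *)

Local Notation Re := (@complex.Re (Real.sort _)).
Local Notation Im := (@complex.Im (Real.sort _)).

(** * Cauchy's formula on the unit disc *)

Section RealPrimitive.
Variable R : realType.
Implicit Types f F : R -> R.

(* The base point -1 leaves room on both sides of the interval [0, 1], to which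
   all the integrals below are restricted. *)
Definition rprim f (x : R) : R :=
  \int[@lebesgue_measure R]_(t in `[(-1)%R, x]) f t.

Lemma rprimP f (x : R) : continuous f -> -1 < x -> is_derive x 1 (rprim f) (f x).
Proof.
move=> cf x1.
have xx1 : x < x + 1 by rewrite ltrDl.
have fi : (@lebesgue_measure R).-integrable `[(-1)%R, x + 1] (EFin \o f).
  apply: continuous_compact_integrable; first exact: segment_compact.
  exact/continuous_subspaceT.
have [df fE] := continuous_FTC1_closed xx1 fi x1 (cf x).
have df' : derivable (rprim f) x 1 := df.
have fE' : derive1 (rprim f) x = f x := fE.
rewrite derive1E in fE'.
exact: (@DeriveDef _ _ _ x 1 (rprim f) (f x) df' fE').
Qed.

Lemma MVT_derive F f (a b : R) : a <= b ->
  (forall x, x \in `[a, b]%R -> is_derive x 1 F (f x)) ->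
  exists2 c, c \in `[a, b]%R & F b - F a = f c * (b - a).
Proof.
move=> ab dF.
have H1 x : x \in `]a, b[%R -> is_derive x 1 F (f x).
  by move=> xab; apply: dF; exact: (subset_itv_oo_cc xab).
have H2 : {within `[a, b], continuous F}.
  apply: derivable_within_continuous => x xab.
  exact: (@ex_derive _ _ _ _ _ _ _ (dF x xab)).
exact: (@MVT_segment R F f a b ab H1 H2).
Qed.

End RealPrimitive.

(** * Real-valued modulus of complex numbers *)

Section ComplexNorm.
Variable R : realType.
Local Notation C := R[i].
Implicit Types z w : C.

(** The norm of [R[i]] takes its values in [R[i]]; a modulus in R makes estimates accessible to real
    arithmetic. *)
Definition nm z : R := Re `|z|.

Lemma nmE z : `|z| = (nm z)%:C.
Proof. by rewrite /nm normc_def. Qed.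

Lemma nm_ge0 z : 0 <= nm z.
Proof. by rewrite -ler0c -nmE. Qed.

Lemma nmD z w : nm (z + w) <= nm z + nm w.
Proof. by rewrite -lecR rmorphD /= -!nmE ler_normD. Qed.

Lemma nmM z w : nm (z * w) = nm z * nm w.
Proof. by apply: complexI; rewrite rmorphM /= -!nmE normrM. Qed.

Lemma nmN z : nm (- z) = nm z.
Proof. by rewrite /nm normrN. Qed.

Lemma nmB z w : nm (z - w) = nm (w - z).
Proof. by rewrite -nmN opprB. Qed.

Lemma nm_dist z w : nm (z - w) <= nm z + nm w.
Proof. by rewrite -(nmN w) nmD. Qed.

Lemma nm0 : nm 0 = 0.
Proof. by rewrite /nm normr0. Qed.

Lemma nm0_eq0 z : nm z = 0 -> z = 0.
Proof. by move=> z0; apply: normr0_eq0; rewrite nmE z0. Qed.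

Lemma nm_gt0 z : (0 < nm z) = (z != 0).
Proof.
rewrite lt_neqAle nm_ge0 andbT eq_sym; congr (~~ _).
by apply/eqP/eqP => [/nm0_eq0//|->]; rewrite nm0.
Qed.

Lemma nmV z : nm z^-1 = (nm z)^-1.
Proof. by apply: complexI; rewrite fmorphV /= -!nmE normfV. Qed.

Lemma nmX z n : nm (z ^+ n) = nm z ^+ n.
Proof. by apply: complexI; rewrite rmorphXn /= -!nmE normrX. Qed.

Lemma nm_real (x : R) : nm x%:C = `|x|.
Proof. by rewrite /nm normc_def /= expr0n addr0 sqrtr_sqr. Qed.

Lemma nm_Re z : `|Re z| <= nm z.
Proof. by rewrite -lecR -nmE normc_ge_Re. Qed.

Lemma nm_Im z : `|Im z| <= nm z.
Proof.
have -> : Im z = - Re (z * 'i) by rewrite ReiNIm opprK.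
rewrite normrN (le_trans (nm_Re _))// nmM (_ : nm 'i = 1) ?mulr1//.
by rewrite /nm normc_def /= expr0n add0r expr1n sqrtr1.
Qed.

Lemma nm_ReIm z : nm z <= `|Re z| + `|Im z|.
Proof.
rewrite {1}[z]complexE (le_trans (nmD _ _))// nm_real lerD2l nmM nm_real.
by rewrite (_ : nm 'i = 1) ?mul1r// /nm normc_def /= expr0n add0r expr1n sqrtr1.
Qed.

Lemma nm_sum I (r : seq I) (P : pred I) (F : I -> C) :
  nm (\sum_(i <- r | P i) F i) <= \sum_(i <- r | P i) nm (F i).
Proof.
by elim/big_ind2 : _ => [|x x' y y' h h'|//];
  [rewrite nm0|exact: le_trans (nmD _ _) (lerD h h')].
Qed.

End ComplexNorm.

(** * Continuity, derivatives and integrals of curves R -> C *)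

Section ComplexIntegral.
Variable R : realType.
Local Notation C := R[i].
Implicit Types (f g F G : R -> C) (a b : R) (c : C).

Definition ccont f := forall x, forall e, 0 < e ->
  exists2 d, 0 < d & forall y, `|y - x| < d -> nm (f y - f x) < e.

Definition cderiv F f := forall x : R,
  is_derive x 1 (fun t => Re (F t)) (Re (f x)) /\
  is_derive x 1 (fun t => Im (F t)) (Im (f x)).

(** As a difference of values of one primitive, the integral is additive in its end points by
    definition and makes sense for a > b. *)
Definition cint f a b : C :=
  (rprim (fun t => Re (f t)) b - rprim (fun t => Re (f t)) a) +i*
  (rprim (fun t => Im (f t)) b - rprim (fun t => Im (f t)) a).

Lemma cReB (z w : C) : Re (z - w) = Re z - Re w :> R.
Proof. by case: z w => ? ? []. Qed.
Lemma cImB (z w : C) : Im (z - w) = Im z - Im w :> R.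
Proof. by case: z w => ? ? []. Qed.
Lemma cReD (z w : C) : Re (z + w) = Re z + Re w :> R.
Proof. by case: z w => ? ? []. Qed.
Lemma cImD (z w : C) : Im (z + w) = Im z + Im w :> R.
Proof. by case: z w => ? ? []. Qed.
Lemma cReM (z w : C) : Re (z * w) = Re z * Re w - Im z * Im w :> R.
Proof. by case: z w => ? ? []. Qed.
Lemma cImM (z w : C) : Im (z * w) = Re z * Im w + Im z * Re w :> R.
Proof. by case: z w => ? ? []. Qed.

Lemma cReN (z : C) : Re (- z) = - Re z :> R.
Proof. by case: z. Qed.
Lemma cImN (z : C) : Im (- z) = - Im z :> R.
Proof. by case: z. Qed.

Lemma complex_eq (z w : C) : Re z = Re w -> Im z = Im w -> z = w.
Proof. by case: z w => ? ? [? ?] /= -> ->. Qed.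

Lemma ccont_Re f : ccont f -> continuous (fun t => Re (f t)).
Proof.
move=> cf x; apply/cvgrPdist_lt => e e0; have [d d0 fd] := cf x e e0.
exists d => //= y yd; rewrite -cReB (le_lt_trans (nm_Re _))// nmB fd//.
by rewrite distrC.
Qed.

Lemma ccont_Im f : ccont f -> continuous (fun t => Im (f t)).
Proof.
move=> cf x; apply/cvgrPdist_lt => e e0; have [d d0 fd] := cf x e e0.
exists d => //= y yd; rewrite -cImB (le_lt_trans (nm_Im _))// nmB fd//.
by rewrite distrC.
Qed.

Lemma ccont_ReIm f : continuous (fun t => Re (f t)) ->
  continuous (fun t => Im (f t)) -> ccont f.
Proof.
move=> cr ci x e e0; have e20 : 0 < e / 2 by rewrite divr_gt0.
have /cvgrPdist_lt/(_ _ e20)[d1 /= d10 h1] := cr x.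
have /cvgrPdist_lt/(_ _ e20)[d2 /= d20 h2] := ci x.
exists (Num.min d1 d2); first by rewrite lt_min d10.
move=> y; rewrite lt_min distrC => /andP[y1 y2].
rewrite (le_lt_trans (nm_ReIm _))// cReB cImB (splitr e) ltrD// distrC.
  exact: h1.
exact: h2.
Qed.

Lemma cderiv_cont F f : cderiv F f -> ccont F.
Proof.
move=> dF; apply: ccont_ReIm => x; have [dr di] := dF x.
  apply/differentiable_continuous/derivable1_diffP; exact: dr.(ex_derive).
apply/differentiable_continuous/derivable1_diffP; exact: di.(ex_derive).
Qed.

Lemma ccont_cst c : ccont (fun=> c).
Proof. by move=> x e e0; exists 1 => // y _; rewrite subrr nm0. Qed.

Lemma ccontD f g : ccont f -> ccont g -> ccont (fun t => f t + g t).
Proof.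
move=> cf cg x e e0; have e20 : 0 < e / 2 by rewrite divr_gt0.
have [d1 d10 h1] := cf x _ e20; have [d2 d20 h2] := cg x _ e20.
exists (Num.min d1 d2); first by rewrite lt_min d10.
move=> y; rewrite lt_min => /andP[y1 y2].
rewrite (_ : f y + _ - _ = (f y - f x) + (g y - g x)); last by ring.
by rewrite (le_lt_trans (nmD _ _))// (splitr e) ltrD ?h1 ?h2.
Qed.

Lemma ccontM f g : ccont f -> ccont g -> ccont (fun t => f t * g t).
Proof.
move=> /[dup] /ccont_Re cr /ccont_Im ci /[dup] /ccont_Re dr /ccont_Im di.
apply: ccont_ReIm => x.
  under eq_fun do rewrite cReM.
  by apply: cvgB; apply: cvgM; [exact: cr|exact: dr|exact: ci|exact: di].
under eq_fun do rewrite cImM.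
by apply: cvgD; apply: cvgM; [exact: cr|exact: di|exact: ci|exact: dr].
Qed.

Lemma ccontN f : ccont f -> ccont (fun t => - f t).
Proof.
move=> cf x e e0; have [d d0 fd] := cf x e e0; exists d => // y /fd.
by rewrite -opprD nmN.
Qed.

Lemma ccontB f g : ccont f -> ccont g -> ccont (fun t => f t - g t).
Proof. by move=> cf cg; apply: ccontD => //; exact: ccontN. Qed.

Lemma ccont_sum n (f : 'I_n -> R -> C) :
  (forall i, ccont (f i)) -> ccont (fun t => \sum_i f i t).
Proof.
elim: n f => [f _|n IH f cf].
  by under eq_fun do rewrite big_ord0; exact: ccont_cst.
under eq_fun do rewrite big_ord_recr.
by apply: ccontD; [apply: IH => i; exact: cf|exact: cf].
Qed.

Lemma ccontX f n : ccont f -> ccont (fun t => f t ^+ n).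
Proof.
move=> cf; elim: n => [|n IH]; first exact: ccont_cst.
by under eq_fun do rewrite exprS; exact: ccontM.
Qed.

Lemma ccontV f : ccont f -> (forall t, f t != 0) -> ccont (fun t => (f t)^-1).
Proof.
move=> cf f0 x e e0.
have fx0 : 0 < nm (f x) by rewrite nm_gt0.
pose e1 := Num.min (nm (f x) / 2) (e * (nm (f x)) ^+ 2 / 2).
have e10 : 0 < e1.
  by rewrite lt_min !divr_gt0// mulr_gt0// exprn_gt0.
have [d d0 fd] := cf x _ e10; exists d => // y /fd; rewrite lt_min => /andP[h1 h2].
have h3 : nm (f x) / 2 <= nm (f y).
  have := nmD (f y) (f x - f y); rewrite addrC subrK nmB; lra.
have -> : (f y)^-1 - (f x)^-1 = (f x - f y) / (f x * f y).
  by field; rewrite !f0.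
rewrite nmM nmV nmM ltr_pdivrMr; last by rewrite mulr_gt0// nm_gt0.
rewrite nmB (lt_le_trans h2)//.
have := ler_wpM2l (ltW e0) (ler_wpM2l (ltW fx0) h3); lra.
Qed.

Lemma cderivM F f G g : cderiv F f -> cderiv G g ->
  cderiv (fun t => F t * G t) (fun t => f t * G t + F t * g t).
Proof.
move=> dF dG x; have [fr fi] := dF x; have [gr gi] := dG x.
split.
  under eq_fun do rewrite cReM.
  have h := is_deriveB (is_deriveM fr gr) (is_deriveM fi gi).
  apply: (is_derive_eq h); rewrite /GRing.scale /= cReD !cReM; ring.
under eq_fun do rewrite cImM.
have h := is_deriveD (is_deriveM fr gi) (is_deriveM fi gr).
apply: (is_derive_eq h); rewrite /GRing.scale /= cImD !cImM; ring.
Qed.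

Lemma cderiv_cst c : cderiv (fun=> c) (fun=> 0).
Proof. by move=> x; split; exact: is_derive_cst. Qed.

Lemma cderivZ c F f : cderiv F f -> cderiv (fun t => c * F t) (fun t => c * f t).
Proof.
move=> dF; have := cderivM (cderiv_cst c) dF.
by congr cderiv; apply/funext => t; rewrite mul0r add0r.
Qed.

Lemma cderiv_eq F f g : cderiv F f -> f =1 g -> cderiv F g.
Proof. by move=> ? /funext <-. Qed.

Lemma cint_ftc F f a b : ccont f -> cderiv F f -> 0 <= a -> 0 <= b ->
  cint f a b = F b - F a.
Proof.
move=> cf dF.
have key (p q : R -> R) : continuous q -> (forall x : R, is_derive x 1 p (q x)) ->
    0 <= a -> 0 <= b -> rprim q b - rprim q a = p b - p a.
  move=> cq dp; wlog ab : a b / a <= b.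
    move=> W a0 b0; case: (leP a b) => [|/ltW] ab; first exact: W.
    by apply: oppr_inj; rewrite !opprB; apply: W.
  move=> a0 b0.
  have [|c _] := @MVT_derive R (rprim q \- p) (fun=> 0) a b ab.
    move=> x; rewrite in_itv /= => /andP[ax _].
    have ? := rprimP cq (lt_le_trans (ltrN10 R) (le_trans a0 ax)).
    have ? := dp x; rewrite -(subrr (q x)); exact: is_deriveB.
  by rewrite mul0r /= => h; lra.
move=> a0 b0; apply: complex_eq; rewrite ?cReB ?cImB /=.
  apply: (key (fun t => Re (F t)) _ (ccont_Re cf) _ a0 b0).
  by move=> x; have [] := dF x.
apply: (key (fun t => Im (F t)) _ (ccont_Im cf) _ a0 b0).
by move=> x; have [] := dF x.
Qed.

End ComplexIntegral.

Section IntegralLinearity.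
Variable R : realType.
Local Notation C := R[i].
Implicit Types (f g F G : R -> C) (a b : R) (c : C).

(** The derivative is asked for on x > -1 only, so that combinations of [rprim] themselves qualify
    as p; linearity of the integral follows from this. *)
Lemma rprim_ftc (p q : R -> R) (a b : R) : continuous q ->
  (forall x : R, -1 < x -> is_derive x 1 p (q x)) -> 0 <= a -> 0 <= b ->
  rprim q b - rprim q a = p b - p a.
Proof.
move=> cq dp; wlog ab : a b / a <= b.
  move=> W a0 b0; case: (leP a b) => [|/ltW] ab; first exact: W.
  by apply: oppr_inj; rewrite !opprB; apply: W.
move=> a0 b0.
have [|c _] := @MVT_derive R (rprim q \- p) (fun=> 0) a b ab.
  move=> x; rewrite in_itv /= => /andP[ax _].
  have x1 := lt_le_trans (ltrN10 R) (le_trans a0 ax).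
  have h1 := rprimP cq x1; have h2 := dp x x1.
  rewrite -(subrr (q x)); exact: is_deriveB.
by rewrite mul0r /= => h; lra.
Qed.

Lemma rprim_lin (p q : R -> R) (u v a b : R) :
  continuous p -> continuous q -> 0 <= a -> 0 <= b ->
  rprim (fun t => u * p t + v * q t) b - rprim (fun t => u * p t + v * q t) a =
  u * (rprim p b - rprim p a) + v * (rprim q b - rprim q a).
Proof.
move=> cp cq a0 b0.
have cpq : continuous (fun t => u * p t + v * q t).
  by move=> x; apply: cvgD; apply: cvgM;
    [exact: cvg_cst|exact: cp|exact: cvg_cst|exact: cq].
have dpq (x : R) : -1 < x ->
    is_derive x 1 (fun t => u * rprim p t + v * rprim q t) (u * p x + v * q x).
  move=> x1; have h1 := rprimP cp x1; have h2 := rprimP cq x1.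
  exact: is_deriveD (is_deriveZ u h1) (is_deriveZ v h2).
rewrite (rprim_ftc cpq dpq a0 b0); ring.
Qed.

Lemma cint_lin c f g a b : ccont f -> ccont g -> 0 <= a -> 0 <= b ->
  cint (fun t => c * f t + g t) a b = c * cint f a b + cint g a b.
Proof.
move=> cf cg a0 b0; have [rf mf] := (ccont_Re cf, ccont_Im cf).
have [rg mg] := (ccont_Re cg, ccont_Im cg).
have lin2 (u v : R) : continuous (fun t => u * Re (f t) + v * Im (f t)).
  by move=> x; apply: cvgD; apply: cvgM; [exact: cvg_cst|exact: rf|exact: cvg_cst|exact: mf].
apply: complex_eq; rewrite ?cReD ?cImD ?cReM ?cImM /=.
  have -> : (fun t => Re (c * f t + g t)) = (fun t =>
      1 * (Re c * Re (f t) + (- Im c) * Im (f t)) + 1 * Re (g t)).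
    by apply/funext => t; rewrite cReD cReM; ring.
  rewrite (rprim_lin 1 1 (lin2 _ _) rg a0 b0) (rprim_lin _ _ rf mf a0 b0).
  ring.
have -> : (fun t => Im (c * f t + g t)) = (fun t =>
    1 * (Im c * Re (f t) + Re c * Im (f t)) + 1 * Im (g t)).
  by apply/funext => t; rewrite cImD cImM; ring.
rewrite (rprim_lin 1 1 (lin2 _ _) mg a0 b0) (rprim_lin _ _ rf mf a0 b0).
ring.
Qed.

Lemma cintC c a b : 0 <= a -> 0 <= b -> cint (fun=> c) a b = c * (b - a)%:C.
Proof.
move=> a0 b0; rewrite (@cint_ftc _ (fun t => c * t%:C))//.
- by rewrite rmorphB mulrBr.
- exact: ccont_cst.
- rewrite -[X in cderiv _ X]/(fun=> c) => x; split.
    under eq_fun do rewrite cReM /= mulr0 subr0.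
    have h := @is_deriveZ R _ _ id (Re c) x 1 1 (is_derive_id x 1).
    by apply: (is_derive_eq h); rewrite /GRing.scale /= mulr1.
  under eq_fun do rewrite cImM /= mulr0 add0r.
  have h := @is_deriveZ R _ _ id (Im c) x 1 1 (is_derive_id x 1).
  by apply: (is_derive_eq h); rewrite /GRing.scale /= mulr1.
Qed.

Lemma cintZ c f a b : ccont f -> 0 <= a -> 0 <= b ->
  cint (fun t => c * f t) a b = c * cint f a b.
Proof.
move=> cf a0 b0; have := cint_lin c cf (ccont_cst 0) a0 b0.
rewrite cintC// mul0r addr0 => <-; congr cint.
by apply/funext => t; rewrite addr0.
Qed.

Lemma cintD f g a b : ccont f -> ccont g -> 0 <= a -> 0 <= b ->
  cint (fun t => f t + g t) a b = cint f a b + cint g a b.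
Proof.
move=> cf cg a0 b0; have := cint_lin 1 cf cg a0 b0.
by rewrite mul1r => <-; congr cint; apply/funext => t; rewrite mul1r.
Qed.

Lemma cintB f g a b : ccont f -> ccont g -> 0 <= a -> 0 <= b ->
  cint (fun t => f t - g t) a b = cint f a b - cint g a b.
Proof.
move=> cf cg a0 b0; have := cint_lin (-1) cg cf a0 b0.
rewrite mulN1r addrC => <-; congr cint.
by apply/funext => t; rewrite mulN1r addrC.
Qed.

Lemma cint_sum n (f : 'I_n -> R -> C) a b : (forall i, ccont (f i)) ->
  0 <= a -> 0 <= b ->
  cint (fun t => \sum_i f i t) a b = \sum_i cint (f i) a b.
Proof.
move=> cf a0 b0; elim: n f cf => [f _|n IH f cf].
  under eq_fun do rewrite big_ord0; rewrite cintC// big_ord0; exact: mul0r.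
under eq_fun do rewrite big_ord_recr.
by rewrite cintD// ?IH ?big_ord_recr//; exact: ccont_sum.
Qed.

(** The factor 2 comes from bounding the real and imaginary parts separately, each by the mean value
    theorem. *)
Lemma cint_bound f a b M : ccont f -> 0 <= a -> a <= b ->
  (forall t, a <= t <= b -> nm (f t) <= M) ->
  nm (cint f a b) <= 2 * M * (b - a).
Proof.
move=> cf a0 ab fM.
have key (q : R -> R) : continuous q -> (forall t, a <= t <= b -> `|q t| <= M) ->
    `|rprim q b - rprim q a| <= M * (b - a).
  move=> cq qM.
  have [|c] := @MVT_derive R (rprim q) q a b ab.
    move=> x; rewrite in_itv /= => /andP[ax _].
    by have := rprimP cq (lt_le_trans (ltrN10 R) (le_trans a0 ax)).
  rewrite in_itv /= => cab ->; rewrite normrM (@ger0_norm _ (b - a)) ?subr_ge0//.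
  by rewrite ler_wpM2r ?subr_ge0// qM.
rewrite (le_trans (nm_ReIm _))//=.
have h1 : `|rprim (fun t => Re (f t)) b - rprim (fun t => Re (f t)) a| <= M * (b - a).
  apply: key; [exact: ccont_Re|move=> t /fM; apply: le_trans; exact: nm_Re].
have h2 : `|rprim (fun t => Im (f t)) b - rprim (fun t => Im (f t)) a| <= M * (b - a).
  apply: key; [exact: ccont_Im|move=> t /fM; apply: le_trans; exact: nm_Im].
by lra.
Qed.

Lemma cint_chain f a m b : cint f a m + cint f m b = cint f a b.
Proof. by apply: complex_eq; rewrite ?cReD ?cImD /=; ring. Qed.

End IntegralLinearity.

(** * Goursat's subdivision argument *)

Section NestedRectangles.
Variable R : realType.
Variables (K : R -> R -> R -> R[i]) (t0 s0 T S : R).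
Hypotheses (T0 : 0 <= T) (S0 : 0 <= S).
Hypothesis Kadd : forall t s h, t0 <= t -> s0 <= s -> 0 < h ->
  t + h * T <= t0 + T -> s + h * S <= s0 + S ->
  K t s h = K t s (h / 2) + K (t + h / 2 * T) s (h / 2)
    + K t (s + h / 2 * S) (h / 2) + K (t + h / 2 * T) (s + h / 2 * S) (h / 2).
Hypothesis Kloc : forall t1 s1, t0 <= t1 <= t0 + T -> s0 <= s1 <= s0 + S ->
  forall e, 0 < e -> exists2 d, 0 < d & forall t s h, 0 < h < d ->
    t0 <= t -> s0 <= s -> t + h * T <= t0 + T -> s + h * S <= s0 + S ->
    t <= t1 <= t + h * T -> s <= s1 <= s + h * S -> nm (K t s h) <= e * h ^+ 2.

Let good c (p : R * R) h := c * h ^+ 2 <= nm (K p.1 p.2 h).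

(** The fourth quarter is the default: by the triangle inequality it is good whenever the other
    three are not. *)
Let next c (p : R * R) h : R * R :=
  let h2 := h / 2 in
  if good c p h2 then p else
  if good c (p.1 + h2 * T, p.2) h2 then (p.1 + h2 * T, p.2) else
  if good c (p.1, p.2 + h2 * S) h2 then (p.1, p.2 + h2 * S) else
  (p.1 + h2 * T, p.2 + h2 * S).

Let hh n : R := 2^-1 ^+ n.
Let sq c := fix sq n := if n is n'.+1 then next c (sq n') (hh n') else (t0, s0).

Let hh_gt0 n : 0 < hh n. Proof. by rewrite exprn_gt0// invr_gt0. Qed.
Let hhS n : hh n / 2 = hh n.+1. Proof. by rewrite /hh exprSr. Qed.

Let sq_in c n : [/\ t0 <= (sq c n).1, s0 <= (sq c n).2,
  (sq c n).1 + hh n * T <= t0 + T & (sq c n).2 + hh n * S <= s0 + S].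
Proof.
elim: n => [|n [h1 h2 h3 h4]]; first by rewrite /hh expr0 !mul1r.
have hT := mulr_ge0 (ltW (hh_gt0 n)) T0; have hS := mulr_ge0 (ltW (hh_gt0 n)) S0.
rewrite -hhS /= /next; do 3?[case: ifP => _ /=].
all: split; lra.
Qed.

Let sq_step c n : [/\ (sq c n).1 <= (sq c n.+1).1,
   (sq c n.+1).1 + hh n.+1 * T <= (sq c n).1 + hh n * T,
   (sq c n).2 <= (sq c n.+1).2 &
   (sq c n.+1).2 + hh n.+1 * S <= (sq c n).2 + hh n * S].
Proof.
have hT := mulr_ge0 (ltW (hh_gt0 n)) T0; have hS := mulr_ge0 (ltW (hh_gt0 n)) S0.
rewrite -hhS /= /next; do 3?[case: ifP => _ /=].
all: split; lra.
Qed.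

Let sq_good c n : nm (K t0 s0 1) = c -> good c (sq c n) (hh n).
Proof.
move=> cE; elim: n => [|n IH]; first by rewrite /good /= /hh expr0 expr1n mulr1 cE.
have [h1 h2 h3 h4] := sq_in c n; move: IH.
rewrite -hhS /= /next /good; set p := sq c n; set h := hh n.
rewrite (Kadd h1 h2 (hh_gt0 n) h3 h4) -/p -/h.
case: ifPn => // b1; case: ifPn => // b2; case: ifPn => // b3.
move: b1 b2 b3; rewrite -!ltNge /= => b1 b2 b3.
set z4 := K (_ + _) (_ + _) _.
set z1 := K _ _ _ in b1 *; set z2 := K _ _ _ in b2 *; set z3 := K _ _ _ in b3 *.
have := nmD (z1 + z2 + z3) z4; have := nmD (z1 + z2) z3; have := nmD z1 z2.
rewrite (_ : c * h ^+ 2 = 4 * (c * (h / 2) ^+ 2)); last by field.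
lra.
Qed.

Lemma nested_limit (u v : nat -> R) : (forall n, u n <= u n.+1) ->
  (forall n, v n.+1 <= v n) -> (forall n, u n <= v n) ->
  exists x, forall n, u n <= x <= v n.
Proof.
move=> hu hv huv.
have mu m n : (m <= n)%N -> u m <= u n.
  by move=> /subnK <-; elim: (n - m)%N => // i /le_trans; apply; rewrite addSn.
have mv m n : (m <= n)%N -> v n <= v m.
  move=> /subnK <-; elim: (n - m)%N => // i IH; rewrite addSn.
  exact: le_trans (hv _) IH.
have uv m n : u m <= v n.
  by apply: le_trans (mu _ _ (leq_maxl m n)) (le_trans (huv _) (mv _ _ (leq_maxr m n))).
have su : has_sup (range u).
  by split; [exists (u 0%N), 0%N|exists (v 0%N) => _ [m _ <-]].
exists (sup (range u)) => n; apply/andP; split.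
  by apply: ub_le_sup; [exact: su.2|exists n].
by apply: ge_sup; [exact: su.1|move=> _ [m _ <-]].
Qed.

(** [K t s h] plays the role of the contour integral around the rectangle with corner (t, s) and
    sides h T, h S. If c = |K t0 s0 1| were positive, repeated bisection would select rectangles
    with |K| >= c h^2 shrinking to a point, whereas [Kloc] at that point with e = c / 2 bounds |K|
    by c h^2 / 2. *)
Lemma goursat_nested : K t0 s0 1 = 0.
Proof.
apply: nm0_eq0; apply/eqP; rewrite -[_ == _]negbK; apply/negP => c0.
set c := nm _ in c0; have {}c0 : 0 < c by rewrite lt_neqAle eq_sym c0 nm_ge0.
have [t1 ht1] : exists t, forall n, (sq c n).1 <= t <= (sq c n).1 + hh n * T.
  apply: nested_limit => n; [by have [] := sq_step c n|by have [] := sq_step c n|].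
  by rewrite lerDl mulr_ge0// ltW.
have [s1 hs1] : exists s, forall n, (sq c n).2 <= s <= (sq c n).2 + hh n * S.
  apply: nested_limit => n; [by have [] := sq_step c n|by have [] := sq_step c n|].
  by rewrite lerDl mulr_ge0// ltW.
have ht0 := ht1 0%N; have hs0 := hs1 0%N; rewrite /= /hh expr0 !mul1r in ht0 hs0.
have c20 : 0 < c / 2 by rewrite divr_gt0.
have [d d0 hd] := Kloc ht0 hs0 c20.
have [n nd] : exists n, hh n < d.
  have := @cvg_expr R 2^-1; rewrite ger0_norm// => /(_ _)/cvgrPdist_lt.
  move=> /(_ _ d d0)[|n _ /(_ n (leqnn n))]; first by rewrite invf_lt1// ltr1n.
  by rewrite sub0r normrN ger0_norm ?exprn_ge0//; exists n.
have [h1 h2 h3 h4] := sq_in c n.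
have hn : 0 < hh n < d by rewrite hh_gt0.
have := hd _ _ _ hn h1 h2 h3 h4 (ht1 n) (hs1 n).
apply/negP; rewrite -ltNge; apply: lt_le_trans (@sq_good c n erefl).
by rewrite ltr_pM2r ?exprn_gt0//; lra.
Qed.

End NestedRectangles.

(** * The unit circle as a curve over [0, 1] *)

Section Circle.
Variable R : realType.
Local Notation C := R[i].

Definition tpi : C := locked ((pi *+ 2)%:C * 'i).
(** The exponential exp(2 i pi t); [Ei] is its inverse and conjugate, and [tpi] is 2 i pi. *)
Definition E (t : R) : C := cos (pi *+ 2 * t) +i* sin (pi *+ 2 * t).
Definition Ei (t : R) : C := cos (pi *+ 2 * t) -i* sin (pi *+ 2 * t).

Lemma nmEt (t : R) : nm (E t) = 1.
Proof. by rewrite /nm normc_def /= cos2Dsin2 sqrtr1. Qed.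

Lemma EEi (t : R) : E t * Ei t = 1.
Proof.
apply: complex_eq; rewrite ?cReM ?cImM /=; last by ring.
by rewrite -(cos2Dsin2 (pi *+ 2 * t)); ring.
Qed.

Lemma E_neq0 (t : R) : E t != 0.
Proof. by rewrite -nm_gt0 nmEt. Qed.

Lemma EiE (t : R) : Ei t = (E t)^-1.
Proof. by apply: (mulfI (E_neq0 t)); rewrite EEi mulfV ?E_neq0. Qed.

Lemma nmEi (t : R) : nm (Ei t) = 1.
Proof. by rewrite EiE nmV nmEt invr1. Qed.

Lemma E01 : E 1 = E 0.
Proof. by rewrite /E mulr1 mulr0 cos2pi sin2pi cos0 sin0. Qed.

Lemma Ei01 : Ei 1 = Ei 0.
Proof. by rewrite !EiE E01. Qed.

Lemma derive_cos2pi (x : R) : is_derive x 1 (fun t : R => cos (pi *+ 2 * t))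
  (- (pi *+ 2) * sin (pi *+ 2 * x)).
Proof.
have h1 := is_deriveZ (pi *+ 2 : R) (is_derive_id x (1 : R)).
have h2 := is_derive_cos (pi *+ 2 * x : R).
have h := is_derive1_comp h2 h1.
by apply: (is_derive_eq h); rewrite /GRing.scale /=; ring.
Qed.

Lemma derive_sin2pi (x : R) : is_derive x 1 (fun t : R => sin (pi *+ 2 * t))
  (pi *+ 2 * cos (pi *+ 2 * x)).
Proof.
have h1 := is_deriveZ (pi *+ 2 : R) (is_derive_id x (1 : R)).
have h2 := is_derive_sin (pi *+ 2 * x : R).
have h := is_derive1_comp h2 h1.
by apply: (is_derive_eq h); rewrite /GRing.scale /=; ring.
Qed.

Lemma cderivE : cderiv E (fun t => tpi * E t).
Proof.
move=> x; rewrite /E /tpi -lock cReM cImM cReM cImM /=; split.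
  by apply: (is_derive_eq (derive_cos2pi x)); ring.
by apply: (is_derive_eq (derive_sin2pi x)); ring.
Qed.

Lemma cderivEi : cderiv Ei (fun t => - tpi * Ei t).
Proof.
move=> x; rewrite /Ei /tpi -lock cReM cImM !cReN !cImN cReM cImM /=; split.
  by apply: (is_derive_eq (derive_cos2pi x)); ring.
by apply: (is_derive_eq (is_deriveN (derive_sin2pi x))); ring.
Qed.

Lemma cderivEiX n : cderiv (fun t => Ei t ^+ n) (fun t => - tpi *+ n * Ei t ^+ n).
Proof.
elim: n => [|n IH].
  by apply: (cderiv_eq (cderiv_cst 1)) => t; rewrite mulr0n mul0r.
have -> : (fun t => Ei t ^+ n.+1) = (fun t => Ei t * Ei t ^+ n).
  by apply/funext => t; rewrite exprS.
apply: (cderiv_eq (cderivM cderivEi IH)) => t.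
by rewrite mulrSr exprS; ring.
Qed.

Lemma ccontE : ccont E. Proof. exact: cderiv_cont cderivE. Qed.
Lemma ccontEi : ccont Ei. Proof. exact: cderiv_cont cderivEi. Qed.

Lemma tpi_neq0 : tpi != 0.
Proof.
rewrite /tpi -lock mulf_neq0//; last by rewrite eq_complex /= oner_eq0 andbF.
by rewrite -nm_gt0 nm_real normr_gt0 mulrn_eq0 /= gt_eqF// pi_gt0.
Qed.

Lemma cintEiX n : (0 < n)%N -> cint (fun t => Ei t ^+ n) 0 1 = 0.
Proof.
move=> n0; have h := cderivZ ((- tpi *+ n)^-1) (cderivEiX n).
have nz : - tpi *+ n != 0.
  by rewrite mulNrn oppr_eq0 mulrn_eq0 negb_or -lt0n n0 tpi_neq0.
rewrite (cint_ftc _ (cderiv_eq h _)) ?ler01 ?lexx ?Ei01 ?subrr//.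
- exact/ccontX/ccontEi.
- by move=> t /=; rewrite mulKf.
Qed.

Lemma E_lip (s t : R) : 0 <= s -> 0 <= t ->
  nm (E t - E s) <= 2 * nm tpi * `|t - s|.
Proof.
move=> s0 t0; wlog st : s t s0 t0 / s <= t.
  move=> W; case: (leP s t) => [|/ltW] st; first exact: W.
  by rewrite nmB distrC; exact: W.
have cE' : ccont (fun t => tpi * E t) by apply: ccontM; [exact: ccont_cst|exact: ccontE].
rewrite -(cint_ftc cE' cderivE)// ger0_norm ?subr_ge0//.
by apply: cint_bound => // u _; rewrite nmM nmEt mulr1.
Qed.

End Circle.

(** * Cauchy's formula and the Taylor estimate on the unit disc *)

Section CauchyFormula.
Variable R : realType.
Local Notation C := R[i].
Implicit Types (f : C -> C) (z l a : C).

Definition cdiff_at f z l := forall e : R, 0 < e ->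
  exists2 d : R, 0 < d &
    forall w : C, nm w < d -> nm (f (z + w) - f z - l * w) <= e * nm w.

Definition ccontC f z := forall e : R, 0 < e ->
  exists2 d : R, 0 < d & forall w : C, nm w < d -> nm (f (z + w) - f z) < e.

Lemma cdiff_cont f z l : cdiff_at f z l -> ccontC f z.
Proof.
move=> df e e0; have [d d0 h] := df 1 ltr01.
have c0 : 0 < 1 + nm l by rewrite ltr_wpDr ?nm_ge0.
exists (Num.min d (e / (1 + nm l))); first by rewrite lt_min d0 divr_gt0.
move=> w; rewrite lt_min => /andP[w1]; rewrite ltr_pdivlMr// => w2.
apply: le_lt_trans w2.
rewrite (_ : f (z + w) - f z = (f (z + w) - f z - l * w) + l * w); last by ring.
by rewrite (le_trans (nmD _ _))// nmM; have := h w w1; lra.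
Qed.

Lemma ccont_comp f (g : R -> C) : (forall t, ccontC f (g t)) -> ccont g ->
  ccont (fun t => f (g t)).
Proof.
move=> cf cg x e e0; have [d d0 h] := cf x e e0; have [d' d'0 h'] := cg x d d0.
by exists d' => // y /h' /h; rewrite subrKC.
Qed.

Variables (f : C -> C) (a : C).
Hypothesis df : forall z, nm z <= 1 -> exists l, cdiff_at f z l.
Hypothesis a1 : nm a < 1.

(** The Cauchy kernel dz / (z - a), pulled back along z = [E t]. *)
Let k (t : R) : C := tpi R * E t / (E t - a).

Let Ea (t : R) : 1 - nm a <= nm (E t - a).
Proof.
have := nmD (E t - a) a; rewrite subrK nmEt; lra.
Qed.

Let Ea0 (t : R) : E t - a != 0.
Proof. by rewrite -nm_gt0 (lt_le_trans _ (Ea t))// subr_gt0. Qed.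

Let ck : ccont k.
Proof.
apply: ccontM; first by apply: ccontM; [exact: ccont_cst|exact: ccontE].
by apply: ccontV => //; apply: ccontB; [exact: ccontE|exact: ccont_cst].
Qed.

Let Bk := nm (tpi R) / (1 - nm a).
Let nmk t : nm (k t) <= Bk.
Proof.
have t0 : 0 < nm (tpi R) by rewrite nm_gt0 tpi_neq0.
rewrite /k /Bk !nmM nmEt mulr1 nmV ler_pM2l//.
by rewrite lef_pV2 ?posrE ?nm_gt0// ?subr_gt0.
Qed.

Let nm_seg (t s : R) : 0 <= t <= 1 -> nm (a + t%:C * (E s - a)) <= 1.
Proof.
move=> /andP[t0 t1]; rewrite (_ : _ + _ = (1 - t)%:C * a + t%:C * E s); last first.
  by rewrite rmorphB rmorph1; ring.
rewrite (le_trans (nmD _ _))// !nmM !nm_real nmEt !ger0_norm ?subr_ge0//.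
have := ler_wpM2l (_ : 0 <= 1 - t) (ltW a1); rewrite subr_ge0 => /(_ t1); lra.
Qed.

Section Homotopy.
Variable dl : R.
Hypothesis dl01 : 0 < dl < 1.
Let dl0 : 0 < dl. Proof. by case/andP: dl01. Qed.
Let dl1 : dl < 1. Proof. by case/andP: dl01. Qed.

(** Clamps t to [dl, 1]: [ccont] quantifies over all of R, and 1 / t has to stay continuous
    there. *)
Let cl (t : R) := Num.max dl (Num.min t 1).
Let cl_dl t : dl <= cl t. Proof. by rewrite /cl le_max lexx. Qed.
Let cl_1 t : cl t <= 1.
Proof. by rewrite /cl ge_max (ltW dl1) ge_min lexx orbT. Qed.
Let clE t : dl <= t <= 1 -> cl t = t.
Proof. by move=> /andP[t0 t1]; rewrite /cl min_l// max_r. Qed.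
Let cl_gt0 t : 0 < cl t. Proof. exact: lt_le_trans (cl_dl t). Qed.

Let ccl : ccont (fun t => (cl t)%:C).
Proof.
have lip x y : x <= y -> 0 <= cl y - cl x <= y - x.
  rewrite /cl /Num.max /Num.min; move: dl1.
  by do 4?[case: ifPn; rewrite -?leNgt]; lra.
move=> x e e0; exists e => // y; apply: le_lt_trans.
rewrite -rmorphB nm_real; case: (leP x y) => [|/ltW] xy; last first.
  rewrite distrC (distrC y).
all: by have /andP[? ?] := lip _ _ xy; rewrite !ger0_norm// subr_ge0.
Qed.

Let G t s : C := a + (cl t)%:C * (E s - a).
Let P t s : C := f (G t s) * k s.
Let Q t s : C := f (G t s) * ((cl t)%:C)^-1.

Let G1 t s : nm (G t s) <= 1.
Proof. by apply: nm_seg; rewrite cl_1 ltW. Qed.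

Let cfG t s : ccontC f (G t s).
Proof. by have [l /cdiff_cont] := df (G1 t s). Qed.

Let cP t : ccont (P t).
Proof.
apply: ccontM => //; apply: ccont_comp => //.
apply: ccontD; first exact: ccont_cst.
apply: ccontM; first exact: ccont_cst.
by apply: ccontB; [exact: ccontE|exact: ccont_cst].
Qed.

Let cIcl : ccont (fun t => ((cl t)%:C)^-1).
Proof. by apply: ccontV => // t; rewrite -nm_gt0 nm_real gtr0_norm. Qed.

Let cQ s : ccont (fun t => Q t s).
Proof.
apply: ccontM => //; apply: (@ccont_comp f (fun t => G t s)) => //.
apply: ccontD; first exact: ccont_cst.
by apply: ccontM => //; exact: ccont_cst.
Qed.

(* The integral of f(z) dz / (z - a) along the boundary of the image under G of a
   rectangle, where G contracts the unit circle to a: in the coordinates (t, s)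
   the form is f(G) (k ds + dt / t), which has no pole at a when t >= dl. *)
Let K t s h := cint (P (t + h * (1 - dl))) s (s + h * 1) - cint (P t) s (s + h * 1)
  - (cint (fun u => Q u (s + h * 1)) t (t + h * (1 - dl))
     - cint (fun u => Q u s) t (t + h * (1 - dl))).

Let Kadd t s h : K t s h =
    K t s (h / 2) + K (t + h / 2 * (1 - dl)) s (h / 2)
    + K t (s + h / 2 * 1) (h / 2)
    + K (t + h / 2 * (1 - dl)) (s + h / 2 * 1) (h / 2).
Proof.
rewrite /K.
have -> : t + h / 2 * (1 - dl) + h / 2 * (1 - dl) = t + h * (1 - dl) by field.
have -> : s + h / 2 * 1 + h / 2 * 1 = s + h * 1 by field.
set t2 := t + h / 2 * _; set t3 := t + _; set s2 := s + h / 2 * _; set s3 := s + _.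
rewrite -(cint_chain (P t3) s s2 s3) -(cint_chain (P t) s s2 s3).
rewrite -(cint_chain (Q^~ s3) t t2 t3) -(cint_chain (Q^~ s) t t2 t3).
by repeat match goal with |- context [cint ?u ?v ?w] =>
  generalize (cint u v w); intro end; ring.
Qed.

(** Near z = [G t1 s1], f is its affine approximation al + l z up to o(h). The affine part
    contributes nothing around the rectangle, since its integrals over opposite sides cancel
    explicitly; the error is integrated over four sides of length O(h). *)
Let Kloc t1 s1 : dl <= t1 <= dl + (1 - dl) -> 0 <= s1 <= 0 + 1 ->
  forall e, 0 < e -> exists2 d, 0 < d & forall t s h, 0 < h < d ->
    dl <= t -> 0 <= s -> t + h * (1 - dl) <= dl + (1 - dl) -> s + h * 1 <= 0 + 1 ->
    t <= t1 <= t + h * (1 - dl) -> s <= s1 <= s + h * 1 ->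
    nm (K t s h) <= e * h ^+ 2.
Proof.
have dl0' := dl0; have dl1' := dl1; have a1' := a1.
rewrite subrKC add0r => t11 s11 e e0.
have [l dfl] := df (G1 t1 s1).
(* A Lipschitz constant for [G]: |E v - a| <= 2 governs the first variable, 2 |tpi| the second. *)
pose L := 2 + 2 * nm (tpi R); have L0 : 0 < L.
  by rewrite ltr_wpDr// mulr_ge0// nm_ge0.
have Bk0 : 0 <= Bk by apply: le_trans (nm_ge0 _) (nmk 0).
(* Each side costs at most 2 (e / M) L h^2, times [Bk] on two sides and times 1 / dl on the other
   two; this [M] makes the total e h^2. *)
pose M := 4 * L * (Bk + dl^-1); have M0 : 0 < M.
  by rewrite !mulr_gt0// ltr_wpDl// invr_gt0.
have eM0 : 0 < e / M by rewrite divr_gt0.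
have [d d0 hd] := dfl _ eM0.
exists (d / L); first by rewrite divr_gt0.
move=> t s h /andP[h0 hdL] tdl s0 tT sS tt1 ss1.
rewrite !mulr1 in sS ss1 *.
have hT : 0 <= h * (1 - dl) <= h.
  have := mulr_ge0 (ltW h0) (ltW dl0); have := mulr_gt0 h0 (_ : 0 < 1 - dl).
  by rewrite subr_gt0 => /(_ dl1); lra.
rewrite /K mulr1; set t' := t + _; set s' := s + h in sS ss1 *.
pose z := G t1 s1; pose al := f z - l * z.
have box u v : t <= u <= t' -> s <= v <= s' ->
    nm (f (G u v) - al - l * G u v) <= e / M * (L * h).
  move=> ut vs.
  have clu : cl u = u by apply: clE; rewrite /t' in ut; lra.
  have clt1 : cl t1 = t1 by exact: clE.
  have dG : nm (G u v - z) <= L * h.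
    have -> : G u v - z = (u - t1)%:C * (E v - a) + t1%:C * (E v - E s1).
      by rewrite /z /G clu clt1 rmorphB; ring.
    rewrite (le_trans (nmD _ _))// !nmM !nm_real.
    have Ev : nm (E v - a) <= 2.
      have := nm_dist (E v) a; rewrite nmEt => /le_trans; apply.
      by move: a1; lra.
    have ut1 : `|u - t1| <= h by rewrite ler_norml; rewrite /t' in ut tt1; lra.
    have vs1 : `|v - s1| <= h by rewrite ler_norml; rewrite /s' in vs ss1; lra.
    have t1n : `|t1| <= 1 by rewrite ger0_norm; lra.
    have h1 := ler_pM (normr_ge0 _) (nm_ge0 _) ut1 Ev.
    have hE : nm (E v - E s1) <= 2 * nm (tpi R) * h.
      apply: le_trans (E_lip _ _) _; rewrite ?ler_wpM2l ?mulr_ge0 ?nm_ge0//; lra.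
    have h2 := ler_pM (normr_ge0 _) (nm_ge0 _) t1n hE.
    by rewrite /L; lra.
  have wd : nm (G u v - z) < d.
    by apply: le_lt_trans dG _; rewrite mulrC -ltr_pdivlMr.
  have := hd _ wd; rewrite subrKC => hd'.
  have -> : f (G u v) - al - l * G u v = f (G u v) - f z - l * (G u v - z).
    by rewrite /al; ring.
  by apply: le_trans hd' _; rewrite ler_wpM2l// ltW.
have ss' : s <= s' by rewrite lerDl ltW.
have tt' : t <= t' by rewrite /t'; lra.
have t'1 : t' <= 1 by [].
have s'0 : 0 <= s' := le_trans s0 ss'.
have t0 : 0 <= t by exact: le_trans (ltW dl0) tdl.
have t'0 : 0 <= t' := le_trans t0 tt'.
(* On the image of [G] the affine approximation is b + l u (E v - a). Multiplied by k v or by 1 / u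
   it becomes b times that factor plus a term integrable in closed form; [rP] and [rQ] are what
   remains of the integrands. *)
pose b := al + l * a.
pose rP u v := P u v - (b * k v + l * u%:C * (tpi R * E v)).
pose rQ v u := Q u v - (b * ((cl u)%:C)^-1 + l * (E v - a)).
have ctE : ccont (fun v => tpi R * E v).
  by apply: ccontM; [exact: ccont_cst|exact: ccontE].
have cltE (u : R) : ccont (fun v => l * u%:C * (tpi R * E v)).
  by apply: ccontM => //; exact: ccont_cst.
have cbk : ccont (fun v => b * k v) by apply: ccontM => //; exact: ccont_cst.
have cbl : ccont (fun u => b * ((cl u)%:C)^-1).
  by apply: ccontM => //; exact: ccont_cst.
have crP u : ccont (rP u) by apply: ccontB => //; exact: ccontD.
have crQ v : ccont (rQ v).
  by apply: ccontB => //; apply: ccontD => //; exact: ccont_cst.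
have intP u : cint (P u) s s' = b * cint k s s' + l * u%:C * (E s' - E s)
    + cint (rP u) s s'.
  rewrite -(cint_ftc ctE (@cderivE R))// -!cintZ// -!cintD//; last exact: ccontD.
  by congr cint; apply/funext => v; rewrite /rP subrKC.
have intQ v : cint (Q^~ v) t t' = b * cint (fun u => ((cl u)%:C)^-1) t t'
    + l * (E v - a) * (t' - t)%:C + cint (rQ v) t t'.
  rewrite -[l * _ * _](@cintC _ (l * (E v - a)))// -!cintZ// -!cintD//.
  - by congr cint; apply/funext => u; rewrite /rQ subrKC.
  - by apply: ccontD => //; exact: ccont_cst.
  - exact: ccont_cst.
rewrite !intP !intQ.
rewrite (_ : _ - _ = cint (rP t') s s' - cint (rP t) s s'
   - (cint (rQ s') t t' - cint (rQ s) t t')); last first.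
  rewrite rmorphB; repeat match goal with |- context [cint ?u ?v ?w] =>
    generalize (cint u v w); intro end; ring.
have bP u : t <= u <= t' -> nm (cint (rP u) s s') <= 2 * (e / M * (L * h) * Bk) * h.
  move=> ut; have -> : h = s' - s by rewrite /s'; ring.
  apply: cint_bound => // v vs.
  have clu : cl u = u by apply: clE; rewrite /t' in ut; lra.
  have -> : rP u v = (f (G u v) - al - l * G u v) * k v.
    by rewrite /rP /P /b /G /k clu; field; exact: Ea0.
  have -> : s' - s = h by rewrite /s'; ring.
  by rewrite nmM ler_pM ?nm_ge0// box.
have bQ v : s <= v <= s' -> nm (cint (rQ v) t t') <= 2 * (e / M * (L * h) * dl^-1) * h.
  move=> vs.
  have : nm (cint (rQ v) t t') <= 2 * (e / M * (L * h) * dl^-1) * (t' - t).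
    apply: cint_bound => // u ut.
    have clu : cl u = u by apply: clE; rewrite /t' in ut; lra.
    have u0 : u%:C != 0 by rewrite -nm_gt0 nm_real normr_gt0 gt_eqF//; lra.
    have -> : rQ v u = (f (G u v) - al - l * G u v) * (u%:C)^-1.
      by rewrite /rQ /Q /b /G clu; field.
    rewrite nmM ler_pM ?nm_ge0 ?box// nmV nm_real ger0_norm; last by lra.
    have [tu _] := andP ut; have u_dl := le_trans tdl tu.
    by rewrite lef_pV2 ?posrE// (lt_le_trans dl0).
  move=> /le_trans; apply; rewrite ler_wpM2l//; last by rewrite /t'; lra.
  by rewrite !mulr_ge0// ?invr_ge0 ltW.
have b1 := bP t'; have b2 := bP t; have b3 := bQ s'; have b4 := bQ s.
rewrite ?lexx ?tt' ?ss' in b1 b2 b3 b4.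
have {b1 b2 b3 b4} := (b1 isT, b2 isT, b3 isT, b4 isT) => -[[[b1 b2] b3] b4].
have n1 := nm_dist (cint (rP t') s s' - cint (rP t) s s')
  (cint (rQ s') t t' - cint (rQ s) t t').
have n2 := nm_dist (cint (rP t') s s') (cint (rP t) s s').
have n3 := nm_dist (cint (rQ s') t t') (cint (rQ s) t t').
apply: le_trans n1 _; apply: le_trans (lerD n2 n3) _.
apply: le_trans (lerD (lerD b1 b2) (lerD b3 b4)) _.
have eM : e = M * (e / M) by rewrite mulrC divfK// gt_eqF.
rewrite [leRHS](_ : _ = M * (e / M) * h ^+ 2); last by rewrite -eM.
move: (e / M) => x; rewrite /M; generalize Bk (dl^-1) L h => B D L' h'.
by rewrite le_eqVlt; apply/orP; left; apply/eqP; ring.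
Qed.

(** The sides s = 0 and s = 1 of the parameter rectangle carry the same integral because [E] has
    period 1, so only the unit circle and the shrunken circle remain. *)
Lemma circle_homotopy : cint (fun s => f (E s) * k s) 0 1 =
  cint (fun s => f (a + dl%:C * (E s - a)) * k s) 0 1.
Proof.
have dl1' : 0 <= 1 - dl by rewrite subr_ge0 ltW.
have := goursat_nested dl1' (@ler01 R)
  (fun t s h _ _ _ _ _ => Kadd t s h) Kloc.
rewrite /K !mul1r add0r subrKC.
have -> : (fun u => Q u 1) = (fun u => Q u 0).
  by apply/funext => u; rewrite /Q /G E01.
rewrite subrr subr0 => /eqP; rewrite subr_eq0 => /eqP.
rewrite /P /G.
have -> : cl 1 = 1 by apply: clE; rewrite lexx ltW.
have -> : cl dl = dl by apply: clE; rewrite lexx ltW.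
have -> // : (fun s => f (a + 1%:C * (E s - a)) * k s) = (fun s => f (E s) * k s).
by apply/funext => s; rewrite mul1r subrKC.
Qed.

End Homotopy.

(** As dl tends to 0 the shrunken circle collapses to a, where f is continuous. *)
Lemma cauchy_kernel : cint (fun s => f (E s) * k s) 0 1 = f a * cint k 0 1.
Proof.
have [l /cdiff_cont dfa] := df (ltW a1).
apply/eqP; rewrite -subr_eq0; apply/eqP/nm0_eq0/eqP.
rewrite eq_le nm_ge0 andbT; apply/ler_addgt0Pl => e e0; rewrite addr0.
have Bk0 : 0 <= Bk by apply: le_trans (nm_ge0 _) (nmk 0).
have e1 : 0 < e / (2 * Bk + 1) by rewrite divr_gt0//; lra.
have [d d0 hd] := dfa _ e1.
pose dl := Num.min (d / 3) (1 / 2).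
have dl01 : 0 < dl < 1.
  rewrite lt_min divr_gt0//= divr_gt0//= gt_min; apply/orP; right; lra.
have /andP[dl0 dl1] := dl01.
have dld : dl * 2 < d.
  by apply: (@le_lt_trans _ _ (d / 3 * 2)); [rewrite ler_pM2r// ge_min lexx|lra].
have c1 : ccont (fun s => f (a + dl%:C * (E s - a)) * k s).
  apply: ccontM => //; apply: ccont_comp.
    move=> s; have h01 : 0 <= dl <= 1 by rewrite !ltW.
    by have [l' /cdiff_cont] := df (nm_seg s h01).
  apply: ccontD; first exact: ccont_cst.
  apply: ccontM; first exact: ccont_cst.
  by apply: ccontB; [exact: ccontE|exact: ccont_cst].
have c2 : ccont (fun s => f a * k s) by apply: ccontM => //; exact: ccont_cst.
rewrite (circle_homotopy dl01) -cintZ// -cintB//.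
rewrite (_ : e = 2 * (e / (2 * Bk + 1) * (Bk + 2^-1)) * (1 - 0)); last first.
  by field; rewrite gt_eqF//; lra.
apply: cint_bound => //; first exact: ccontB.
move=> s _; rewrite -mulrBl nmM ler_pM ?nm_ge0//; last first.
  by apply: le_trans (nmk s) _; rewrite lerDl invr_ge0.
apply/ltW/hd; rewrite nmM nm_real gtr0_norm//; apply: le_lt_trans dld.
by rewrite ler_pM2l//; have := nm_dist (E s) a; move: a1; rewrite nmEt; lra.
Qed.

Let geo n (s : R) : E s / (E s - a) =
  \sum_(j < n) a ^+ j * Ei s ^+ j + a ^+ n * (Ei s ^+ n * (E s / (E s - a))).
Proof.
elim: n => [|n IH]; first by rewrite big_ord0 add0r !expr0 !mul1r.
rewrite big_ord_recr /= {1}IH -addrA; congr (_ + _).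
have hE : Ei s * E s = 1 by rewrite mulrC EEi.
have -> : a ^+ n.+1 * (Ei s ^+ n.+1 * (E s / (E s - a))) =
    a ^+ n * Ei s ^+ n * (a * ((Ei s * E s) / (E s - a))).
  by rewrite !exprS; ring.
have -> : E s / (E s - a) = 1 + a * (1 / (E s - a)) by field; exact: Ea0.
rewrite hE; ring.
Qed.

Let crem n : ccont (fun s => Ei s ^+ n * (E s / (E s - a))).
Proof.
apply: ccontM; first exact/ccontX/ccontEi.
apply: ccontM; first exact: ccontE.
by apply: ccontV => //; apply: ccontB; [exact: ccontE|exact: ccont_cst].
Qed.

Let rem_bound n s : nm (Ei s ^+ n * (E s / (E s - a))) <= (1 - nm a)^-1.
Proof.
rewrite !nmM nmX nmEi expr1n mul1r nmEt mul1r nmV.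
by rewrite lef_pV2 ?posrE ?nm_gt0 ?subr_gt0.
Qed.

(** Expand the kernel as a geometric series in a / E s: the positive powers of [Ei] integrate to 0,
    the constant term gives 2 i pi, and the remainder tends to 0 because |a| < 1. *)
Lemma cint_kernel : cint k 0 1 = tpi R.
Proof.
apply/eqP; rewrite -subr_eq0; apply/eqP/nm0_eq0/eqP.
rewrite eq_le nm_ge0 andbT; apply/ler_addgt0Pl => e e0; rewrite addr0.
pose B := 2 * (nm (tpi R) * (1 - nm a)^-1).
have B0 : 0 < B by rewrite !mulr_gt0 ?nm_gt0 ?tpi_neq0 ?invr_gt0 ?subr_gt0.
have [n an] : exists n, nm a ^+ n.+1 * B < e.
  have := @cvg_expr R (nm a); rewrite ger0_norm ?nm_ge0// => /(_ a1)/cvgrPdist_lt.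
  move=> /(_ (e / B) (divr_gt0 e0 B0))[m _ /(_ m.+1 (leqnSn m))].
  rewrite sub0r normrN ger0_norm ?exprn_ge0 ?nm_ge0// ltr_pdivlMr//.
  by exists m.
apply: ltW; apply: le_lt_trans an.
have -> : k = (fun s => tpi R * (\sum_(j < n.+1) a ^+ j * Ei s ^+ j +
    a ^+ n.+1 * (Ei s ^+ n.+1 * (E s / (E s - a))))).
  by apply/funext => s; rewrite -geo /k mulrA.
have cE j : ccont (fun s : R => a ^+ j * Ei s ^+ j).
  by apply: ccontM; [exact: ccont_cst|exact/ccontX/ccontEi].
have cr : ccont (fun s => a ^+ n.+1 * (Ei s ^+ n.+1 * (E s / (E s - a)))).
  by apply: ccontM => //; exact: ccont_cst.
have cs : ccont (fun s : R => \sum_(j < n.+1) a ^+ j * Ei s ^+ j).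
  by apply: ccont_sum => j; exact: cE.
rewrite cintZ//; last exact: ccontD.
rewrite cintD// cint_sum//.
rewrite big_ord_recl /= big1 ?addr0; last first.
  by move=> j _; rewrite cintZ ?cintEiX ?mulr0//; exact/ccontX/ccontEi.
have -> : cint (fun s : R => a ^+ 0 * Ei s ^+ 0) 0 1 = 1.
  have -> : (fun s : R => a ^+ 0 * Ei s ^+ 0) = (fun=> 1).
    by apply/funext => s; rewrite !expr0 mulr1.
  by rewrite cintC// subr0 mulr1.
rewrite mulrDr mulr1 addrC addKr cintZ// !nmM nmX.
have h : nm (cint (fun s => Ei s ^+ n.+1 * (E s / (E s - a))) 0 1)
    <= 2 * (1 - nm a)^-1 * (1 - 0).
  by apply: cint_bound => // s _; exact: rem_bound.
rewrite subr0 mulr1 in h.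
have := ler_wpM2l (mulr_ge0 (exprn_ge0 n.+1 (nm_ge0 a)) (nm_ge0 (tpi R))) h.
by rewrite /B; lra.
Qed.

(** The j-th Taylor coefficient of f at 0: on the circle, dz / (2 i pi z) is ds. *)
Definition ccoef (j : nat) : C := cint (fun s => f (E s) * Ei s ^+ j) 0 1.

Let cfE : ccont (fun s => f (E s)).
Proof.
apply: ccont_comp; last exact: ccontE.
by move=> t; have [|l /cdiff_cont//] := @df (E t); rewrite nmEt.
Qed.

(** Cauchy's formula with the geometric series of the kernel stopped after n terms; the last term of
    [geo] is the error. *)
Lemma cauchy_taylor n M : (forall s : R, 0 <= s <= 1 -> nm (f (E s)) <= M) ->
  nm (f a - \sum_(j < n) ccoef j * a ^+ j) <= 2 * (M / (1 - nm a)) * nm a ^+ n.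
Proof.
move=> fM.
have h : f a = cint (fun s => f (E s) * (E s / (E s - a))) 0 1.
  apply: (mulfI (tpi_neq0 R)); rewrite -cintZ//; last first.
    by apply: ccontM => //; have := crem 0; under eq_fun do rewrite mul1r.
  rewrite mulrC -{1}cint_kernel -cauchy_kernel; congr cint; apply/funext => s.
  by rewrite /k; ring.
have cE j : ccont (fun s : R => a ^+ j * (f (E s) * Ei s ^+ j)).
  apply: ccontM; first exact: ccont_cst.
  by apply: ccontM => //; exact/ccontX/ccontEi.
have cr0 : ccont (fun s => f (E s) * (Ei s ^+ n * (E s / (E s - a)))).
  exact: ccontM.
have cr : ccont (fun s => a ^+ n * (f (E s) * (Ei s ^+ n * (E s / (E s - a))))).
  by apply: ccontM => //; exact: ccont_cst.
have -> : f a = \sum_(j < n) ccoef j * a ^+ j +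
    a ^+ n * cint (fun s => f (E s) * (Ei s ^+ n * (E s / (E s - a)))) 0 1.
  rewrite h -cintZ//.
  have -> : \sum_(j < n) ccoef j * a ^+ j =
      cint (fun s => \sum_(j < n) a ^+ j * (f (E s) * Ei s ^+ j)) 0 1.
    rewrite cint_sum//; apply: eq_bigr => j _.
    by rewrite mulrC -cintZ//; apply: ccontM => //; exact/ccontX/ccontEi.
  rewrite -cintD//; last by apply: ccont_sum => j; exact: cE.
  congr cint; apply/funext => s; rewrite {1}(geo n s) mulrDr mulr_sumr.
  congr (_ + _); last by ring.
  by apply: eq_bigr => j _; ring.
rewrite addrC addKr nmM nmX mulrC ler_wpM2r ?exprn_ge0 ?nm_ge0//.
have : nm (cint (fun s => f (E s) * (Ei s ^+ n * (E s / (E s - a)))) 0 1)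
    <= 2 * (M / (1 - nm a)) * (1 - 0).
  by apply: cint_bound => // s s01; rewrite nmM ler_pM ?nm_ge0 ?fM.
by rewrite subr0 mulr1.
Qed.

End CauchyFormula.

(** * Taylor coefficients and derivatives in one variable *)

Section OneVariable.
Variable R : realType.
Local Notation C := R[i].
Implicit Types (f g : C -> C) (z l : C).

Lemma is_derive_eps (F : R -> R) (x d : R) :
  (forall e, 0 < e -> exists2 dl, 0 < dl & forall h, `|h| < dl ->
     `|F (x + h) - F x - d * h| <= e * `|h|) -> is_derive x 1 F d.
Proof.
move=> H.
suff cv : (fun h : R => h^-1 *: ((F \o shift x) (h *: 1) - F x)) @ 0^' --> d.
  by apply: DeriveDef; [exact: cvgP cv|exact: cvg_lim cv].
apply/cvgrPdist_le => e e0; have [dl dl0 hdl] := H e e0.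
exists dl => //= h /=; rewrite sub0r normrN => hd h0.
rewrite /GRing.scale /= mulr1 (_ : d - _ = - (h^-1 * (F (x + h) - F x - d * h))).
  rewrite normrN normrM normfV ler_pdivrMl ?normr_gt0// (mulrC _ e).
  exact: hdl.
by rewrite (addrC h x); field.
Qed.

Lemma eps_is_derive (F : R -> R) (x d : R) : is_derive x 1 F d ->
  forall e, 0 < e -> exists2 dl, 0 < dl & forall h, `|h| < dl ->
     `|F (x + h) - F x - d * h| <= e * `|h|.
Proof.
move=> [dF dE] e e0.
have cv : (fun h : R => h^-1 *: ((F \o shift x) (h *: 1) - F x)) @ 0^' --> d.
  by rewrite -dE; exact: dF.
have /cvgrPdist_le/(_ _ e0)[dl /= dl0 hdl] := cv; exists dl => // h hd.
have [->|h0] := eqVneq h 0; first by rewrite addr0 subrr mulr0 subrr normr0 mulr0.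
have := hdl h; rewrite /= sub0r normrN => /(_ hd h0).
rewrite /GRing.scale /= mulr1.
rewrite (_ : d - _ = - (h^-1 * (F (x + h) - F x - d * h))); last first.
  by rewrite (addrC h x); field.
by rewrite normrN normrM normfV ler_pdivrMl ?normr_gt0// (mulrC _ e).
Qed.

Lemma cderiv_comp f (g g' l : R -> C) : (forall t, cdiff_at f (g t) (l t)) ->
  cderiv g g' -> cderiv (fun t => f (g t)) (fun t => l t * g' t).
Proof.
move=> df dg x.
suff H e : 0 < e -> exists2 dl, 0 < dl & forall h : R, `|h| < dl ->
    nm (f (g (x + h)) - f (g x) - l x * g' x * h%:C) <= e * `|h|.
  split; apply: is_derive_eps => e e0; have [dl dl0 hdl] := H e e0;
    exists dl => // h /hdl; apply: le_trans.
    rewrite (_ : _ - _ - _ = Re (f (g (x + h)) - f (g x) - l x * g' x * h%:C)).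
      exact: nm_Re.
    by rewrite !cReB (cReM _ h%:C) /= mulr0 subr0.
  rewrite (_ : _ - _ - _ = Im (f (g (x + h)) - f (g x) - l x * g' x * h%:C)).
    exact: nm_Im.
  by rewrite !cImB (cImM _ h%:C) /= mulr0 add0r.
move=> e0; set L := nm (l x); set D := nm (g' x).
have L0 : 0 <= L := nm_ge0 _; have D0 : 0 <= D := nm_ge0 _.
have e10 : 0 < e / (2 * (D + 1)) by rewrite divr_gt0//; lra.
have e20 : 0 < Num.min (2^-1) (e / (4 * (L + 1))).
  by rewrite lt_min invr_gt0 ltr0n divr_gt0//; lra.
have [d1 d10 h1] := df x _ e10.
have [gr gi] := dg x.
have [d2 d20 h2] := eps_is_derive gr e20; have [d3 d30 h3] := eps_is_derive gi e20.
exists (Num.min (Num.min d2 d3) (d1 / (D + 1))).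
  by rewrite !lt_min d20 d30 divr_gt0//; lra.
move=> h; rewrite !lt_min => /andP[/andP[/h2 {}h2 /h3 {}h3] hd1].
set e2 := Num.min _ _ in h2 h3.
have gg : nm (g (x + h) - g x - g' x * h%:C) <= 2 * e2 * `|h|.
  apply: le_trans (nm_ReIm _) _.
  rewrite !cReB !cImB (cReM _ h%:C) (cImM _ h%:C) /= !mulr0 subr0 add0r.
  by move: h2 h3; lra.
have e2a : e2 <= 2^-1 by rewrite /e2 ge_min lexx.
have e2b : e2 * (4 * (L + 1)) <= e.
  by rewrite -ler_pdivlMr ?ge_min ?lexx ?orbT//; lra.
have hn := normr_ge0 h.
have gw : nm (g (x + h) - g x) <= (D + 1) * `|h|.
  have -> : g (x + h) - g x = (g (x + h) - g x - g' x * h%:C) + g' x * h%:C by ring.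
  apply: le_trans (nmD _ _) _; rewrite nmM nm_real -/D.
  have := ler_wpM2r hn e2a; lra.
have gd : nm (g (x + h) - g x) < d1.
  by apply: le_lt_trans gw _; rewrite mulrC -ltr_pdivlMr//; lra.
have := h1 _ gd; rewrite subrKC => h1'.
have -> : f (g (x + h)) - f (g x) - l x * g' x * h%:C =
  (f (g (x + h)) - f (g x) - l x * (g (x + h) - g x)) +
  l x * (g (x + h) - g x - g' x * h%:C) by ring.
apply: le_trans (nmD _ _) _; rewrite nmM -/L.
have A : e / (2 * (D + 1)) * nm (g (x + h) - g x) <= e / 2 * `|h|.
  apply: le_trans (ler_wpM2l (ltW e10) gw) _.
  rewrite le_eqVlt; apply/orP; left; apply/eqP; field; lra.
have B1 := ler_wpM2l L0 gg.
have B2 := ler_wpM2r hn e2b.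
have e2p : 0 <= e2 * `|h| by rewrite mulr_ge0// ltW.
move: h1' A B1 B2 e2p; lra.
Qed.

Lemma cdiff_uniq f z l l' : cdiff_at f z l -> cdiff_at f z l' -> l = l'.
Proof.
move=> df df'; apply/eqP; rewrite -subr_eq0; apply/eqP/nm0_eq0/eqP.
rewrite eq_le nm_ge0 andbT; apply/ler_addgt0Pl => e e0; rewrite addr0.
have e20 : 0 < e / 2 by rewrite divr_gt0.
have [d d0 h] := df _ e20; have [d' d'0 h'] := df' _ e20.
pose w : C := (Num.min d d' / 2)%:C.
have m0 : 0 < Num.min d d' by rewrite lt_min d0.
have wE : nm w = Num.min d d' / 2 by rewrite nm_real gtr0_norm// divr_gt0.
have w0 : 0 < nm w by rewrite wE divr_gt0.
have wm : nm w < Num.min d d' by rewrite wE; lra.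
move: (wm); rewrite lt_min => /andP[/h {}h /h' {}h'].
rewrite -(ler_pM2r w0) -nmM.
have -> : (l - l') * w = (f (z + w) - f z - l' * w) - (f (z + w) - f z - l * w).
  by ring.
apply: le_trans (nm_dist _ _) _; lra.
Qed.

Lemma ccont_bounded (f : R -> C) : ccont f ->
  exists M, forall t, 0 <= t <= 1 -> nm (f t) <= M.
Proof.
move=> cf.
have key (q : R -> R) : continuous q -> exists M, forall t, 0 <= t <= 1 -> q t <= M.
  move=> cq; have [|c _ hc] := @EVT_max R q 0 1 ler01.
    exact: continuous_subspaceT.
  by exists (q c) => t t01; apply: hc; rewrite in_itv.
have cr := ccont_Re cf; have ci := ccont_Im cf.
have [M1 h1] := key _ cr; have [M2 h2] := key _ ci.
have cr' : continuous (fun t => - Re (f t)) by move=> x; exact: cvgN (cr x).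
have ci' : continuous (fun t => - Im (f t)) by move=> x; exact: cvgN (ci x).
have [M3 h3] := key _ cr'; have [M4 h4] := key _ ci'.
exists ((`|M1| + `|M3|) + (`|M2| + `|M4|)) => t t01.
apply: le_trans (nm_ReIm _) (lerD _ _).
  rewrite ler_norml; have := h1 t t01; have := h3 t t01 => /=.
  have := ler_norm M1; have := ler_norm M3; have := normr_ge0 M1; have := normr_ge0 M3.
  by lra.
rewrite ler_norml; have := h2 t t01; have := h4 t t01 => /=.
have := ler_norm M2; have := ler_norm M4; have := normr_ge0 M2; have := normr_ge0 M4.
by lra.
Qed.

Lemma ccoef0 f : (forall z, nm z <= 1 -> exists l, cdiff_at f z l) ->
  ccoef f 0 = f 0.
Proof.
move=> df; have n0 : nm (0 : C) < 1 by rewrite nm0.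
have cf : ccont (fun s => f (E s)).
  apply: ccont_comp; last exact: ccontE.
  by move=> t; have [|l] := df (E t); [rewrite nmEt|exact: cdiff_cont].
have [M fM] := ccont_bounded cf.
have := cauchy_taylor df n0 1 fM.
rewrite nm0 expr1 mulr0 big_ord1 expr0 mulr1 => h.
apply/esym/eqP; rewrite -subr_eq0; apply/eqP/nm0_eq0/eqP.
by rewrite eq_le h nm_ge0.
Qed.

(** Integration by parts: f (E t) Ei(t)^(j+1) has period 1, so its derivative integrates to 0 over
    [0, 1]. *)
Lemma ccoef_deriv f f' j : (forall z, nm z <= 1 -> cdiff_at f z (f' z)) ->
  (forall z, nm z <= 1 -> ccontC f' z) ->
  ccoef f' j = j.+1%:R * ccoef f j.+1.
Proof.
move=> df cf'.
have nE (t : R) : nm (E t) <= 1 by rewrite nmEt.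
have cf : ccont (fun s => f (E s)).
  apply: ccont_comp; last exact: ccontE.
  by move=> t; exact: cdiff_cont (df _ (nE t)).
have cfp : ccont (fun s => f' (E s)).
  by apply: ccont_comp; [move=> t; exact: cf' (nE t)|exact: ccontE].
have d1 := cderiv_comp (fun t => df _ (nE t)) (@cderivE R).
have d2 := cderivZ ((tpi R)^-1) (cderivM d1 (@cderivEiX R j.+1)).
have {d2}d2 : cderiv (fun t => (tpi R)^-1 * (f (E t) * Ei t ^+ j.+1))
    (fun t => f' (E t) * Ei t ^+ j - j.+1%:R * (f (E t) * Ei t ^+ j.+1)).
  apply: (cderiv_eq d2) => t /=.
  rewrite exprS mulrnAl -[_ *+ _]mulr_natl.
  have -> : f' (E t) * (tpi R * E t) * (Ei t * Ei t ^+ j) =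
     f' (E t) * tpi R * Ei t ^+ j * (E t * Ei t) by ring.
  by rewrite EEi; field; exact: tpi_neq0.
have c1 : ccont (fun t => f' (E t) * Ei t ^+ j).
  by apply: ccontM => //; exact/ccontX/ccontEi.
have c2 : ccont (fun t => f (E t) * Ei t ^+ j.+1).
  by apply: ccontM => //; exact/ccontX/ccontEi.
have c3 : ccont (fun t => j.+1%:R * (f (E t) * Ei t ^+ j.+1)).
  by apply: ccontM => //; exact: ccont_cst.
have := cint_ftc (ccontB c1 c3) d2 (lexx 0) ler01.
rewrite cintB// ?cintZ// E01 Ei01 subrr => /eqP.
by rewrite subr_eq0 => /eqP.
Qed.

(** Read off the Taylor estimate of order 2 by uniqueness of the derivative. Integration by parts
    would presuppose a continuous derivative, which is precisely what this lemma later helps to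
    establish. *)
Lemma ccoef1 f l M : (forall z, nm z <= 1 -> exists l, cdiff_at f z l) ->
  (forall s : R, nm (f (E s)) <= M) -> cdiff_at f 0 l -> ccoef f 1 = l.
Proof.
move=> df fM dl; apply: (cdiff_uniq (f := f) (z := 0)) => // e e0.
have M0 : 0 <= M by apply: le_trans (nm_ge0 _) (fM 0).
exists (Num.min (1/2) (e / (4 * (M + 1)))).
  by rewrite lt_min !divr_gt0//; lra.
move=> w; rewrite lt_min => /andP[w1 w2].
have wlt1 : nm w < 1 by apply: lt_trans w1 _; lra.
have := cauchy_taylor df wlt1 2 (fun s _ => fM s).
rewrite !big_ord_recr big_ord0 /= add0r expr0 mulr1 expr1.
rewrite (ccoef0 df).
rewrite add0r opprD addrA => /le_trans; apply.
have h1 : M / (1 - nm w) <= 2 * M.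
  rewrite ler_pdivrMr ?subr_gt0//.
  have := ler_wpM2l M0 (_ : 1 / 2 <= 1 - nm w); rewrite lerBrDl -lerBrDr.
  by move=> /(_ _); lra.
have h2 : nm w * (4 * (M + 1)) <= e.
  by rewrite -ler_pdivlMr ?ltW//; lra.
have h3 := ler_wpM2r (exprn_ge0 2 (nm_ge0 w)) h1.
have h4 := ler_wpM2r (nm_ge0 w) h2.
have h5 := exprn_ge0 2 (nm_ge0 w).
move: h3 h4 h5; rewrite !expr2; lra.
Qed.

End OneVariable.

(** * Holomorphic functions of several variables *)

Section RowVectorNorm.
Variables (R : realType) (N : nat).
Local Notation C := (R[i] : numClosedFieldType).
Local Notation V := 'rV[C]_N.
Implicit Types (x y v : V) (c : C) (F : V -> C).

Definition vn v : R := Re `|v|.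

Lemma vnE v : `|v| = (vn v)%:C.
Proof. by apply/esym/RRe_real; rewrite ger0_real. Qed.

Lemma vn_ge0 v : 0 <= vn v.
Proof. by rewrite -ler0c -vnE. Qed.

Lemma vnD x y : vn (x + y) <= vn x + vn y.
Proof. by rewrite -lecR rmorphD /= -!vnE ler_normD. Qed.

Lemma vnN x : vn (- x) = vn x.
Proof. by rewrite /vn normrN. Qed.

Lemma vn0 : vn 0 = 0.
Proof. by rewrite /vn normr0. Qed.

Lemma vnZ c x : vn (c *: x) = nm c * vn x.
Proof. by apply: complexI; rewrite rmorphM /= -!vnE -nmE normrZ. Qed.

Lemma vn_eq0 v : (vn v == 0) = (v == 0).
Proof.
apply/eqP/eqP => [h|->]; last exact: vn0.
by apply/normr0_eq0; rewrite vnE h.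
Qed.

Lemma vn_gt0 v : (0 < vn v) = (v != 0).
Proof. by rewrite lt_neqAle vn_ge0 andbT eq_sym vn_eq0. Qed.

Lemma nm_coord v i : nm (v 0 i) <= vn v.
Proof.
rewrite -lecR -vnE -nmE (_ : `|v| = mx_norm v)// mx_normE.
rewrite -[leLHS]nngE num_le.
exact: (le_bigmax _ _ (0, i)).
Qed.

Lemma vn_le v (r : R) : 0 <= r -> (forall i, nm (v 0 i) <= r) -> vn v <= r.
Proof.
move=> r0 h; rewrite -lecR -vnE.
have rc : 0 <= r%:C by rewrite ler0c.
have {}h i : `|v 0 i| <= r%:C by rewrite nmE lecR.
rewrite (_ : `|v| = mx_norm v)// mx_normE.
move: (r%:C) rc h => e /nonnegP[{}e] h; rewrite [_ <= _%:num]num_le.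
apply/bigmax_leP; split => [|[a i] _]; first by rewrite -num_le /= ge0.
by rewrite -num_le /= (ord1 a).
Qed.

Lemma nearP (x : V) (P : set V) :
  (\forall y \near x, P y) <->
  (exists2 d : R, 0 < d & forall y, vn y < d -> P (x + y)).
Proof.
split=> [/nbhs_ballP[e /= e0 he]|[d d0 h]].
  have er : e = (Re e)%:C by rewrite RRe_real// gtr0_real.
  exists (Re e); first by rewrite -ltcR -er.
  move=> y yd; apply: he; rewrite mx_norm_ball /ball_ /= opprD addNKr normrN.
  by rewrite vnE er ltcR.
apply/nbhs_ballP; exists d%:C => /=; first by rewrite ltcR.
move=> y; rewrite mx_norm_ball /ball_ /= distrC vnE ltcR => /h.
by rewrite subrKC.
Qed.

Definition linform (l : 'I_N -> C) v : C := \sum_i v 0 i * l i.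

Lemma linform_is_linear l : linear (linform l).
Proof.
move=> c u v; rewrite /linform /GRing.scale /= mulr_sumr -big_split /=.
by apply: eq_bigr => i _; rewrite !mxE mulrDl mulrA.
Qed.

HB.instance Definition _ l := GRing.isLinear.Build C V C _ (linform l)
  (linform_is_linear l).

Lemma linform_continuous l : continuous (linform l : V -> C).
Proof.
move=> x; rewrite /linform; apply: cvg_big; [exact: add_continuous|exact: nbhs_filter|].
move=> i _; apply: (@cvgM C V (nbhs x) _ (fun v => v 0 i) (fun=> l i)).
  exact: coord_continuous.
exact: cvg_cst.
Qed.

Definition eps_diff F x (L : V -> C) := forall e : R, 0 < e ->
  exists2 d : R, 0 < d & forall y, vn y < d ->
    nm (F (x + y) - F x - L y) <= e * vn y.

Lemma differentiable_eps F x : differentiable F x -> eps_diff F x ('d F x).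
Proof.
move=> /diff_locally/eqaddoP h e e0.
have e0' : 0 < e%:C by rewrite ltcR.
have /nearP[d d0 hd] := h _ e0'; exists d => // y /hd /=.
rewrite add0r nmE vnE -rmorphM lecR /=.
by congr (nm _ <= _); rewrite !fctE /= (addrC y) opprD addrA.
Qed.

Lemma eps_diff_differentiable F x l : eps_diff F x (linform l) ->
  differentiable F x /\ 'd F x = linform l :> (V -> C).
Proof.
move=> h.
have key : F \o shift x = cst (F x) + linform l +o_ (0 : V) id.
  apply/eqaddoP => e e0.
  have er : e = (Re e)%:C by rewrite RRe_real// gtr0_real.
  have e0' : 0 < Re e by rewrite -ltcR -er.
  have [d d0 hd] := h _ e0'.
  apply/nearP; exists d => // y /hd /=; rewrite add0r er nmE vnE -rmorphM lecR.
  by congr (nm _ <= _); rewrite !fctE /= (addrC y) opprD addrA.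
have dE := diff_unique (@linform_continuous l) key.
split=> //; apply/diff_locallyP; rewrite dE; split=> //.
exact: linform_continuous.
Qed.

Lemma diff_linform F x : 'd F x = linform (fun i => 'd F x (delta_mx 0 i)) :> (V -> C).
Proof.
apply/funext => v; rewrite {1}[v]row_sum_delta linear_sum /linform.
by apply: eq_bigr => i _; rewrite linearZ.
Qed.

End RowVectorNorm.

(** * Directional derivatives of holomorphic functions are holomorphic *)

Section DifferentialIsHolomorphic.
Variables (R : realType) (N : nat).
Local Notation C := (R[i] : numClosedFieldType).
Local Notation V := 'rV[C]_N.
Implicit Types (x y v : V) (F : V -> C).

Lemma diff_scale F x (c : C) v : 'd F x (c *: v) = c * 'd F x v.
Proof. exact: linearZ. Qed.

Lemma line_cdiff F x v (t : R[i]) : differentiable F (x + t *: v) ->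
  cdiff_at (fun t : R[i] => F (x + t *: v)) t ('d F (x + t *: v) v).
Proof.
move=> /differentiable_eps h e e0.
have v0 : 0 < vn v + 1 by have := vn_ge0 v; lra.
have ev0 : 0 < e / (vn v + 1) by rewrite divr_gt0.
have [d d0 hd] := h _ ev0; exists (d / (vn v + 1)); first by rewrite divr_gt0.
move=> w; rewrite ltr_pdivlMr// => wd.
have wv : vn (w *: v) <= nm w * (vn v + 1).
  by rewrite vnZ ler_wpM2l ?nm_ge0// lerDl.
have := hd _ (le_lt_trans wv wd); rewrite diff_scale /= scalerDl addrA.
rewrite [_ * w]mulrC => /le_trans; apply.
apply: le_trans (ler_wpM2l (ltW ev0) wv) _.
rewrite mulrCA divfK; first by rewrite mulrC.
by rewrite gt_eqF.
Qed.

Definition bounded_hol F x (r M : R) := forall y, vn y <= r ->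
  differentiable F (x + y) /\ nm (F (x + y)) <= M.

(** The one-variable estimate of order 2 on the complex line through x and x + y, parametrised so
    that the unit circle has radius r in the space; then x + y sits at the parameter a = |y| / r <=
    1 / 2. *)
Lemma second_order F x r M y : 0 < r -> bounded_hol F x r M -> vn y <= r / 2 ->
  nm (F (x + y) - F x - 'd F x y) <= 4 * M * (vn y / r) ^+ 2.
Proof.
move=> r0 hF yr; have [->|y0] := eqVneq y 0.
  by rewrite addr0 subrr linear0 subr0 nm0 vn0 mul0r expr0n mulr0.
have y0' : 0 < vn y by rewrite vn_gt0.
pose a : R := vn y / r; have a0 : 0 < a by rewrite divr_gt0.
have a2 : a <= 1 / 2 by rewrite ler_pdivrMr//; lra.
pose v := (a%:C)^-1 *: y.
have vr : vn v = r.
  by rewrite vnZ nmV nm_real gtr0_norm// /a invf_div divfK// gt_eqF.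
have ay : a%:C *: v = y.
  by rewrite scalerA mulfV ?scale1r// -nm_gt0 nm_real gtr0_norm.
have tv (t : R[i]) : nm t <= 1 -> vn (t *: v) <= r.
  by move=> t1; rewrite vnZ vr ger_pMl.
pose f (t : R[i]) := F (x + t *: v).
have df z : nm z <= 1 -> cdiff_at f z ('d F (x + z *: v) v).
  by move=> /tv /hF [h _]; exact: line_cdiff.
have df' z : nm z <= 1 -> exists l, cdiff_at f z l by move=> /df; eexists; eauto.
have fM (s : R) : nm (f (E s)) <= M.
  by have [|_] := hF (E s *: v); first by apply: tv; rewrite nmEt.
have na : nm (a%:C) < 1 by rewrite nm_real gtr0_norm//; lra.
have := cauchy_taylor df' na 2 (fun s _ => fM s).
rewrite !big_ord_recr big_ord0 /= add0r expr0 mulr1 expr1.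
rewrite (ccoef0 df').
have n01 : nm (0 : C) <= 1 by rewrite nm0.
rewrite (ccoef1 df' fM (df 0 n01)) /f scale0r addr0 ay.
have -> : 'd F x y = 'd F x v * a%:C by rewrite -[in LHS]ay diff_scale mulrC.
rewrite opprD addrA nm_real gtr0_norm// => /le_trans; apply.
have M0 : 0 <= M := le_trans (nm_ge0 _) (fM 0).
apply: ler_wpM2r; first exact: sqr_ge0.
have : M / (1 - a) <= 2 * M; last by lra.
rewrite ler_pdivrMr; last by lra.
by have := ler_wpM2l M0 a2; lra.
Qed.

Lemma near_bounded_hol F x : (\forall z \near x, differentiable F z) ->
  exists2 r, 0 < r & exists M, bounded_hol F x r M.
Proof.
move=> /nearP[r r0 hr].
have dx : differentiable F x by rewrite -[x]addr0; apply: hr; rewrite vn0.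
have /cvgrPdist_lt/(_ 1 ltr01)/nearP[d d0 hd] := differentiable_continuous dx.
exists (Num.min r d / 2); first by rewrite divr_gt0// lt_min r0.
exists (nm (F x) + 1) => y yr.
have m0 : 0 < Num.min r d by rewrite lt_min r0.
have : vn y < Num.min r d by lra.
rewrite lt_min => /andP[/hr h1 /hd h2]; split=> //.
have h3 : nm (F x - F (x + y)) < 1 by rewrite -ltcR -nmE.
have := nmD (F x) (F (x + y) - F x); rewrite subrKC nmB; lra.
Qed.

Lemma bounded_hol_shift F x r M y : bounded_hol F x r M -> forall r', vn y + r' <= r ->
  bounded_hol F (x + y) r' M.
Proof.
move=> hF r' yr z zr; rewrite -addrA; apply: hF.
by apply: le_trans (vnD _ _) _; lra.
Qed.

Lemma diff_quotient_split (A B h p q p' q' : C) : (A - B) * h =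
  ((q' - q - h * B) - (p' - p - h * A)) + ((p' - q') - (p - q)).
Proof. ring. Qed.

Lemma quarter_sum (a : R) : 0 < a -> a / 4 + a / 4 + (a / 8 + a / 8) <= a.
Proof. lra. Qed.

(** By [second_order] the derivative along v is uniformly close to a difference quotient of step h.
    Once h is fixed, that quotient varies continuously with y because F does. *)
Lemma diff_dir_cont F x r M v : 0 < r -> bounded_hol F x r M ->
  forall e, 0 < e -> exists2 d, 0 < d & forall y, vn y < d ->
    nm ('d F (x + y) v - 'd F x v) < e.
Proof.
move=> r0 hF e e0.
have hF0 : bounded_hol F (x + 0) (r / 2) M.
  by apply: bounded_hol_shift hF _ _; rewrite vn0; lra.
have v0 := vn_ge0 v.
have M0 : 0 <= M.
  have vr : vn (0 : V) <= r by rewrite vn0 ltW.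
  by have [_ h] := hF 0 vr; exact: le_trans (nm_ge0 _) h.
pose B := 4 * M * (vn v / (r / 2)) ^+ 2 + 1.
have B0 : 0 < B.
  have := mulr_ge0 (mulr_ge0 (ler0n R 4) M0) (sqr_ge0 (vn v / (r / 2))).
  rewrite /B; lra.
(* The first bound keeps h v within r / 4, the second makes each second-order error at most e h /
   4. *)
pose h := Num.min (r / 4 / (vn v + 1)) (e / (4 * B)).
have h0 : 0 < h by rewrite lt_min !divr_gt0//; lra.
have hv : vn (h%:C *: v) <= r / 4.
  rewrite vnZ nm_real gtr0_norm//.
  have : h * (vn v + 1) <= r / 4.
    by rewrite -ler_pdivlMr ?ge_min ?lexx//; lra.
  by lra.
have hB : h * (4 * B) <= e.
  by rewrite -ler_pdivlMr ?ge_min ?lexx ?orbT//; lra.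
have eh0 : 0 < e * h / 8 by rewrite divr_gt0// mulr_gt0.
have cF z : vn z <= r -> exists2 d, 0 < d & forall y, vn y < d ->
    nm (F (x + z + y) - F (x + z)) < e * h / 8.
  move=> /hF[/differentiable_continuous/cvgrPdist_lt].
  have : 0 < (e * h / 8)%:C by rewrite ltcR.
  move=> + /(_ _) => /[swap] /[apply] /nearP[d d0 hd] _.
  by exists d => // y /hd; rewrite nmE ltcR nmB.
have [|d1 d10 h1] := cF 0; first by rewrite vn0 ltW.
have [|d2 d20 h2] := cF (h%:C *: v); first by lra.
exists (Num.min (r / 2) (Num.min d1 d2)).
  by rewrite !lt_min d10 d20 divr_gt0.
move=> y; rewrite !lt_min => /andP[yr /andP[/h1 {}h1 /h2 {}h2]].
have hFy : bounded_hol F (x + y) (r / 2) M.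
  by apply: bounded_hol_shift hF _ _; lra.
have r20 : 0 < r / 2 by rewrite divr_gt0.
have hv2 : vn (h%:C *: v) <= r / 2 / 2 by lra.
have s1 := second_order r20 hFy hv2.
have s2 := second_order r20 hF0 hv2.
rewrite !addr0 in h1 s2.
have hE : 4 * M * (vn (h%:C *: v) / (r / 2)) ^+ 2 <= h ^+ 2 * B.
  rewrite vnZ nm_real gtr0_norm//.
  have -> : 4 * M * (h * vn v / (r / 2)) ^+ 2 = h ^+ 2 * (4 * M * (vn v / (r / 2)) ^+ 2).
    by field; rewrite gt_eqF.
  by rewrite ler_wpM2l ?sqr_ge0// /B lerDl.
have {s1} s1 := le_trans s1 hE; have {s2} s2 := le_trans s2 hE.
rewrite (diff_scale F (x + y)) in s1; rewrite (diff_scale F x) in s2.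
rewrite -(ltr_pM2r h0) -[X in _ * X < _](gtr0_norm h0) -nm_real -nmM.
move: h1 h2 s1 s2; rewrite addrAC.
set p := F _; set q := F _; set p' := F _; set q' := F _ => h1 h2 s1 s2.
rewrite (diff_quotient_split _ _ _ p q p' q').
apply: le_lt_trans (nmD _ _) _.
have t1 := nm_dist (q' - q - h%:C * 'd F x v) (p' - p - h%:C * 'd F (x + y) v).
have t2 := nm_dist (p' - q') (p - q).
have t3 : h ^+ 2 * B <= e * h / 4.
  rewrite (_ : h ^+ 2 * B = h * (4 * B) * h / 4); last by field.
  by rewrite ler_pM2r ?invr_gt0// ler_wpM2r// ltW.
apply: le_lt_trans (lerD (le_trans t1 (lerD s2 s1)) t2) _.
apply: lt_le_trans (ler_ltD (lerD t3 t3) (ltrD h2 h1)) _.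
exact: quarter_sum (mulr_gt0 e0 h0).
Qed.

Lemma mul_sub3 (s a b c : C) : s * (a - b - c) = s * a - s * b - s * c.
Proof. ring. Qed.

(** Cauchy's formula writes the derivative along v at x + y as an integral over a circle of F
    translated by y. This is differentiated under the integral sign, with a remainder that
    [second_order] bounds uniformly on the circle. *)
Lemma diff_dir_differentiable F x v : (\forall z \near x, differentiable F z) ->
  differentiable (fun z => 'd F z v) x.
Proof.
move=> /near_bounded_hol[r2 r20 [M hF]].
pose r := r2 / 2; have r0 : 0 < r by rewrite divr_gt0.
have v0 := vn_ge0 v.
(* Scaling v to norm at most r keeps the circle around x, thickened by r, inside the ball of radius
   r2 = 2 r where F is bounded. *)
pose sg := r / (vn v + 1); have sg0 : 0 < sg by rewrite divr_gt0//; lra.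
pose u := sg%:C *: v.
have ur : vn u <= r.
  rewrite vnZ nm_real gtr0_norm// /sg mulrAC ler_pdivrMr; last by lra.
  by rewrite ler_pM2l//; lra.
have Eu (s : R) : vn (E s *: u) <= r by rewrite vnZ nmEt mul1r.
pose p (s : R) := x + E s *: u.
have hp s : bounded_hol F (p s) r M.
  by apply: bounded_hol_shift hF _ _; have := Eu s; rewrite /r; lra.
have Eball y (t : R[i]) : vn y <= r -> nm t <= 1 -> vn (y + t *: u) <= r2.
  move=> yr t1; apply: le_trans (vnD _ _) _; rewrite vnZ.
  have := ler_pM (nm_ge0 t) (vn_ge0 u) t1 ur; rewrite /r in yr *; lra.
have cauchy1 y : vn y <= r ->
    sg%:C * 'd F (x + y) v = cint (fun s => F (p s + y) * Ei s) 0 1.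
  move=> yr; pose f (t : R[i]) := F (x + y + t *: u).
  have df z : nm z <= 1 -> cdiff_at f z ('d F (x + y + z *: u) u).
    move=> z1; apply: line_cdiff; rewrite -addrA.
    by have [] := hF _ (Eball _ _ yr z1).
  have df' z : nm z <= 1 -> exists l, cdiff_at f z l by move=> /df; eexists; eauto.
  have n01 : nm (0 : C) <= 1 by rewrite nm0.
  have fM (s : R) : nm (f (E s)) <= M.
    have E1 : nm (E s) <= 1 by rewrite nmEt.
    by rewrite /f -addrA; have [] := hF _ (Eball _ _ yr E1).
  have := ccoef1 df' fM (df 0 n01).
  rewrite scale0r addr0 /u diff_scale => <-; congr cint; apply/funext => s.
  by rewrite /f expr1 /p addrAC.
have cFp y : vn y <= r -> ccont (fun s => F (p s + y) * Ei s).
  move=> yr; apply: ccontM; last exact: ccontEi.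
  have -> : (fun s => F (p s + y)) = (fun s => (fun t : R[i] => F (x + y + t *: u)) (E s)).
    by apply/funext => s; rewrite /p addrAC.
  apply: (@ccont_comp R (fun t : R[i] => F (x + y + t *: u)) (@E R)); last exact: ccontE.
  move=> s; have E1 : nm (E s) <= 1 by rewrite nmEt.
  apply: cdiff_cont; apply: line_cdiff; rewrite -addrA.
  by have [] := hF _ (Eball _ _ yr E1).
have cdp y : ccont (fun s => 'd F (p s) y * Ei s).
  apply: ccontM; last exact: ccontEi.
  move=> s e e0; have [d d0 hd] := diff_dir_cont y r0 (hp s) e0.
  have u0 : 0 < vn u + 1 by have := vn_ge0 u; lra.
  have [d' d'0 hd'] := @ccontE R s _ (divr_gt0 d0 u0).
  exists d' => // t /hd' ht.
  have -> : p t = p s + (E t - E s) *: u.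
    by rewrite /p scalerBl -addrA subrKC.
  apply: hd; rewrite vnZ; move: ht; rewrite ltr_pdivlMr//.
  by have := nm_ge0 (E t - E s); lra.
pose l i : C := (sg%:C)^-1 * cint (fun s => 'd F (p s) (delta_mx 0 i) * Ei s) 0 1.
have sgc : sg%:C != 0 by rewrite -nm_gt0 nm_real gtr0_norm.
have lE y : sg%:C * linform l y = cint (fun s => 'd F (p s) y * Ei s) 0 1.
  rewrite /linform mulr_sumr.
  have -> : (fun s => 'd F (p s) y * Ei s) = (fun s =>
      \sum_i y 0 i * ('d F (p s) (delta_mx 0 i) * Ei s)).
    apply/funext => s; rewrite {1}diff_linform /linform mulr_suml.
    by apply: eq_bigr => i _; rewrite mulrA.
  rewrite cint_sum//; last first.
    by move=> i; apply: ccontM => //; exact: ccont_cst.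
  by apply: eq_bigr => i _; rewrite cintZ// /l mulrCA mulVKf.
suff : eps_diff (fun z => 'd F z v) x (linform l) by case/eps_diff_differentiable.
move=> e e0.
have M0 : 0 <= M.
  have vr : vn (0 : V) <= r2 by rewrite vn0 ltW.
  by have [_ h] := hF 0 vr; exact: le_trans (nm_ge0 _) h.
pose B := 8 * M / r ^+ 2 + 1.
have B0 : 0 < B.
  have := mulr_ge0 (mulr_ge0 (ler0n R 8) M0) (_ : 0 <= (r ^+ 2)^-1).
  by rewrite invr_ge0 sqr_ge0 /B => /(_ isT); lra.
exists (Num.min (r / 2) (e * sg / B)).
  by rewrite lt_min !divr_gt0// mulr_gt0.
move=> y; rewrite lt_min => /andP[yr2]; rewrite ltr_pdivlMr// => yB.
have yr : vn y <= r by have := vn_ge0 y; lra.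
have z0r : vn (0 : V) <= r by rewrite vn0 ltW.
have cx := cauchy1 0 z0r; rewrite addr0 in cx.
have splitE : sg%:C * ('d F (x + y) v - 'd F x v - linform l y) =
    cint (fun s => F (p s + y) * Ei s) 0 1 - cint (fun s => F (p s + 0) * Ei s) 0 1
    - cint (fun s => 'd F (p s) y * Ei s) 0 1.
  by rewrite mul_sub3; congr (_ - _ - _); [exact: cauchy1|exact: cx|exact: lE].
rewrite -(ler_pM2l sg0) -[X in X * nm _](gtr0_norm sg0) -nm_real -nmM splitE.
have c0 := cFp 0 z0r; have c1 := cFp y yr; have c2 := cdp y.
rewrite -!cintB//; last exact: ccontB.
have : nm (cint (fun t => F (p t + y) * Ei t - F (p t + 0) * Ei t -
    'd F (p t) y * Ei t) 0 1) <= 2 * (4 * M * (vn y / r) ^+ 2) * (1 - 0).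
  apply: cint_bound => //; first by apply: ccontB => //; exact: ccontB.
  move=> t _; rewrite -!mulrBl nmM nmEi mulr1 addr0.
  by apply: second_order (hp t) _ => //; exact: ltW.
rewrite subr0 mulr1 => /le_trans; apply.
have -> : 2 * (4 * M * (vn y / r) ^+ 2) = (8 * M / r ^+ 2) * vn y * vn y.
  by field; rewrite gt_eqF.
have y0 := vn_ge0 y.
have := ler_wpM2r y0 (ltW yB).
have := mulr_ge0 y0 y0; rewrite /B; lra.
Qed.

End DifferentialIsHolomorphic.

(** * Iterated partial derivatives, scalar and vector-valued *)

Section PartialDerivatives.
Variables (R : realType) (N : nat).
Local Notation C := (R[i] : numClosedFieldType).
Local Notation V := 'rV[C]_N.
Implicit Types (x y v : V) (F G : V -> C) (r : R) (s : seq 'I_N).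

Lemma near_differentiable F G x : (\forall y \near x, F y = G y) ->
  differentiable F x -> differentiable G x /\ 'd G x = 'd F x :> (V -> C).
Proof.
move=> nFG dF.
have [d d0 FG] := (nearP x [set y | F y = G y]).1 nFG.
have dFE := diff_linform F x.
suff [dG dGE] : differentiable G x /\
    'd G x = linform (fun i => 'd F x (delta_mx 0 i)) :> (V -> C).
  by split; [exact: dG|exact: etrans dGE (esym dFE)].
apply: eps_diff_differentiable => e e0.
have [d' d'0 h] := differentiable_eps dF e0.
exists (Num.min d d'); first by rewrite lt_min d0.
move=> y; rewrite lt_min => /andP[/FG /= <- /h].
have FGx : F x = G x by have := FG 0; rewrite /= addr0; apply; rewrite vn0.
by rewrite -FGx (congr1 (fun f => f y) dFE).
Qed.

Definition hol r F := forall x, vn x < r -> differentiable F x.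

Lemma hol_near r F x : hol r F -> vn x < r -> \forall z \near x, differentiable F z.
Proof.
move=> hF xr; apply/nearP; exists (r - vn x); first by rewrite subr_gt0.
by move=> y yr; apply: hF; apply: le_lt_trans (vnD _ _) _; lra.
Qed.

Lemma hol_eq r F G : (forall x, vn x < r -> F x = G x) -> hol r F -> hol r G.
Proof.
move=> FG hF x xr; apply: (proj1 (near_differentiable _ (hF x xr))).
apply/nearP; exists (r - vn x); first by rewrite subr_gt0.
by move=> y yr; apply: FG; apply: le_lt_trans (vnD _ _) _; lra.
Qed.

Definition dpart i F x : C := 'd F x (delta_mx 0 i).
Definition spart s F := foldr dpart F s.

Lemma hol_dpart r F i : hol r F -> hol r (dpart i F).
Proof. by move=> hF x xr; apply: diff_dir_differentiable; exact: hol_near hF xr. Qed.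

Lemma hol_spart r F s : hol r F -> hol r (spart s F).
Proof. by move=> hF; elim: s => [|i s]; [exact: hF|exact: hol_dpart]. Qed.

Lemma dpart_eq r F G i : hol r F -> (forall x, vn x < r -> F x = G x) ->
  forall x, vn x < r -> dpart i F x = dpart i G x.
Proof.
move=> hF FG x xr.
have nFG : \forall y \near x, F y = G y.
  apply/(nearP x [set y | F y = G y]); exists (r - vn x); first by rewrite subr_gt0.
  by move=> y yr; apply: FG; apply: le_lt_trans (vnD _ _) _; lra.
have [_ dE] := near_differentiable nFG (hF x xr).
exact: (congr1 (fun f => f (delta_mx 0 i)) (esym dE)).
Qed.

Lemma hol_lin r F G (c : C) : hol r F -> hol r G -> hol r (fun x => F x + c * G x).
Proof.
move=> hF hG x xr.
have h := differentiableD (hF x xr) (differentiableZ c (hG x xr)).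
exact: h.
Qed.

Lemma spart_lin r F G (c : C) s : hol r F -> hol r G ->
  forall x, vn x < r -> spart s (fun y => F y + c * G y) x = spart s F x + c * spart s G x.
Proof.
move=> hF hG; elim: s => [|i s IH] x xr; first by [].
rewrite /= in IH *.
have hFs := hol_spart s hF; have hGs := hol_spart s hG.
rewrite (dpart_eq i (hol_spart s (hol_lin c hF hG)) IH xr) /dpart.
have dF := hFs x xr; have dG := hGs x xr.
have h1 := diffD dF (differentiableZ c dG); have h2 := diffZ c dG.
apply: etrans (congr1 (fun f => f (delta_mx 0 i)) h1) _.
congr (_ + _); exact: (congr1 (fun f => f (delta_mx 0 i)) h2).
Qed.

Lemma diff_components (P : V -> V) x :
  (forall i, differentiable (fun y => P y 0 i : C) x) -> differentiable P x.
Proof.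
move=> dP.
have -> : P = \sum_i (fun y => P y 0 i *: delta_mx 0 i).
  apply/funext => y; rewrite fct_sumE; exact: row_sum_delta.
apply: differentiable_sum => i; exact: differentiableZl.
Qed.

Lemma diff_coord (P : V -> V) x i : differentiable P x ->
  differentiable (fun y => P y 0 i : C) x.
Proof.
move=> dP; exact: (differentiable_comp dP (differentiable_coord (P x) 0 i)).
Qed.

Lemma diff_linform_comp (P : V -> V) x l : differentiable P x ->
  differentiable (fun y => linform l (P y)) x /\
  forall v, 'd (fun y => linform l (P y)) x v = linform l ('d P x v).
Proof.
move=> dP.
have dl : differentiable (linform l : V -> C) (P x).
  by apply: linear_differentiable; exact: linform_continuous.
split; first exact: (differentiable_comp dP dl).
move=> v; have h1 := congr1 (fun f => f v) (diff_comp dP dl).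
have h2 := congr1 (fun f => f ('d P x v)) (diff_lin (P x) (@linform_continuous _ _ l)).
exact: etrans h1 h2.
Qed.

Lemma linform_delta i v : linform (fun j => (j == i)%:R) v = v 0 i.
Proof.
rewrite /linform (bigD1 i)//= eqxx mulr1 big1 ?addr0// => j /negPf ->.
exact: mulr0.
Qed.

(** The induction has to carry the differentiability of the vector-valued partial derivatives along,
    because ['D] is identified with ['d] at points of differentiability. *)
Lemma partials_spart r (P : V -> V) l s : (forall x, vn x < r -> differentiable P x) ->
  forall x, vn x < r -> differentiable (partials s P) x /\
    spart s (fun y => linform l (P y)) x = linform l (partials s P x).
Proof.
move=> dP.
have hP l' : hol r (fun y => linform l' (P y)).
  by move=> x /dP /(diff_linform_comp l')[].
elim: s l => /= [|i s IH] l; first by move=> x xr; split; [exact: dP|].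
have dS x : vn x < r -> differentiable (partials s P) x by move=> /(IH l)[].
have IH' l' y : vn y < r -> spart s (fun y => linform l' (P y)) y = linform l' (partials s P y).
  by move=> /(IH l')[].
have E l' x : vn x < r -> spart (i :: s) (fun y => linform l' (P y)) x =
    linform l' (partials (i :: s) P x).
  move=> xr; apply: etrans (dpart_eq i (hol_spart s (hP l')) (IH' l') xr) _.
  apply: etrans ((diff_linform_comp l' (dS x xr)).2 _) _.
  by congr (linform l' _); apply/esym/deriveE; exact: dS.
move=> x xr; split; last exact: E.
apply: diff_components => j.
pose lj (k : 'I_N) : C := (k == j)%:R.
have hE : hol r (fun y => partials (i :: s) P y 0 j).
  apply: hol_eq (hol_spart (i :: s) (hP lj)) => y yr.
  by rewrite (E lj y yr) linform_delta.
exact: hE.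
Qed.

End PartialDerivatives.

(** * Taylor expansion in several variables *)

Section Taylor.
Variables (R : realType) (N : nat).
Local Notation C := (R[i] : numClosedFieldType).
Local Notation V := 'rV[C]_N.
Implicit Types (x y v : V) (F G : V -> C) (r : R) (s : seq 'I_N).

Fixpoint words j : seq (seq 'I_N) :=
  if j is j'.+1 then [seq i :: s | s <- words j', i <- enum 'I_N] else [:: [::]].

Lemma size_words j s : s \in words j -> size s = j.
Proof.
elim: j s => [|j IH] s /=; first by rewrite inE => /eqP ->.
by move=> /allpairsP[[s' i] /= [/IH <- _ ->]].
Qed.

Definition mono s x : C := \prod_(i <- s) x 0 i.

(** The j-th differential of F at y, evaluated on (x, ..., x). Ordered words take the place of
    multi-indices, so every word of length j enters Taylor's formula with the same coefficient 1 /
    j!. *)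
Definition hcomp F j x y : C := \sum_(s <- words j) mono s x * spart s F y.

Lemma cdiff_sum (I : Type) (t : seq I) (f : I -> R[i] -> R[i]) (l : I -> R[i]) z :
  (forall i, cdiff_at (f i) z (l i)) ->
  cdiff_at (fun w => \sum_(i <- t) f i w) z (\sum_(i <- t) l i).
Proof.
move=> df; elim: t => [|i t IH] e e0.
  by exists 1 => // w _; rewrite !big_nil mul0r !subr0 nm0 mulr_ge0 ?nm_ge0// ltW.
have e20 : 0 < e / 2 by rewrite divr_gt0.
have [d d0 hd] := df i _ e20; have [d' d'0 hd'] := IH _ e20.
exists (Num.min d d'); first by rewrite lt_min d0.
move=> w; rewrite lt_min => /andP[/hd h1 /hd' h2]; rewrite !big_cons.
rewrite (_ : _ - _ - _ = (f i (z + w) - f i z - l i * w) +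
  (\sum_(j <- t) f j (z + w) - \sum_(j <- t) f j z - (\sum_(j <- t) l j) * w)); last by ring.
by apply: le_trans (nmD _ _) _; rewrite (splitr e) mulrDl lerD.
Qed.

Lemma cdiffZ (f : R[i] -> R[i]) l c z : cdiff_at f z l ->
  cdiff_at (fun w => c * f w) z (c * l).
Proof.
move=> df e e0; have c0 : 0 < nm c + 1 by have := nm_ge0 c; lra.
have [d d0 hd] := df _ (divr_gt0 e0 c0); exists d => // w /hd h.
rewrite (_ : _ - _ - _ = c * (f (z + w) - f z - l * w)); last by ring.
rewrite nmM; have := ler_wpM2l (nm_ge0 c) h => /le_trans; apply.
rewrite mulrA ler_wpM2r ?nm_ge0// mulrA ler_pdivrMr//.
by have := nm_ge0 c; lra.
Qed.

Lemma hcomp_cdiff r F j x t : hol r F -> vn (t *: x) < r ->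
  cdiff_at (fun t : R[i] => hcomp F j x (t *: x)) t (hcomp F j.+1 x (t *: x)).
Proof.
move=> hF tr.
have -> : hcomp F j.+1 x (t *: x) =
    \sum_(s <- words j) mono s x * 'd (spart s F) (t *: x) x.
  rewrite /hcomp /= big_allpairs_dep /=; apply: eq_bigr => s _.
  rewrite diff_linform /linform mulr_sumr big_enum /=; apply: eq_bigr => i _.
  by rewrite /mono big_cons /dpart; ring.
apply: cdiff_sum => s; apply: cdiffZ.
have := @line_cdiff R N (spart s F) 0 x t.
rewrite add0r => /(_ (hol_spart s hF tr)).
by under eq_fun do rewrite add0r.
Qed.

(** Iterates [ccoef_deriv] along the line t -> t x: each derivative raises the degree of [hcomp] by
    one and supplies one factor of the factorial. *)
Lemma ccoef_hcomp r F x j n : hol r F -> vn x < r ->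
  j`!%:R * ccoef (fun t : R[i] => hcomp F n x (t *: x)) j = hcomp F (n + j) x 0.
Proof.
move=> hF xr.
have tx z : nm z <= 1 -> vn (z *: x) < r.
  move=> z1; rewrite vnZ; apply: le_lt_trans xr.
  by apply: ler_piMl; [exact: vn_ge0|exact: z1].
have dh m z : nm z <= 1 ->
    cdiff_at (fun t : R[i] => hcomp F m x (t *: x)) z (hcomp F m.+1 x (z *: x)).
  by move=> /tx; exact: hcomp_cdiff hF.
elim: j n => [|j IH] n.
  rewrite mul1r ccoef0; first by rewrite scale0r addn0.
  by move=> z /(dh n); eexists; eauto.
have cd := ccoef_deriv j (dh n) (fun z z1 => cdiff_cont (dh n.+1 z z1)).
by rewrite factS natrM mulrAC mulrC -cd IH addSnnS.
Qed.

Lemma mono_scale s x (c : C) : mono s (c *: x) = c ^+ size s * mono s x.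
Proof.
elim: s => [|i s IH]; first by rewrite /mono !big_nil mulr1.
by rewrite /mono !big_cons -!/(mono _ _) IH mxE /= exprS; ring.
Qed.

Lemma hcomp_scale F j x y (c : C) : hcomp F j (c *: x) y = c ^+ j * hcomp F j x y.
Proof.
rewrite /hcomp mulr_sumr big_seq [RHS]big_seq; apply: eq_bigr => s /size_words <-.
by rewrite mono_scale mulrA.
Qed.

(** The one-variable estimate on the line through 0 and x, rescaled so that the unit circle has norm
    rho. *)
Lemma taylor r rho M F x n : 0 < rho < r -> hol r F ->
  (forall y, vn y <= rho -> nm (F y) <= M) -> vn x <= rho / 2 ->
  nm (F x - \sum_(j < n) (j`!%:R)^-1 * hcomp F j x 0) <= 4 * M * (vn x / rho) ^+ n.
Proof.
move=> /andP[rho0 rhor] hF FM xr.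
have M0 : 0 <= M by apply: le_trans (nm_ge0 (F 0)) (FM _ _); rewrite vn0 ltW.
have [->|x0] := eqVneq x 0.
  case: n => [|n].
    rewrite big_ord0 subr0 expr0 mulr1; have := FM 0; rewrite vn0 => /(_ (ltW rho0)); lra.
  rewrite big_ord_recl big1 ?addr0; last first.
    by move=> j _; rewrite -[X in hcomp _ _ X](scale0r 0) hcomp_scale expr0n mul0r mulr0.
  rewrite invr1 mul1r /hcomp big_seq1 /mono big_nil mul1r subrr nm0.
  by rewrite vn0 mul0r expr0n mulr0.
have x0' : 0 < vn x by rewrite vn_gt0.
pose a : R := vn x / rho; have a0 : 0 < a by rewrite divr_gt0.
have a2 : a <= 1 / 2 by rewrite ler_pdivrMr//; lra.
pose v := (a%:C)^-1 *: x.
have vr : vn v = rho.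
  by rewrite vnZ nmV nm_real gtr0_norm// /a invf_div divfK// gt_eqF.
have av : a%:C *: v = x.
  by rewrite scalerA mulfV ?scale1r// -nm_gt0 nm_real gtr0_norm.
have tv (t : R[i]) : nm t <= 1 -> vn (t *: v) <= rho.
  by move=> t1; rewrite vnZ vr ger_pMl.
pose f (t : R[i]) := F (t *: v).
have fh : f = (fun t => hcomp F 0 v (t *: v)).
  by apply/funext => t; rewrite /hcomp big_seq1 /mono big_nil mul1r.
have df z : nm z <= 1 -> exists l, cdiff_at f z l.
  move=> /tv h; rewrite fh; exists (hcomp F 1 v (z *: v)).
  exact: hcomp_cdiff hF (le_lt_trans h rhor).
have fM (s : R) : nm (f (E s)) <= M by apply: FM; apply: tv; rewrite nmEt.
have na : nm (a%:C) < 1 by rewrite nm_real gtr0_norm//; lra.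
have := cauchy_taylor df na n (fun t _ => fM t).
rewrite nm_real gtr0_norm//.
have -> : \sum_(j < n) ccoef f j * a%:C ^+ j = \sum_(j < n) (j`!%:R)^-1 * hcomp F j x 0.
  have vr' : vn v < r by rewrite vr.
  apply: eq_bigr => j _; have hj := ccoef_hcomp j 0 hF vr'.
  rewrite add0n -fh in hj; rewrite -av hcomp_scale -hj mulrCA mulKf; first by rewrite mulrC.
  by rewrite pnatr_eq0 -lt0n fact_gt0.
rewrite /f av => /le_trans; apply.
apply: ler_wpM2r; first by rewrite exprn_ge0 ?ltW.
have : M / (1 - a) <= 2 * M; last by lra.
rewrite ler_pdivrMr; last by lra.
by have := ler_wpM2l M0 a2; lra.
Qed.

End Taylor.

(** * Infinitesimal automorphisms of a quadric *)

Section PolynomialFunctions.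
Variable C : numClosedFieldType.
Implicit Types (g h : C -> C) (P Q : {poly C}).

Definition ispoly g := exists P, forall t, g t = P.[t].

Lemma poly_nat0 P : (forall n : nat, P.[n.+1%:R] = 0) -> P = 0.
Proof.
move=> P0; apply/eqP; apply: contraT => nz.
have := @max_poly_roots _ P [seq n.+1%:R | n <- iota 0 (size P)] nz.
rewrite size_map size_iota ltnn => -> //.
  by apply/allP => _ /mapP[n _ ->]; apply/rootP.
rewrite map_inj_uniq ?iota_uniq// => a b /eqP.
by rewrite eqr_nat eqSS => /eqP.
Qed.

Lemma poly_eq_nz P Q : (forall t, t != 0 -> P.[t] = Q.[t]) -> P = Q.
Proof.
move=> PQ; apply/eqP; rewrite -subr_eq0; apply/eqP/poly_nat0 => n.
by rewrite hornerD hornerN PQ ?subrr// pnatr_eq0.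
Qed.

(** Selects the polynomial that induces g, with default 0; by [pol_eq] there is at most one. *)
Definition pol g : {poly C} := xget 0 [set P | forall t, g t = P.[t]].

Lemma polP g t : ispoly g -> g t = (pol g).[t].
Proof. by move=> [P gP]; rewrite /pol; case: xgetP => [Q _ ->|/(_ P)]. Qed.

Lemma pol_eq g P : (forall t, g t = P.[t]) -> pol g = P.
Proof.
move=> gP; apply: poly_eq_nz => t _; rewrite -gP -polP//; by exists P.
Qed.

Lemma ispoly_cst c : ispoly (fun=> c).
Proof. by exists c%:P => t; rewrite hornerC. Qed.

Lemma ispoly_id : ispoly id.
Proof. by exists 'X => t; rewrite hornerX. Qed.

Lemma ispolyD g h : ispoly g -> ispoly h -> ispoly (fun t => g t + h t).
Proof. by move=> [P gP] [Q hQ]; exists (P + Q) => t; rewrite hornerD gP hQ. Qed.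

Lemma ispolyM g h : ispoly g -> ispoly h -> ispoly (fun t => g t * h t).
Proof. by move=> [P gP] [Q hQ]; exists (P * Q) => t; rewrite hornerM gP hQ. Qed.

Lemma ispolyN g : ispoly g -> ispoly (fun t => - g t).
Proof. by move=> [P gP]; exists (- P) => t; rewrite hornerN gP. Qed.

Lemma ispolyZ c g : ispoly g -> ispoly (fun t => c * g t).
Proof. by move=> ?; apply: ispolyM => //; exact: ispoly_cst. Qed.

Lemma ispoly_sum (I : Type) (s : seq I) (p : pred I) (g : I -> C -> C) :
  (forall i, ispoly (g i)) -> ispoly (fun t => \sum_(i <- s | p i) g i t).
Proof.
move=> gP; exists (\sum_(i <- s | p i) pol (g i)) => t.
by rewrite horner_sum; apply: eq_bigr => i _; exact: polP.
Qed.

Lemma ispoly_prod (I : Type) (s : seq I) (p : pred I) (g : I -> C -> C) :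
  (forall i, ispoly (g i)) -> ispoly (fun t => \prod_(i <- s | p i) g i t).
Proof.
move=> gP; exists (\prod_(i <- s | p i) pol (g i)) => t.
by rewrite horner_prod; apply: eq_bigr => i _; exact: polP.
Qed.

Lemma ispoly_scale g c : ispoly g -> ispoly (fun t => g (c * t)).
Proof.
move=> [P gP]; exists (P \Po (c *: 'X)) => t.
by rewrite horner_comp hornerZ hornerX gP.
Qed.

Lemma pol_scale g c i : ispoly g -> (pol (fun t => g (c * t)))`_i = c ^+ i * (pol g)`_i.
Proof.
move=> gP; have gc := ispoly_scale c gP.
have -> : pol (fun t => g (c * t)) = \poly_(j < size (pol g)) (c ^+ j * (pol g)`_j).
  apply: pol_eq => t; rewrite (polP _ gP) horner_poly horner_coef.
  by apply: eq_bigr => j _; rewrite exprMn; ring.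
by rewrite coef_poly; case: ltnP => // h; rewrite nth_default// mulr0.
Qed.

Lemma pol_linC g h c1 c2 : ispoly g -> ispoly h ->
  pol (fun t => c1 * g t + c2 * h t) = c1 *: pol g + c2 *: pol h.
Proof. by move=> gP hP; apply: pol_eq => t; rewrite hornerD !hornerZ -!polP. Qed.

Lemma conj_horner P t : Num.conj_op (P.[Num.conj_op t]) = (map_poly (@Num.conj_op C) P).[t].
Proof. by rewrite -{2}[t]conjCK horner_map. Qed.

Lemma ispoly_conj g : ispoly g -> ispoly (fun t => Num.conj_op (g (Num.conj_op t))).
Proof. by move=> [P gP]; exists (map_poly (@Num.conj_op C) P) => t; rewrite gP conj_horner. Qed.

Definition pdeg_le (m : nat) g := exists2 P : {poly C}, (size P <= m.+1)%N & forall t, g t = P.[t].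

Lemma affineP g : (forall t, g t = (1 - t) * g 0 + t * g 1) -> pdeg_le 1 g.
Proof.
move=> h; exists ((g 0)%:P + (g 1 - g 0) *: 'X).
  rewrite (leq_trans (size_polyD _ _))// geq_max (leq_trans (size_polyC_leq1 _))//.
  by rewrite (leq_trans (size_scale_leq _ _))// size_polyX.
by move=> t; rewrite hornerD hornerC hornerZ hornerX {1}h; ring.
Qed.

Lemma pdeg_le1 g t : pdeg_le 1 g -> g t = (1 - t) * g 0 + t * g 1.
Proof.
move=> [P sP gP]; rewrite !gP !(horner_coef_wide _ sP) !big_ord_recl !big_ord0 /=.
by rewrite !expr0 !expr1; ring.
Qed.

Lemma pdeg_quad g a b c : (forall t, g t = a + b * t + c * t ^+ 2) -> pdeg_le 2 g.
Proof.
move=> h; exists (\poly_(i < 3) [:: a; b; c]`_i); first exact: size_poly.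
by move=> t; rewrite h horner_poly !big_ord_recl big_ord0 /= expr0 expr1; ring.
Qed.

(* Lagrange interpolation at 0, 1, 2. *)
Lemma pdeg2_interp g : pdeg_le 2 g -> forall t, g t =
  ((t - 1) * (t - 2) / 2) * g 0 - (t * (t - 2)) * g 1 + (t * (t - 1) / 2) * g 2.
Proof.
move=> [P sP gP] t; rewrite !gP !(horner_coef_wide _ sP) !big_ord_recl !big_ord0 /=.
by rewrite !expr0 !expr1 /bump /=; field.
Qed.

Lemma vanishing_order_deg g m n Q : pdeg_le m g -> (m < n)%N ->
  (forall t, g t = t ^+ n * Q.[t]) -> forall t, g t = 0.
Proof.
move=> [P sP gP] mn gQ t.
have PQ : P = 'X^n * Q.
  by apply: poly_eq_nz => s _; rewrite -gP gQ hornerM hornerXn.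
have [Q0|Q0] := eqVneq Q 0; first by rewrite gQ Q0 horner0 mulr0.
have := sP; rewrite PQ mulrC size_mulXn// => h.
have : (0 < size Q)%N by rewrite size_poly_gt0.
by move: h mn; clear; lia.
Qed.

(** The conclusions are the coefficients of l^0, of l^1 and of the higher powers of l.
    Multiplication by l^(N+1) turns the identity into one between polynomials, in which the
    polynomials in 1 / l appear reversed. *)
Lemma laurent_coef (Q Qc A D : {poly C}) (c : C) :
  (forall l : C, l != 0 -> Q.[l] - Qc.[l^-1] = c * (A.[l] / l + l * D.[l^-1])) ->
  [/\ Q`_0 - Qc`_0 = c * (A`_1 + D`_1), Q`_1 = c * (A`_2 + D`_0) &
      forall i, Q`_(i.+2) = c * A`_(i.+3)].
Proof.
move=> H.
have [N [sQ sD N2]] : exists N, [/\ (size Qc <= N)%N, (size D <= N)%N & (1 < N)%N].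
  by exists (maxn (size Qc) (size D)).+2; split; lia.
have wide (P : {poly C}) (l : C) : (size P <= N)%N -> l != 0 ->
    l ^+ N * P.[l^-1] = (\sum_(i < N) P`_i *: 'X^(N - i)).[l].
  move=> sP l0; rewrite (horner_coef_wide _ sP) mulr_sumr horner_sum.
  apply: eq_bigr => i _; rewrite hornerZ hornerXn mulrCA; congr (_ * _).
  by rewrite exprVn -exprB// ?unitfE// ltnW.
pose rev (P : {poly C}) : {poly C} := \sum_(i < N) P`_i *: 'X^(N - i).
have E : 'X^(N.+1) * Q - 'X * rev Qc = c *: ('X^N * A + 'X^2 * rev D).
  apply: poly_eq_nz => l l0.
  rewrite !(hornerD, hornerN, hornerM, hornerZ, hornerXn, hornerX) -!wide//.
  have := congr1 (fun x => l ^+ N.+1 * x) (H l l0); rewrite !exprS => e.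
  have -> : l * l ^+ N * Q.[l] - l * (l ^+ N * Qc.[l^-1]) =
    l * l ^+ N * (Q.[l] - Qc.[l^-1]) by ring.
  by rewrite e; field.
have rev_coef (P : {poly C}) j : (rev P)`_j = if (0 < j <= N)%N then P`_(N - j) else 0.
  rewrite /rev coef_sum; case: ifPn => jN.
    have jn : (N - j < N)%N by lia.
    rewrite (bigD1 (Ordinal jn))//= coefZ coefXn subKn; last by case/andP: jN.
    rewrite eqxx mulr1 big1 ?addr0// => i; rewrite -val_eqE /= => ij.
    rewrite coefZ coefXn; case: eqP => [e|_]; last by rewrite mulr0.
    by move: ij; rewrite e subKn ?eqxx// ltnW.
  rewrite big1// => i _; rewrite coefZ coefXn; case: eqP => [e|_]; last by rewrite mulr0.
  by move: jN; rewrite e subn_gt0 ltn_ord leq_subr.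
have co k : (if (k < N.+1)%N then 0 else Q`_(k - N.+1)) -
    (if (k == 0)%N then 0 else if (0 < k.-1 <= N)%N then Qc`_(N - k.-1) else 0) =
    c * ((if (k < N)%N then 0 else A`_(k - N)) +
    (if (k < 2)%N then 0 else if (0 < k - 2 <= N)%N then D`_(N - (k - 2)) else 0)).
  have := congr1 (fun P : {poly C} => P`_k) E.
  by rewrite coefD coefN coefZ coefD !coefXnM coefXM !rev_coef.
split.
- have := co N.+1; rewrite ltnn subnn /= leqnn subnn (ltnW N2) /=.
  have -> : (N.+1 < N)%N = false by lia.
  have -> : (N.+1 < 2)%N = false by lia.
  have -> : (0 < N.+1 - 2 <= N)%N by lia.
  have -> : (N.+1 - N = 1)%N by lia.
  by have -> : (N - (N.+1 - 2) = 1)%N by lia.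
- have := co N.+2; rewrite [_ == _]/= [N.+2.-1]/= ltnn andbF subr0.
  have -> : (N.+2 < N.+1)%N = false by lia.
  have -> : (N.+2 < N)%N = false by lia.
  have -> : (N.+2 < 2)%N = false by lia.
  have -> : (0 < N.+2 - 2 <= N)%N by lia.
  have -> : (N.+2 - N.+1 = 1)%N by lia.
  have -> : (N.+2 - N = 2)%N by lia.
  by have -> : (N - (N.+2 - 2) = 0)%N by lia.
- move=> i; have := co (N.+1 + i.+2)%N; rewrite /=.
  have -> : (N.+1 + i.+2 < N.+1)%N = false by lia.
  have -> : (N.+1 + i.+2 < N)%N = false by lia.
  have -> : (N.+1 + i.+2 < 2)%N = false by lia.
  have -> : (0 < N + i.+2 <= N)%N = false by lia.
  have -> : (0 < N.+1 + i.+2 - 2 <= N)%N = false by lia.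
  have -> : (N.+1 + i.+2 - N.+1 = i.+2)%N by lia.
  have -> : (N.+1 + i.+2 - N = i.+3)%N by lia.
  by rewrite subr0 addr0.
Qed.

(* The reason why the infinitesimal automorphisms of the sphere are quadratic. *)
Lemma sphere_quadratic (phi a d : C -> C) :
  (forall t s, phi t - phi s = (t - s) * (a t + d s)) -> pdeg_le 2 phi.
Proof.
move=> H; apply: (@pdeg_quad _ (phi 0) (phi 1 - phi 0 + d 0 - d 1) (d 1 - d 0)) => t.
have h0 := H t 0; have h1 := H t 1.
have at_ : a t = phi 1 - phi 0 - t * d 0 + (t - 1) * d 1.
  apply/eqP; rewrite -subr_eq0; apply/eqP.
  have -> : a t - (phi 1 - phi 0 - t * d 0 + (t - 1) * d 1) =
     ((t - 0) * (a t + d 0) - (phi t - phi 0)) - ((t - 1) * (a t + d 1) - (phi t - phi 1)).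
    ring.
  by rewrite -h0 -h1 !subrr.
have -> : phi t = (t - 0) * (a t + d 0) + phi 0 by rewrite -h0 subrK.
by rewrite at_; ring.
Qed.

End PolynomialFunctions.

(** * The polarised form, polynomial maps, and degrees along its values *)

Section SesquilinearForms.
Variables (C : numClosedFieldType) (d k : nat) (H : 'I_k -> 'M[C]_d).
Local Notation Vd := 'rV[C]_d.
Local Notation Vk := 'rV[C]_k.
Local Notation cj := (@Num.conj_op C).
Local Notation ii := ('i%R : C).
Implicit Types (x y z v : Vd) (u w : Vk).

Lemma rvD n (x y : 'rV[C]_n) j : (x + y) 0 j = x 0 j + y 0 j.
Proof. by rewrite mxE. Qed.
Lemma rvN n (x : 'rV[C]_n) j : (- x) 0 j = - x 0 j.
Proof. by rewrite mxE. Qed.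
Lemma rvZ n c (x : 'rV[C]_n) j : (c *: x) 0 j = c * x 0 j.
Proof. by rewrite mxE. Qed.
Lemma rv0 n j : (0 : 'rV[C]_n) 0 j = 0.
Proof. by rewrite mxE. Qed.
Definition rvE := (rvD, rvN, rvZ, rv0).

Definition cv n (x : 'rV[C]_n) : 'rV[C]_n := map_mx cj x.

Lemma cvK n (x : 'rV[C]_n) : cv (cv x) = x.
Proof. by apply/rowP => i; rewrite !mxE conjCK. Qed.

Lemma cvD n (x y : 'rV[C]_n) : cv (x + y) = cv x + cv y.
Proof. by apply/rowP => i; rewrite !mxE rmorphD. Qed.

Lemma cvZ n (c : C) (x : 'rV[C]_n) : cv (c *: x) = cj c *: cv x.
Proof. by apply/rowP => i; rewrite !mxE rmorphM. Qed.

Lemma cv0 n : cv (0 : 'rV[C]_n) = 0.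
Proof. by apply/rowP => i; rewrite !mxE rmorph0. Qed.

Definition B x y : Vk := \row_j (x *m H j *m y^T) 0 0.

Lemma BE x y j : B x y 0 j = \sum_a \sum_b x 0 a * H j a b * y 0 b.
Proof.
rewrite mxE [LHS]mxE exchange_big /=; apply: eq_bigr => b _.
by rewrite !mxE mulr_suml.
Qed.

Lemma BjE x y j : B x y 0 j = (x *m H j *m y^T) 0 0.
Proof. by rewrite mxE. Qed.

Lemma BDl x x' y : B (x + x') y = B x y + B x' y.
Proof. by apply/rowP => j; rewrite [RHS]mxE !BjE !mulmxDl [LHS]mxE. Qed.

Lemma BZl c x y : B (c *: x) y = c *: B x y.
Proof. by apply/rowP => j; rewrite [RHS]mxE !BjE -!scalemxAl [LHS]mxE. Qed.

Lemma BDr x y y' : B x (y + y') = B x y + B x y'.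
Proof. by apply/rowP => j; rewrite [RHS]mxE !BjE linearD mulmxDr [LHS]mxE. Qed.

Lemma BZr c x y : B x (c *: y) = c *: B x y.
Proof. by apply/rowP => j; rewrite [RHS]mxE !BjE linearZ -scalemxAr [LHS]mxE. Qed.

Lemma B0l y : B 0 y = 0.
Proof. by rewrite -[X in B X _](scale0r 0) BZl scale0r. Qed.

Lemma B0r x : B x 0 = 0.
Proof. by rewrite -[X in B _ X](scale0r 0) BZr scale0r. Qed.

Hypothesis Hherm : forall j, H j \is hermsymmx.

Lemma hermE j a b : cj (H j a b) = H j b a.
Proof.
have /is_hermitianmxP := Hherm j; rewrite expr0 scale1r => hE.
by rewrite [in LHS]hE !mxE conjCK.
Qed.

Lemma B_conj x y : cv (B x y) = B (cv y) (cv x).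
Proof.
apply/rowP => j; rewrite mxE !BE rmorph_sum [RHS]exchange_big /=.
apply: eq_bigr => a _; rewrite rmorph_sum; apply: eq_bigr => b _ /=.
by rewrite !rmorphM /= hermE !mxE; ring.
Qed.

Hypothesis Hker : forall z : Vd, (forall j, z *m H j = 0) -> z = 0.

Lemma B_nondegl x : (forall y, B x y = 0) -> x = 0.
Proof.
move=> h; apply: Hker => j; apply/rowP => a.
have /rowP/(_ j) := h (delta_mx 0 a).
by rewrite BjE trmx_delta -colE !mxE => ->.
Qed.

Lemma B_nondegr y : (forall x, B x y = 0) -> y = 0.
Proof.
move=> h; rewrite -[y]cvK; rewrite (@B_nondegl (cv y)) ?cv0// => x.
by rewrite -[x]cvK -B_conj h cv0.
Qed.

Definition pcurve n (g : C -> 'rV[C]_n) := forall i, ispoly (fun t => g t 0 i).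

Lemma pcurve_cst n (x : 'rV[C]_n) : pcurve (fun=> x).
Proof. by move=> i; exact: ispoly_cst. Qed.

Lemma pcurveD n (g h : C -> 'rV[C]_n) : pcurve g -> pcurve h ->
  pcurve (fun t => g t + h t).
Proof. by move=> gP hP i; under eq_fun do rewrite mxE; exact: ispolyD. Qed.

Lemma pcurveZ n (c : C -> C) (g : C -> 'rV[C]_n) : ispoly c -> pcurve g ->
  pcurve (fun t => c t *: g t).
Proof. by move=> cP gP i; under eq_fun do rewrite mxE; exact: ispolyM. Qed.

Lemma pcurve_line n (x y : 'rV[C]_n) : pcurve (fun t => x + t *: y).
Proof.
apply: pcurveD; first exact: pcurve_cst.
by apply: pcurveZ; [exact: ispoly_id|exact: pcurve_cst].
Qed.

Lemma pcurve_scale n (y : 'rV[C]_n) : pcurve (fun t => t *: y).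
Proof. by apply: pcurveZ; [exact: ispoly_id|exact: pcurve_cst]. Qed.

Lemma pcurveB (g h : C -> Vd) : pcurve g -> pcurve h -> pcurve (fun t => B (g t) (h t)).
Proof.
move=> gP hP j; under eq_fun do rewrite BE.
apply: ispoly_sum => a; apply: ispoly_sum => b.
by apply: ispolyM => //; apply: ispolyM => //; exact: ispoly_cst.
Qed.

Lemma pcurve_conj n (g : C -> 'rV[C]_n) : pcurve g -> pcurve (fun t => cv (g (cj t))).
Proof. by move=> gP i; under eq_fun do rewrite mxE; exact: (ispoly_conj (gP i)). Qed.

(** Polynomiality is recorded along polynomial curves only, which reduces all arguments to
    [{poly C}] in one variable. *)
Definition pmap2 n (p : Vd -> Vk -> 'rV[C]_n) := forall g h, pcurve g -> pcurve h ->
  pcurve (fun t => p (g t) (h t)).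

(** This is p with conjugated coefficients; it replaces the conjugate of p once y stands for the
    conjugate of z. *)
Definition conj2 n (p : Vd -> Vk -> 'rV[C]_n) y w := cv (p (cv y) (cv w)).

Lemma pmap2_conj n (p : Vd -> Vk -> 'rV[C]_n) : pmap2 p -> pmap2 (conj2 p).
Proof.
move=> pP g h gP hP.
have := pcurve_conj (pP _ _ (pcurve_conj gP) (pcurve_conj hP)).
by under eq_fun do rewrite !conjCK.
Qed.

(** The ordinary order of vanishing at 0, not the weighted one: z and w are scaled by the same t. *)
Definition order_gt n m (p : Vd -> Vk -> 'rV[C]_m) := forall z w i,
  exists Q : {poly C}, forall t, p (t *: z) (t *: w) 0 i = t ^+ n.+1 * Q.[t].

Lemma order_conj n m (p : Vd -> Vk -> 'rV[C]_m) : order_gt n p -> order_gt n (conj2 p).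
Proof.
move=> op z w i; have [Q hQ] := op (cv z) (cv w) i.
exists (map_poly cj Q) => t; rewrite mxE !cvZ hQ rmorphM rmorphXn /= conjCK.
by rewrite conj_horner.
Qed.

Lemma coef1_lift (F G L : C -> C) s : ispoly F -> ispoly G ->
  (forall m, L m = F (s * m) + m * G m) -> (pol L)`_1 = s * (pol F)`_1 + G 0.
Proof.
move=> hF hG hL; have hFs := ispoly_scale s hF.
have -> : pol L = pol (fun m => F (s * m)) + 'X * pol G.
  by apply: pol_eq => m; rewrite hornerD hornerM hornerX -!polP.
by rewrite coefD coefXM /= (pol_scale s 1 hF) expr1 (polP 0 hG) horner_coef0.
Qed.

Definition pfun (phi : Vk -> C) := forall g, pcurve g -> ispoly (fun t => phi (g t)).

(* Both lifting lemmas compare the coefficients of m in an identity that holds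
   along all the directions X + m Y. *)
Lemma lift_const (phi psi : Vk -> C) (X Y : Vk) : pfun phi -> pfun psi ->
  (forall w m t, phi (w + t *: (X + m *: Y)) + m * psi (w + t *: (X + m *: Y)) =
     phi w + m * psi w) ->
  forall w, pdeg_le 1 (fun t => psi (w + t *: X)).
Proof.
move=> hphi hpsi Hc w.
have phX w' t : phi (w' + t *: X) = phi w'.
  by have := Hc w' 0 t; rewrite scale0r addr0 !mul0r !addr0.
have pF : ispoly (fun m => phi (w + m *: Y)) by exact/hphi/pcurve_line.
have pG s : ispoly (fun m => psi (w + s *: X + m *: (s *: Y))).
  exact/hpsi/pcurve_line.
have key s : psi (w + s *: X) = psi w - s * (pol (fun m => phi (w + m *: Y)))`_1.
  have := @coef1_lift _ _ (fun m => phi w + m * psi w) s pF (pG s).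
  have -> : (pol (fun m => phi w + m * psi w))`_1 = psi w.
    rewrite (@pol_eq _ _ ((phi w)%:P + psi w *: 'X)).
      by rewrite coefD coefC coefZ coefX add0r mulr1.
    by move=> m; rewrite hornerD hornerC hornerZ hornerX mulrC.
  rewrite scale0r addr0 => ->; first by ring.
  move=> m; rewrite -(Hc w m s) scalerDr addrA scalerA [s * m]mulrC -scalerA.
  by rewrite addrAC phX.
by apply: affineP => t; rewrite scale0r addr0 key (key 1); ring.
Qed.

Lemma lift_affine (phi psi : Vk -> C) (X Y : Vk) : pfun phi -> pfun psi ->
  (forall w m, pdeg_le 1 (fun t =>
     phi (w + t *: (X + m *: Y)) + m * psi (w + t *: (X + m *: Y)))) ->
  forall w, pdeg_le 2 (fun t => psi (w + t *: X)).
Proof.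
move=> hphi hpsi Hc w.
pose F t m := phi (w + t *: X + m *: Y).
pose L t m := phi (w + t *: (X + m *: Y)) + m * psi (w + t *: (X + m *: Y)).
have pF t : ispoly (F t) by exact/hphi/pcurve_line.
have pG t : ispoly (fun m => psi (w + t *: X + m *: (t *: Y))).
  exact/hpsi/pcurve_line.
have pc t : pcurve (fun m => w + t *: (X + m *: Y)).
  have -> : (fun m => w + t *: (X + m *: Y)) = (fun m => w + t *: X + m *: (t *: Y)).
    by apply/funext => m; rewrite scalerDr addrA !scalerA mulrC.
  exact: pcurve_line.
have pL t : ispoly (L t).
  apply: ispolyD; first exact: hphi (pc t).
  by apply: ispolyM; [exact: ispoly_id|exact: hpsi (pc t)].
have LE t : (pol (L t))`_1 = (1 - t) * (pol (L 0))`_1 + t * (pol (L 1))`_1.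
  have -> : L t = (fun m => (1 - t) * L 0 m + t * L 1 m).
    by apply/funext => m; exact: pdeg_le1 (Hc w m).
  by rewrite pol_linC// coefD !coefZ.
have FE t : (pol (F t))`_1 = (1 - t) * (pol (F 0))`_1 + t * (pol (F 1))`_1.
  have -> : F t = (fun m => (1 - t) * F 0 m + t * F 1 m).
    apply/funext => m; have := pdeg_le1 t (Hc (w + m *: Y) 0).
    have Fs s : F s m = phi (w + m *: Y + s *: X) by rewrite /F addrAC.
    by rewrite !Fs !scale0r !addr0 !mul0r !addr0.
  by rewrite pol_linC// coefD !coefZ.
have key t : psi (w + t *: X) = (pol (L t))`_1 - t * (pol (F t))`_1.
  rewrite (@coef1_lift (F t) _ (L t) t (pF t) (pG t)).
    by rewrite scale0r addr0; ring.
  by move=> m; rewrite /L /F scalerDr addrA !scalerA [t * m]mulrC.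
apply: (@pdeg_quad _ _ (pol (L 0))`_1
  ((pol (L 1))`_1 - (pol (L 0))`_1 - (pol (F 0))`_1)
  ((pol (F 0))`_1 - (pol (F 1))`_1)) => t.
by rewrite key LE FE; ring.
Qed.

Definition sumB (s : seq (Vd * Vd)) : Vk := \sum_(p <- s) B p.1 p.2.

Definition sums_fill r := forall u, exists2 s : seq (Vd * Vd), (size s <= r)%N & sumB s = u.

(** For every u, the vectors x that can open a decomposition of u into at most r values of [B] span
    the whole space; this is phrased through linear maps T killing them. *)
Definition sums_detect r := forall u (T : Vd -> Vd),
  (forall z z', T (z + z') = T z + T z') -> (forall (c : C) z, T (c *: z) = c *: T z) ->
  (forall x y (s : seq (Vd * Vd)), (size s < r)%N -> sumB ((x, y) :: s) = u -> T x = 0) ->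
  forall z, T z = 0.

(** On the line spanned by B x y + sumB s, interpolate at 0, 1, 2 in the multiple of B x y. The
    three interpolated values have degree 2 |s| by induction, started from w, w + B x y and w + 2 B
    x y, and the interpolation coefficients add degree 2. *)
Lemma sumB_degree (g : Vk -> C) (s : seq (Vd * Vd)) :
  (forall w x y, pdeg_le 2 (fun t => g (w + t *: B x y))) ->
  forall w, pdeg_le (2 * size s) (fun t => g (w + t *: sumB s)).
Proof.
move=> hg; elim: s => [|[x y] s IH] w.
  exists (g w)%:P; first exact: size_polyC_leq1.
  by move=> t; rewrite /sumB big_nil scaler0 addr0 hornerC.
have [P0 s0 h0] := IH w.
have [P1 s1 h1] := IH (w + B x y); have [P2 s2 h2] := IH (w + 2 *: B x y).
pose l0 : {poly C} := 2^-1 *: (('X - 1%:P) * ('X - 2%:P)).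
pose l1 : {poly C} := 'X * ('X - 2%:P).
pose l2 : {poly C} := 2^-1 *: ('X * ('X - 1%:P)).
have sX (c : C) : (size ('X - c%:P)%R <= 2)%N by rewrite size_XsubC.
have szM (P Q : {poly C}) (a : nat) : (size P <= a)%N -> (size Q <= (2 * size s).+1)%N ->
    (size (P * Q)%R <= (a + (2 * size s).+1).-1)%N.
  move=> hP hQ; apply: leq_trans (size_polyMleq _ _) _; lia.
have sl (P Q : {poly C}) : (size P <= 2)%N -> (size Q <= 2)%N -> (size (P * Q)%R <= 3)%N.
  by move=> hP hQ; apply: leq_trans (size_polyMleq _ _) _; lia.
have sXX : (size ('X : {poly C}) <= 2)%N by rewrite size_polyX.
have sl0 : (size l0 <= 3)%N by apply: leq_trans (size_scale_leq _ _) (sl _ _ _ _).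
have sl1 : (size l1 <= 3)%N by exact: sl.
have sl2 : (size l2 <= 3)%N by apply: leq_trans (size_scale_leq _ _) (sl _ _ _ _).
exists (l0 * P0 - l1 * P1 + l2 * P2).
  have q0 := szM _ _ _ sl0 s0; have q1 := szM _ _ _ sl1 s1; have q2 := szM _ _ _ sl2 s2.
  apply: leq_trans (size_polyD _ _) _; rewrite geq_max; apply/andP; split; last first.
    by apply: leq_trans q2 _ => /=; lia.
  apply: leq_trans (size_polyD _ _) _; rewrite size_polyN geq_max.
  by apply/andP; split; [apply: leq_trans q0 _|apply: leq_trans q1 _] => /=; lia.
move=> t; rewrite !hornerD hornerN !hornerM -h0 -h1 -h2 /sumB big_cons /=.
have := pdeg2_interp (hg (w + t *: sumB s) x y) t.
rewrite scale0r addr0 scale1r scalerDr [t *: B x y + _]addrC addrA => ->.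
rewrite !hornerZ !hornerM !(hornerX, hornerXsubC) -/(sumB s).
by rewrite ![_ + _ *: B x y + _]addrAC [w + B x y + _]addrAC; ring.
Qed.

(** The same induction step with two nodes for the distinguished summand, along which g is affine.
    The degree saved is what decides the borderline case. *)
Lemma sumB_degree_affine (g : Vk -> C) (x y : Vd) (s : seq (Vd * Vd)) :
  (forall w x y, pdeg_le 2 (fun t => g (w + t *: B x y))) ->
  (forall w, pdeg_le 1 (fun t => g (w + t *: B x y))) ->
  forall w, pdeg_le (2 * size s).+1 (fun t => g (w + t *: sumB ((x, y) :: s))).
Proof.
move=> hg ha w.
have [P0 s0 h0] := sumB_degree s hg w; have [P1 s1 h1] := sumB_degree s hg (w + B x y).
pose l0 : {poly C} := - ('X - 1%:P).
have sl0 : (size l0 <= 2)%N by rewrite size_polyN size_XsubC.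
have sXX : (size ('X : {poly C}) <= 2)%N by rewrite size_polyX.
exists (l0 * P0 + 'X * P1).
  apply: leq_trans (size_polyD _ _) _; rewrite geq_max; apply/andP; split.
    by apply: leq_trans (size_polyMleq _ _) _; lia.
  by apply: leq_trans (size_polyMleq _ _) _; lia.
move=> t; rewrite !hornerD !hornerM -h0 -h1 /sumB big_cons /=.
have := pdeg_le1 t (ha (w + t *: sumB s)).
rewrite scale0r addr0 scale1r scalerDr [t *: B x y + _]addrC addrA => ->.
rewrite hornerN hornerXsubC hornerX -/(sumB s).
by rewrite [w + B x y + _]addrAC; ring.
Qed.

End SesquilinearForms.

(** * Infinitesimal automorphisms of high order vanish *)

Section InfinitesimalAutomorphisms.
Variables (C : numClosedFieldType) (d k : nat) (H : 'I_k -> 'M[C]_d).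
Local Notation Vd := 'rV[C]_d.
Local Notation Vk := 'rV[C]_k.
Local Notation cj := (@Num.conj_op C).
Local Notation ii := ('i%R : C).
Local Notation B := (B H).
Implicit Types (x y z v : Vd) (u w : Vk).

Hypothesis Hherm : forall j, H j \is hermsymmx.
Hypothesis Hker : forall z : Vd, (forall j, z *m H j = 0) -> z = 0.
Variables (p : Vd -> Vk -> Vd) (q : Vd -> Vk -> Vk) (n : nat).
Hypotheses (hp : pmap2 p) (hq : pmap2 q).
Hypotheses (op : order_gt n p) (oq : order_gt n q).
Hypothesis heq : forall z u, cv u = u -> let w := u + ii *: B z (cv z) in
  q z w - cv (q z w) = (2 * ii) *: (B (p z w) (cv z) + cv (B (p z w) (cv z))).

Let pc := conj2 p.
Let qc := conj2 q.
Let i2 : (2 * ii != 0).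
Proof. by rewrite mulf_neq0 ?neq0Ci// pnatr_eq0. Qed.

Lemma pcurveNr m (g : C -> 'rV[C]_m) : pcurve g -> pcurve (fun t => - g t).
Proof. by move=> gP i; under eq_fun do rewrite mxE; exact: ispolyN. Qed.

(* Along the real curves t |-> zc t, uc t through real t, heq is an identity
   between polynomials in t; at t = 'i it becomes the polarised identity. *)
Lemma polarized z y om : let w := om + (2 * ii) *: B z y in
  q z w - qc y om = (2 * ii) *: (B (p z w) y + B z (pc y om)).
Proof.
move=> w; pose u := om + ii *: B z y.
pose al := 2^-1 *: (z + cv y); pose be := (2 * ii)^-1 *: (z - cv y).
pose a := 2^-1 *: (u + cv u); pose b := (2 * ii)^-1 *: (u - cv u).
have ci : cj ii = - ii by exact: conjCi.
have c2 : cj (2^-1) = 2^-1 by rewrite fmorphV rmorph_nat.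
have c2i : cj ((2 * ii)^-1) = - (2 * ii)^-1.
  by rewrite fmorphV rmorphM /= rmorph_nat ci mulrN invrN.
have cvN m (x : 'rV[C]_m) : cv (- x) = - cv x.
  by apply/rowP => i; rewrite !mxE rmorphN.
have ra : cv a = a by rewrite cvZ c2 cvD cvK addrC.
have rb : cv b = b.
  by rewrite cvZ c2i cvD cvN cvK scaleNr -scalerN opprB.
pose zc t := al + t *: be; pose ec t := cv al + t *: cv be; pose uc t := a + t *: b.
pose wc t := uc t + ii *: B (zc t) (ec t); pose oc t := uc t + (- ii) *: B (zc t) (ec t).
have Pz : pcurve zc by exact: pcurve_line.
have Pe : pcurve ec by exact: pcurve_line.
have Pu : pcurve uc by exact: pcurve_line.
have PB : pcurve (fun t => B (zc t) (ec t)) by exact: pcurveB.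
have Pw : pcurve wc.
  by apply: pcurveD => //; apply: pcurveZ => //; exact: ispoly_cst.
have Po : pcurve oc.
  by apply: pcurveD => //; apply: pcurveZ => //; exact: ispoly_cst.
pose Phi t := q (zc t) (wc t) - qc (ec t) (oc t) -
  (2 * ii) *: (B (p (zc t) (wc t)) (ec t) + B (zc t) (pc (ec t) (oc t))).
have PPhi : pcurve Phi.
  apply: pcurveD; last first.
    apply: pcurveNr; apply: pcurveZ; first exact: ispoly_cst.
    apply: pcurveD; apply: pcurveB => //; first exact: hp.
    exact: (pmap2_conj hp).
  apply: pcurveD; first exact: hq.
  by apply: pcurveNr; exact: (pmap2_conj hq).
have Phi0 (m : nat) : Phi m%:R = 0.
  have ct : cj m%:R = m%:R by rewrite rmorph_nat.
  move: (m%:R : C) ct => t ct.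
  have cz : cv (zc t) = ec t by rewrite /zc /ec cvD [cv (t *: _)]cvZ ct.
  have cu : cv (uc t) = uc t by rewrite /uc cvD [cv (t *: _)]cvZ ct ra rb.
  have co : cv (oc t) = wc t.
    by rewrite /oc /wc cvD cvZ cu rmorphN /= ci opprK B_conj// -cz cvK.
  have := heq (zc t) cu; rewrite cz -/(wc t) /= => h.
  rewrite /Phi /qc /pc /conj2 co -cz cvK cz h.
  by rewrite [in X in _ - X](_ : B (zc t) _ = cv (B (p (zc t) (wc t)) (ec t))) ?subrr// B_conj// -cz cvK.
have Phii : Phi ii = 0.
  apply/rowP => j; have [P hP] := PPhi j; rewrite hP mxE.
  by rewrite (@poly_nat0 _ P) ?horner0// => m; rewrite -hP Phi0 mxE.
have iiE : ii * (2 * ii)^-1 = 2^-1 by field; rewrite neq0Ci.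
have half m (x : 'rV[C]_m) : 2^-1 *: (x + x) = x.
  by rewrite scalerDr -scalerDl (_ : 2^-1 + 2^-1 = 1) ?scale1r//; field.
have zi : zc ii = z.
  by rewrite /zc /al /be scalerA iiE -scalerDr addrACA subrr addr0 half.
have ei : ec ii = y.
  rewrite /ec /al /be !cvZ c2 c2i !cvD cvN cvK scalerA mulrN iiE scaleNr -scalerBr.
  by rewrite opprB [_ + (y - _)]addrC addrA subrK half.
have ui : uc ii = u.
  by rewrite /uc /a /b scalerA iiE -scalerDr addrACA subrr addr0 half.
have wi : wc ii = w.
  by rewrite /wc zi ei ui /u /w -addrA -scalerDl -mulr2n mulr_natl.
have oi : oc ii = om by rewrite /oc zi ei ui /u scaleNr addrK.
by move: Phii; rewrite /Phi zi ei wi oi => /eqP; rewrite subr_eq0 => /eqP.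
Qed.

Let Q z w j := pol (fun l => q (l *: z) w 0 j).
Let Qc y w j := pol (fun l => qc (l *: y) w 0 j).
Let A z w y j := pol (fun l => B (p (l *: z) w) y 0 j).
Let D z y w j := pol (fun l => B z (pc (l *: y) w) 0 j).

Let iQ z w j : ispoly (fun l => q (l *: z) w 0 j).
Proof. by apply: hq; [exact: pcurve_scale|exact: pcurve_cst]. Qed.
Let iQc y w j : ispoly (fun l => qc (l *: y) w 0 j).
Proof. by apply: (pmap2_conj hq); [exact: pcurve_scale|exact: pcurve_cst]. Qed.
Let iA z w y j : ispoly (fun l => B (p (l *: z) w) y 0 j).
Proof.
apply: (pcurveB _ _) => //; last exact: pcurve_cst.
by apply: hp; [exact: pcurve_scale|exact: pcurve_cst].
Qed.
Let iD z y w j : ispoly (fun l => B z (pc (l *: y) w) 0 j).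
Proof.
apply: (pcurveB _ _) => //; first exact: pcurve_cst.
by apply: (pmap2_conj hp); [exact: pcurve_scale|exact: pcurve_cst].
Qed.

(** Since B (l z) (y / l) = B z y, neither w nor om depends on l. *)
Let laurent z y om j : let w := om + (2 * ii) *: B z y in
  [/\ (Q z w j)`_0 - (Qc y om j)`_0 = 2 * ii * ((A z w y j)`_1 + (D z y om j)`_1),
      (Q z w j)`_1 = 2 * ii * ((A z w y j)`_2 + (D z y om j)`_0) &
      forall i, (Q z w j)`_(i.+2) = 2 * ii * (A z w y j)`_(i.+3)].
Proof.
move=> w; apply: laurent_coef => l l0.
have wl : om + (2 * ii) *: B (l *: z) (l^-1 *: y) = w.
  by rewrite BZl BZr [l *: (_ *: _)]scalerA mulfV// scale1r.
have := polarized (l *: z) (l^-1 *: y) om; rewrite /= wl BZr BZl.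
move=> /rowP/(_ j); rewrite !rvE -!polP// => ->.
by rewrite [l^-1 * _]mulrC.
Qed.

Let A_scale c z w y j i : (A (c *: z) w y j)`_i = c ^+ i * (A z w y j)`_i.
Proof.
rewrite /A -(pol_scale c i (iA z w y j)).
by under eq_fun do rewrite scalerA mulrC.
Qed.

Let D_lin c z y w j : D (c *: z) y w j = c *: D z y w j.
Proof. by apply: pol_eq => l; rewrite hornerZ -polP// BZl rvZ. Qed.

Let Q0E z w j : (Q z w j)`_0 = q 0 w 0 j.
Proof. by rewrite -horner_coef0 -polP// scale0r. Qed.
Let Qc0E y w j : (Qc y w j)`_0 = qc 0 w 0 j.
Proof. by rewrite -horner_coef0 -polP// scale0r. Qed.
Let D0E z y w j : (D z y w j)`_0 = B z (pc 0 w) 0 j.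
Proof. by rewrite -horner_coef0 -polP// scale0r. Qed.

Let qc0E w : qc 0 w = q 0 w.
Proof.
have := polarized 0 0 w; rewrite /= !B0l scaler0 addr0 B0r addr0 scaler0.
by move=> /eqP; rewrite subr_eq0 => /eqP <-.
Qed.

(** The coefficient of l^0, taken at c z with c = (t - s) / (2i), is the functional equation of
    [sphere_quadratic]. *)
Let q0_quadratic j w z y : pdeg_le 2 (fun t => q 0 (w + t *: B z y) 0 j).
Proof.
pose X := B z y.
apply: (@sphere_quadratic _ _ (fun t => (A z (w + t *: X) y j)`_1)
  (fun s => (D z y (w + s *: X) j)`_1)) => t s.
pose c := (t - s) / (2 * ii).
have [h _ _] := laurent (c *: z) y (w + s *: X) j.
have wE : w + s *: X + (2 * ii) *: B (c *: z) y = w + t *: X.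
  rewrite BZl scalerA [2 * ii * c]mulrC divfK// -addrA -scalerDl.
  by rewrite subrKC.
move: h; rewrite wE Q0E Qc0E qc0E A_scale expr1 D_lin coefZ -mulrDr => ->.
by rewrite mulrA [2 * ii * c]mulrC divfK.
Qed.

Variable r : nat.
Hypothesis D1 : sums_fill H r.
Hypothesis rn : (2 * r <= n)%N.

(* u is a sum of at most r vectors B x y, so g is a polynomial of degree at most
   2 r on the line through 0 and u. *)
Let vanish (g : Vk -> C) m : (2 * r < m)%N ->
  (forall w x y, pdeg_le 2 (fun t => g (w + t *: B x y))) ->
  (forall u, exists P : {poly C}, forall t, g (t *: u) = t ^+ m * P.[t]) ->
  forall u, g u = 0.
Proof.
move=> rm g2 gm u; have [s sr <-] := D1 u; have [P hP] := gm (sumB H s).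
have h : pdeg_le (2 * size s) (fun t => g (t *: sumB H s)).
  by have [P' sP' hP'] := sumB_degree s g2 0; exists P' => // t; rewrite -hP' add0r.
have sm : (2 * size s < m)%N by apply: leq_ltn_trans rm; rewrite leq_mul2l sr orbT.
by have := vanishing_order_deg h sm hP 1; rewrite scale1r.
Qed.

Let q0 w : q 0 w = 0.
Proof.
apply/rowP => j; rewrite rv0; apply: (@vanish (fun w => q 0 w 0 j) n.+1 _ _ _ w) => //.
by move=> u; have [P hP] := oq 0 u j; exists P => t; rewrite -hP scaler0.
Qed.

Let q_affine z w : q z w = (2 * ii) *: B z (pc 0 w).
Proof.
have := polarized z 0 w; rewrite /= !B0r scaler0 addr0 add0r.
by rewrite qc0E q0 subr0.
Qed.

(** The coefficient of l^1, with the larger argument w fixed and om = w + s B z y. Reaching this om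
    takes c z with c = - s / (2i); the term in p scales like c^2 and the other two like c, which
    leaves an affine function of s. *)
Let fc_affine j w z y : pdeg_le 1 (fun s => B z (pc 0 (w + s *: B z y)) 0 j).
Proof.
pose X := B z y.
have Q1E z' w' : (Q z' w' j)`_1 = 2 * ii * B z' (pc 0 w') 0 j.
  rewrite /Q (@pol_eq _ _ ((2 * ii * B z' (pc 0 w') 0 j) *: 'X)).
    by rewrite coefZ coefX mulr1.
  by move=> t; rewrite q_affine BZl scalerA hornerZ hornerX rvZ mulrAC.
exists ((B z (pc 0 w) 0 j)%:P + ((A z w y j)`_2 / (2 * ii)) *: 'X).
  rewrite (leq_trans (size_polyD _ _))// geq_max (leq_trans (size_polyC_leq1 _))//.
  by rewrite (leq_trans (size_scale_leq _ _))// size_polyX.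
move=> s; rewrite hornerD hornerC hornerZ hornerX.
have [->|s0] := eqVneq s 0; first by rewrite scale0r addr0 mulr0 addr0.
pose c := - s / (2 * ii).
have c0 : c != 0 by rewrite mulf_neq0 ?oppr_eq0// invr_eq0.
have [_ h _] := laurent (c *: z) y (w + s *: X) j.
have wE : w + s *: X + (2 * ii) *: B (c *: z) y = w.
  by rewrite BZl scalerA [2 * ii * c]mulrC divfK// scaleNr addrK.
move: h; rewrite wE Q1E A_scale D0E !BZl !rvZ => /(mulfI i2).
rewrite expr2 -mulrA -mulrDr => /(mulfI c0) ->.
by rewrite /X /c; field; rewrite neq0Ci.
Qed.

Let pcg_poly z j : pfun (fun w => B z (pc 0 w) 0 j).
Proof.
move=> g gP; apply: pcurveB; first exact: pcurve_cst.
by apply: (pmap2_conj hp) => //; exact: pcurve_cst.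
Qed.

(** In [fc_affine] the same z pairs with [pc] and spans the direction. Taken at y + m v it is
    polarised by [lift_affine] to degree 2 along every B y e, after which the order n + 1 > 2r
    wins. *)
Let fc0 w : pc 0 w = 0.
Proof.
apply: (B_nondegr Hherm Hker) => v; apply/rowP => j; rewrite rv0.
apply: (@vanish (fun w => B v (pc 0 w) 0 j) n.+1 _ _ _ w) => //.
  move=> w' y e; apply: (@lift_affine _ _ (fun w => B y (pc 0 w) 0 j)
      (fun w => B v (pc 0 w) 0 j) (B y e) (B v e)) => // w1 m.
  have := fc_affine j w1 (y + m *: v) e.
  rewrite BDl BZl => -[P sP hP]; exists P => // t; rewrite -hP.
  by rewrite BDl BZl !rvE.
move=> u; have hQ i := order_conj op 0 u i.
have [P hP] : exists P : 'I_d -> {poly C}, forall i t,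
    pc 0 (t *: u) 0 i = t ^+ n.+1 * (P i).[t].
  have /choice[P hP] : forall i, exists P : {poly C}, forall t,
     pc 0 (t *: u) 0 i = t ^+ n.+1 * P.[t].
    by move=> i; have [P hP] := hQ i; exists P => t; rewrite -hP scaler0.
  by exists P.
exists (\sum_a \sum_b (v 0 a * H j a b) *: P b) => t.
rewrite BE horner_sum mulr_sumr; apply: eq_bigr => a _.
rewrite horner_sum mulr_sumr; apply: eq_bigr => b _.
by rewrite hP hornerZ mulrCA.
Qed.

Let q_zero z w : q z w = 0.
Proof. by rewrite q_affine fc0 B0r scaler0. Qed.

Let qc_zero z w : qc z w = 0.
Proof. by rewrite /qc /conj2 q_zero cv0. Qed.

Let p0 w : p 0 w = 0.
Proof. by have := fc0 (cv w); rewrite /pc /conj2 cvK cv0 => /(congr1 (@cv C d)); rewrite cvK cv0. Qed.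

Let skew z y om : B (p z (om + (2 * ii) *: B z y)) y = - B z (pc y om).
Proof.
have := polarized z y om; rewrite /= q_zero qc_zero subr0 => /esym/eqP.
by rewrite scaler_eq0 (negPf i2) /= addr_eq0 => /eqP.
Qed.

(** With q = 0 and p 0 w = 0, the Laurent comparison kills every coefficient of B (p (l z) w) y
    except that of l. *)
Let p_homog c z w : p (c *: z) w = c *: p z w.
Proof.
apply/eqP; rewrite -subr_eq0; apply/eqP/(B_nondegl Hker) => y; apply/rowP => j.
pose om := w - (2 * ii) *: B z y.
have wE : om + (2 * ii) *: B z y = w by rewrite subrK.
have [_ h1 h2] := laurent z y om j; rewrite wE in h1 h2.
have QE : Q z w j = 0 by apply: pol_eq => t; rewrite q_zero rv0 horner0.
have AE : A z w y j = (A z w y j)`_1 *: 'X.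
  apply/polyP => -[|[|[|i]]]; rewrite coefZ coefX ?mulr0 ?mulr1//.
  - by rewrite -horner_coef0 -polP// scale0r p0 B0l rv0.
  - move: h1; rewrite QE coef0 D0E fc0 B0r rv0 addr0 => /esym/eqP.
    by rewrite mulf_eq0 (negPf i2) => /eqP.
  - by move: (h2 i); rewrite QE coef0 => /esym/eqP; rewrite mulf_eq0 (negPf i2) => /eqP.
have AcE t : B (p (t *: z) w) y 0 j = t * (A z w y j)`_1.
  by rewrite (polP t (iA z w y j)) -/(A z w y j) AE hornerZ hornerX coefZ coefX mulr1 mulrC.
have := AcE 1; rewrite scale1r mul1r => A1.
by rewrite -scaleN1r BDl !BZl !rvE AcE A1; ring.
Qed.

Let pc_homog c y w : pc (c *: y) w = c *: pc y w.
Proof. by rewrite /pc /conj2 cvZ p_homog cvZ conjCK. Qed.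

(** Put e y for y in [skew] and divide by e: the left side no longer depends on e, while the shift
    of w becomes e times a fixed vector. Both sides are polynomial in e, so the identity extends to
    e = 0. *)
Let skew0 z y w : B (p z w) y = - B z (pc y w).
Proof.
apply/rowP => j.
have [P hP] : ispoly (fun e => B z (pc y (w + e *: - ((2 * ii) *: B z y))) 0 j).
  by apply: pcurveB; [exact: pcurve_cst|apply: (pmap2_conj hp); [exact: pcurve_cst|exact: pcurve_line]].
have PE : P = (- (B (p z w) y 0 j))%:P.
  apply: poly_eq_nz => e e0; rewrite -hP hornerC.
  have := skew z (e *: y) (w + e *: - ((2 * ii) *: B z y)).
  rewrite pc_homog !BZr scalerA scalerN scalerA [2 * ii * e]mulrC subrK.
  move=> /rowP/(_ j); rewrite !rvE -mulrN => /(mulfI e0) ->.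
  by rewrite opprK.
have := hP 0; rewrite scale0r addr0 PE hornerC rvN => ->.
by rewrite opprK.
Qed.

Let p_add z z' w : p (z + z') w = p z w + p z' w.
Proof.
apply/eqP; rewrite -subr_eq0; apply/eqP/(B_nondegl Hker) => y.
by rewrite -scaleN1r !(BDl, BZl) !skew0 !BDl scaleN1r !opprD !opprK addrACA !addNr addr0.
Qed.

Let K_const z y w t : B (p z (w + t *: B z y)) y = B (p z w) y.
Proof.
have [->|t0] := eqVneq t 0; first by rewrite scale0r addr0.
pose c := t / (2 * ii).
have c0 : c != 0 by rewrite mulf_neq0// invr_eq0.
have := skew (c *: z) y w.
rewrite BZl scalerA [2 * ii * c]mulrC divfK// p_homog !BZl -scalerN => /(scalerI c0) ->.
by rewrite skew0.
Qed.

Let K_poly z y j : pfun (fun w => B (p z w) y 0 j).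
Proof.
move=> g gP; apply: pcurveB; last exact: pcurve_cst.
by apply: hp => //; exact: pcurve_cst.
Qed.

(** [K_const] ties the direction B z y to the pairing with the same y. Polarising in y frees the
    direction B z y' here, and polarising in z frees B x x' in [K_quad]. *)
Let K_affine z y j : forall w y', pdeg_le 1 (fun t => B (p z (w + t *: B z y')) y 0 j).
Proof.
move=> w y'; apply: (@lift_const _ _ (fun w => B (p z w) y' 0 j)
  (fun w => B (p z w) y 0 j) (B z y') (B z y)) => // w1 m t.
have := K_const z (y' + m *: y) w1 t.
by rewrite !BDr !BZr => /rowP/(_ j); rewrite !rvE.
Qed.

Let K_quad z y j : forall w x x', pdeg_le 2 (fun t => B (p z (w + t *: B x x')) y 0 j).
Proof.
move=> w x x'; apply: (@lift_affine _ _ (fun w => B (p x w) y 0 j)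
  (fun w => B (p z w) y 0 j) (B x x') (B z x')) => // w1 m.
have := K_affine (x + m *: z) y j w1 x'.
rewrite BDl BZl => -[P sP hP]; exists P => // t; rewrite -hP.
by rewrite p_add p_homog BDl BZl !rvE.
Qed.

(** Linearity in z uses up one of the n + 1 factors t. *)
Let K_order z y j u : exists P : {poly C}, forall t,
  B (p z (t *: u)) y 0 j = t ^+ n * P.[t].
Proof.
have /choice[P hP] : forall i, exists P : {poly C}, forall t,
   p (t *: z) (t *: u) 0 i = t ^+ n.+1 * P.[t] by move=> i; exact: op z u i.
have [K hK] : ispoly (fun t => B (p z (t *: u)) y 0 j) by apply: K_poly; exact: pcurve_scale.
pose S := \sum_a \sum_b (H j a b * y 0 b) *: P a.
have KE : 'X * K = 'X * ('X^n * S).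
  apply: poly_eq_nz => t t0; rewrite !hornerM hornerX hornerXn -hK.
  have <- : B (p (t *: z) (t *: u)) y 0 j = t * B (p z (t *: u)) y 0 j.
    by rewrite p_homog BZl rvZ.
  rewrite mulrA -exprS BE horner_sum mulr_sumr; apply: eq_bigr => a _.
  rewrite horner_sum mulr_sumr; apply: eq_bigr => b _.
  by rewrite hP hornerZ; ring.
exists S => t; have /mulfI : ('X : {poly C}) != 0 by rewrite polyX_eq0.
by move=> /(_ _ _ KE) E; rewrite hK E hornerM hornerXn.
Qed.

Hypothesis D2 : (2 * r < n)%N \/ sums_detect H r.

Lemma infinitesimal_automorphism_zero z w : p z w = 0 /\ q z w = 0.
Proof.
split; last exact: q_zero.
case: D2 => [rn'|D2'].
  apply: (B_nondegl Hker) => y; apply/rowP => j; rewrite rv0.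
  apply: (@vanish (fun w => B (p z w) y 0 j) n rn' _ _ w).
    by move=> w' x x'; exact: K_quad.
  exact: K_order.
apply: (D2' w (fun z => p z w)).
- by move=> *; exact: p_add.
- by move=> *; exact: p_homog.
(* Borderline case: pairing p x with any y is affine along B x e, and the fewer than r other
   summands add degree 2 each, so the total degree is at most 2 |s| + 1 < 2r <= n. *)
move=> x e s sr sw; apply: (B_nondegl Hker) => y; apply/rowP => j; rewrite rv0.
have [P hP] := K_order x y j w.
have h : pdeg_le (2 * size s).+1 (fun t => B (p x (t *: w)) y 0 j).
  have [P' sP' hP'] := @sumB_degree_affine _ _ _ _ (fun w => B (p x w) y 0 j) x e s
    (K_quad x y j) (fun w => K_affine x y j w e) 0.
  by exists P' => // t; rewrite -hP' add0r sw.
have sm : ((2 * size s).+1 < n)%N by move: sr rn; clear; lia.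
by have := vanishing_order_deg h sm hP 1; rewrite scale1r.
Qed.

End InfinitesimalAutomorphisms.

(** * Linearisation at the origin *)

Section LeadingTerm.
Variables (R : realType).
Local Notation C := (R[i] : numClosedFieldType).

Lemma common_delta (I : finType) (P : I -> R -> Prop) :
  (forall i, exists2 d, 0 < d & forall t, 0 < t < d -> P i t) ->
  exists2 d, 0 < d & forall i t, 0 < t < d -> P i t.
Proof.
move=> hP.
have /choice[f hf] : forall i, exists d, 0 < d /\ forall t, 0 < t < d -> P i t.
  by move=> i; have [d d0 h] := hP i; exists d.
exists (\big[Num.min/1]_i f i).
  by apply/lt_bigmin => // i _; have [] := hf i.
move=> i t /andP[t0 td]; have [_ h] := hf i; apply: h; rewrite t0/=.
by apply: lt_le_trans td _; exact: bigmin_le_cond.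
Qed.

Lemma nm_conj (z : C) : nm (Num.conj_op z) = nm z.
Proof. by apply: complexI; rewrite -!nmE norm_conjC. Qed.

Lemma conj_real (t : R) : Num.conj_op (t%:C : C) = t%:C.
Proof. exact: conjc_real. Qed.

Lemma vn_cv m (x : 'rV[C]_m) : vn (cv x) <= vn x.
Proof.
apply: vn_le; first exact: vn_ge0.
by move=> i; rewrite mxE nm_conj nm_coord.
Qed.

(* f t = t^n a + O(t^(n+1)) as the real variable t decreases to 0. *)
Definition lead m n (f : R -> 'rV[C]_m) (a : 'rV[C]_m) := exists2 K : R, 0 <= K &
  exists2 e : R, 0 < e <= 1 &
    forall t, 0 < t < e -> vn (f t - t%:C ^+ n *: a) <= K * t ^+ n.+1.

Lemma leadI m n (f : R -> 'rV[C]_m) a (K e : R) : 0 < e ->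
  (forall t, 0 < t < e -> vn (f t - t%:C ^+ n *: a) <= K * t ^+ n.+1) -> lead n f a.
Proof.
move=> e0 h; exists `|K| => //; exists (Num.min e 1).
  by rewrite lt_min e0 ltr01 ge_min lexx orbT.
move=> t; rewrite lt_min => /and3P[t0 te _].
apply: le_trans (h t _) _; first by rewrite t0.
by rewrite ler_wpM2r ?exprn_ge0 ?ler_norm// ltW.
Qed.

Lemma lead_ext m n (f g : R -> 'rV[C]_m) a e : 0 < e ->
  (forall t, 0 < t < e -> f t = g t) -> lead n f a -> lead n g a.
Proof.
move=> e0 fg [K K0 [d /andP[d0 _] h]].
apply: (@leadI _ _ _ _ K (Num.min d e)); first by rewrite lt_min d0.
move=> t; rewrite lt_min => /and3P[t0 td te].
by rewrite -fg ?t0// h ?t0.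
Qed.

Lemma leadD m n (f g : R -> 'rV[C]_m) a b : lead n f a -> lead n g b ->
  lead n (fun t => f t + g t) (a + b).
Proof.
move=> [K K0 [d /andP[d0 _] h]] [K' K'0 [d' /andP[d'0 _] h']].
apply: (@leadI _ _ _ _ (K + K') (Num.min d d')); first by rewrite lt_min d0.
move=> t; rewrite lt_min => /and3P[t0 td td'].
rewrite scalerDr opprD addrACA mulrDl; apply: le_trans (vnD _ _) _.
by apply: lerD; [apply: h|apply: h']; rewrite t0.
Qed.

Lemma nm_pow (t : R) n : 0 < t -> nm (t%:C ^+ n) = t ^+ n.
Proof. by move=> t0; rewrite nmX nm_real gtr0_norm. Qed.

Lemma leadZ m n (c : C) (f : R -> 'rV[C]_m) a : lead n f a ->
  lead n (fun t => c *: f t) (c *: a).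
Proof.
move=> [K K0 [d /andP[d0 _] h]].
apply: (@leadI _ _ _ _ (nm c * K) d) => // t ht.
rewrite scalerA mulrC -scalerA -scalerBr vnZ -mulrA.
by apply: ler_wpM2l; [exact: nm_ge0|exact: h].
Qed.

Lemma leadB m n (f g : R -> 'rV[C]_m) a b : lead n f a -> lead n g b ->
  lead n (fun t => f t - g t) (a - b).
Proof.
move=> hf /(leadZ (-1)); rewrite scaleN1r => /(leadD hf); apply: lead_ext ltr01 _ => t _.
by rewrite scaleN1r.
Qed.

Lemma lead_cv m n (f : R -> 'rV[C]_m) a : lead n f a ->
  lead n (fun t => cv (f t)) (cv a).
Proof.
move=> [K K0 [d /andP[d0 _] h]]; apply: (@leadI _ _ _ _ K d) => // t ht.
apply: le_trans (h t ht); rewrite (_ : _ - _ = cv (f t - t%:C ^+ n *: a)); first exact: vn_cv.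
rewrite -scaleN1r -[in RHS]scaleN1r cvD !cvZ rmorphN rmorph1 rmorphXn /=.
by rewrite conj_real.
Qed.

Lemma lead_bound m n (f : R -> 'rV[C]_m) a : lead n f a -> exists2 K : R, 0 <= K &
  exists2 e : R, 0 < e & forall t, 0 < t < e -> vn (f t) <= K * t ^+ n.
Proof.
move=> [K K0 [d /andP[d0 d1] h]]; exists (K + vn a); first by rewrite addr_ge0 ?vn_ge0.
exists d => // t /andP[t0 td].
rewrite -[f t](subrK (t%:C ^+ n *: a)); apply: le_trans (vnD _ _) _.
rewrite vnZ nm_pow// mulrDl [vn a * _]mulrC lerD2r.
apply: le_trans (h t _) _; first by rewrite t0.
rewrite exprS ler_wpM2l// ler_piMl ?exprn_ge0 ?ltW//.
exact: lt_le_trans td d1.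
Qed.

Lemma leadW m n j (f : R -> 'rV[C]_m) a : (j < n)%N -> lead n f a -> lead j f 0.
Proof.
move=> jn /lead_bound[K K0 [e e0 h]].
apply: (@leadI _ _ _ _ K (Num.min e 1)); first by rewrite lt_min e0 ltr01.
move=> t; rewrite lt_min => /and3P[t0 te t1]; rewrite scaler0 subr0.
apply: le_trans (h t _) _; first by rewrite t0.
by apply: ler_wpM2l => //; apply: ler_wiXn2l; rewrite ?ltW.
Qed.

Lemma lead_uniq m n (f : R -> 'rV[C]_m) a b : lead n f a -> lead n f b -> a = b.
Proof.
move=> [K K0 [d /andP[d0 _] h]] [K' K'0 [d' /andP[d'0 _] h']].
apply/eqP; rewrite -subr_eq0 -vn_eq0; apply/eqP.
have hab t : 0 < t < Num.min d d' -> vn (a - b) <= (K + K') * t.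
  rewrite lt_min => /and3P[t0 td td'].
  have tn : 0 < t ^+ n by rewrite exprn_gt0.
  rewrite -(ler_pM2l tn) -(nm_pow n t0) -vnZ.
  rewrite (_ : _ *: _ = (f t - t%:C ^+ n *: b) - (f t - t%:C ^+ n *: a)); last first.
    by rewrite scalerBr opprB [RHS]addrC subrKA.
  apply: le_trans (vnD _ _) _; rewrite vnN addrC nm_pow// mulrC -mulrA -exprS mulrDl.
  by apply: lerD; [apply: h|apply: h']; rewrite t0.
apply/le_anti; rewrite vn_ge0 andbT leNgt; apply/negP => v0.
pose t := Num.min (Num.min d d') (vn (a - b) / (K + K' + 1)) / 2.
have K1 : 0 < K + K' + 1 by rewrite ltr_pwDr ?addr_ge0.
have m0 : 0 < Num.min (Num.min d d') (vn (a - b) / (K + K' + 1)).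
  by rewrite lt_min lt_min d0 d'0 divr_gt0.
have tt : 0 < t < Num.min (Num.min d d') (vn (a - b) / (K + K' + 1)).
  by rewrite /t divr_gt0//= ltr_pdivrMr// ltr_pMr// ltr1n.
move: tt; rewrite [t < _]lt_min => /and3P[t0 t1 t2].
have := hab t; rewrite t0 t1 => /(_ isT); rewrite leNgt => /negP; apply.
move: t2; rewrite ltr_pdivlMr// mulrC; apply: le_lt_trans.
by rewrite ler_pM2r// lerDl.
Qed.

Variables (d k : nat) (H : 'I_k -> 'M[C]_d).

Lemma vn_B : exists2 K : R, 0 <= K & forall x y, vn (B H x y) <= K * vn x * vn y.
Proof.
pose K := \sum_j \sum_a \sum_b nm (H j a b).
have K0 j : 0 <= \sum_a \sum_b nm (H j a b).
  by apply: sumr_ge0 => a _; apply: sumr_ge0 => b _; exact: nm_ge0.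
exists K => [|x y]; first by apply: sumr_ge0.
apply: vn_le => [|j]; first by rewrite !mulr_ge0 ?vn_ge0// sumr_ge0.
rewrite BE; apply: le_trans (nm_sum _ _ _) _.
have : \sum_a \sum_b nm (H j a b) * (vn x * vn y) <= K * vn x * vn y.
  under eq_bigr do rewrite -mulr_suml; rewrite -mulr_suml -mulrA.
  apply: ler_wpM2r; first by rewrite mulr_ge0 ?vn_ge0.
  by rewrite /K (bigD1 j)//= lerDl sumr_ge0.
apply: le_trans; apply: ler_sum => a _; apply: le_trans (nm_sum _ _ _) _.
apply: ler_sum => b _; rewrite !nmM mulrAC mulrC.
by apply: ler_wpM2l; [exact: nm_ge0|apply: ler_pM; rewrite ?nm_ge0 ?nm_coord].
Qed.

Lemma BBl x y z : B H (x - y) z = B H x z - B H y z.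
Proof. by rewrite -scaleN1r BDl BZl scaleN1r. Qed.

Lemma BBr x y z : B H z (x - y) = B H z x - B H z y.
Proof. by rewrite -scaleN1r BDr BZr scaleN1r. Qed.

Lemma lead_B n j (f g : R -> 'rV[C]_d) a b : lead n f a -> lead j g b ->
  lead (n + j) (fun t => B H (f t) (g t)) (B H a b).
Proof.
move=> hf hg; have [K K0 hK] := vn_B.
have [L L0 [e e0 hL]] := lead_bound hg.
move: hf => [K1 K10 [d1 /andP[d10 d11] h1]]; move: hg => [K2 K20 [d2 /andP[d20 _] h2]].
apply: (@leadI _ _ _ _ (K * K1 * L + K * vn a * K2) (Num.min e (Num.min d1 d2))).
  by rewrite !lt_min e0 d10.
move=> t; rewrite !lt_min => /and4P[t0 te td1 td2].
rewrite (_ : _ - _ = B H (f t - t%:C ^+ n *: a) (g t) +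
    t%:C ^+ n *: B H a (g t - t%:C ^+ j *: b)); last first.
  rewrite BBl BBr BZl BZr scalerBr scalerA -exprD.
  by rewrite addrA subrK.
apply: le_trans (vnD _ _) _; rewrite mulrDl vnZ nm_pow//.
have := hL t; rewrite t0 te => /(_ isT) {}hL.
have := h1 t; rewrite t0 td1 => /(_ isT) {}h1.
have := h2 t; rewrite t0 td2 => /(_ isT) {}h2.
have tn p : 0 <= t ^+ p by rewrite exprn_ge0// ltW.
apply: lerD.
  apply: le_trans (hK _ _) _.
  apply: (@le_trans _ _ (K * (K1 * t ^+ n.+1) * (L * t ^+ j))).
    by apply: ler_pM; rewrite ?vn_ge0 ?mulr_ge0 ?vn_ge0//; exact: ler_wpM2l.
  by rewrite -addSn exprD; rewrite le_eqVlt; apply/orP; left; apply/eqP; ring.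
apply: (@le_trans _ _ (t ^+ n * (K * vn a * (K2 * t ^+ j.+1)))).
  apply: ler_wpM2l => //; apply: le_trans (hK _ _) _.
  by apply: ler_wpM2l => //; rewrite mulr_ge0 ?vn_ge0.
by rewrite -addnS exprD; rewrite le_eqVlt; apply/orP; left; apply/eqP; ring.
Qed.

End LeadingTerm.

(** * Weighted Taylor expansion, z of weight 1 and w of weight 2 *)

Section WeightedTaylor.
Variables (R : realType) (d k : nat).
Local Notation C := (R[i] : numClosedFieldType).
Local Notation V := 'rV[C]_(d + k).
Implicit Types (x y v : V) (F G : V -> C) (r : R) (s : seq 'I_(d + k)).

Definition wt s : nat := \sum_(i <- s) (d <= i).+1.

Lemma size_wt s : (size s <= wt s)%N.
Proof.
by rewrite /wt; elim: s => [|i s IH]; rewrite ?big_nil// big_cons /=; lia.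
Qed.

Lemma wt_size s : (wt s <= 2 * size s)%N.
Proof.
by rewrite /wt; elim: s => [|i s IH]; rewrite ?big_nil// big_cons /=; case: (d <= i)%N; lia.
Qed.

Definition dil (t : C) x : V := row_mx (t *: lsubmx x) (t ^+ 2 *: rsubmx x).

Lemma dilE t x i : dil t x 0 i = t ^+ (d <= i).+1 * x 0 i.
Proof.
rewrite -[x in RHS]hsubmxK; case: (split_ordP i) => j -> /=.
  by rewrite !row_mxEl mxE leqNgt ltn_ord expr1.
by rewrite !row_mxEr mxE leq_addr.
Qed.

Lemma mono_dil s t x : mono s (dil t x) = t ^+ wt s * mono s x.
Proof.
rewrite /mono /wt; elim: s => [|i s IH]; first by rewrite !big_nil mul1r.
by rewrite !big_cons IH dilE exprD; ring.
Qed.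

(** The component of weighted degree n of the Taylor series at 0. A word of length above n has
    weight above n, so lengths up to n suffice. *)
Definition wtT F n x : C :=
  \sum_(j < n.+1) (j`!%:R)^-1 * \sum_(s <- words _ j | wt s == n) mono s x * spart s F 0.

Lemma wtT_widen F m n x : (m <= n)%N -> wtT F m x =
  \sum_(j < n.+1) (j`!%:R)^-1 * \sum_(s <- words _ j | wt s == m) mono s x * spart s F 0.
Proof.
move=> mn; rewrite /wtT -!(big_mkord xpredT (fun j => (j`!%:R)^-1 *
  \sum_(s <- words _ j | wt s == m) mono s x * spart s F 0)).
rewrite [RHS](@big_cat_nat _ _ _ m.+1)//= -[LHS]addr0; congr (_ + _); rewrite big_nat big1//.
move=> j /andP[mj _]; rewrite big_seq_cond big1 ?mulr0//.
by move=> s /andP[/size_words sj /eqP sm]; have := size_wt s; rewrite sm sj leqNgt mj.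
Qed.

(** The Taylor polynomial is cut at ordinary degree n, so after dilation it also contains words of
    weight n + 1 to 2 n; these form the part divisible by t^(n+1). *)
Lemma hcomp_dil F n t x : \sum_(j < n.+1) (j`!%:R)^-1 * hcomp F j (dil t x) 0 =
  \sum_(m < n.+1) t ^+ m * wtT F m x + t ^+ n.+1 *
  \sum_(j < n.+1) (j`!%:R)^-1 * \sum_(s <- words _ j | (n < wt s)%N)
    t ^+ (wt s - n.+1) * (mono s x * spart s F 0).
Proof.
have -> : \sum_(m < n.+1) t ^+ m * wtT F m x = \sum_(j < n.+1) (j`!%:R)^-1 *
    \sum_(s <- words _ j | (wt s <= n)%N) t ^+ wt s * (mono s x * spart s F 0).
  under eq_bigr => m _ do rewrite (wtT_widen F x (ltn_ord m : (m <= n)%N)) mulr_sumr.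
  rewrite exchange_big /=; apply: eq_bigr => j _.
  under eq_bigr do rewrite mulrCA; rewrite -mulr_sumr; congr (_ * _).
  rewrite (eq_bigr (fun m : 'I_n.+1 => \sum_(s <- words _ j)
    if wt s == m then t ^+ m * (mono s x * spart s F 0) else 0)); last first.
    by move=> m _; rewrite mulr_sumr big_mkcond.
  rewrite exchange_big [RHS]big_mkcond /=; apply: eq_bigr => s _.
  case: leqP => sn; last first.
    by rewrite big1// => m _; case: eqP => // sm; move: (ltn_ord m); rewrite -sm ltnNge sn.
  rewrite (bigD1 (Ordinal (sn : (wt s < n.+1)%N)))//= eqxx big1 ?addr0// => m.
  by rewrite -val_eqE /= eq_sym => /negPf ->.
rewrite mulr_sumr -big_split; apply: eq_bigr => j _ /=.
rewrite mulrCA -mulrDr; congr (_ * _); rewrite mulr_sumr /hcomp.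
rewrite (bigID (fun s => (wt s <= n)%N)) /=; congr (_ + _).
  by apply: eq_bigr => s _; rewrite mono_dil mulrA.
apply: eq_big => [s|s]; first by rewrite ltnNge.
by rewrite -ltnNge => ns; rewrite mono_dil !mulrA -exprD subnKC.
Qed.

Lemma near_bounded F r : 0 < r -> hol r F ->
  exists2 rho, 0 < rho < r & exists M, forall y, vn y <= rho -> nm (F y) <= M.
Proof.
move=> r0 hF.
have v0 : vn (0 : V) < r by rewrite vn0.
have [e e0 [M hM]] := near_bounded_hol (hol_near hF v0).
exists (Num.min e (r / 2)); first by rewrite lt_min e0 divr_gt0// gt_min; apply/orP; right; lra.
exists M => y; rewrite le_min => /andP[ye _].
by have [_] := hM y ye; rewrite add0r.
Qed.

Lemma vn_dil (t : R) x : 0 < t <= 1 -> vn (dil t%:C x) <= t * vn x.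
Proof.
move=> /andP[t0 t1]; apply: vn_le => [|i]; first by rewrite mulr_ge0 ?vn_ge0// ltW.
rewrite dilE nmM nm_pow//; apply: ler_pM; rewrite ?nm_ge0 ?nm_coord//.
  by rewrite exprn_ge0// ltW.
by case: (d <= i)%N; rewrite ?expr1// expr2 ger_pMl.
Qed.

Lemma wtT_expand F r n x : 0 < r -> hol r F -> (forall m, (m < n)%N -> wtT F m x = 0) ->
  exists K, exists2 e, 0 < e & forall t, 0 < t < e ->
    nm (F (dil t%:C x) - t%:C ^+ n * wtT F n x) <= K * t ^+ n.+1.
Proof.
move=> r0 hF T0; have [rho rhor [M hM]] := near_bounded r0 hF.
have /andP[rho0 _] := rhor.
have M0 : 0 <= M by apply: le_trans (nm_ge0 (F 0)) (hM _ _); rewrite vn0 ltW.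
pose K2 : R := \sum_(j < n.+1) nm (j`!%:R)^-1 * \sum_(s <- words _ j | (n < wt s)%N)
    nm (mono s x * spart s F 0).
exists (4 * M * (vn x / rho) ^+ n.+1 + K2).
pose e := Num.min 1 (rho / 2 / (vn x + 1)).
have vx1 : 0 < vn x + 1 by rewrite ltr_pwDr ?vn_ge0.
exists e => [|t]; first by rewrite lt_min ltr01 !divr_gt0.
rewrite lt_min => /and3P[t0 t1 te].
have ht : 0 < t <= 1 by rewrite t0 ltW.
have vt : vn (dil t%:C x) <= rho / 2.
  apply: le_trans (vn_dil x ht) _; move: te; rewrite ltr_pdivlMr// => /ltW; apply: le_trans.
  by rewrite ler_pM2l// lerDl.
have := taylor n.+1 rhor hF hM vt; rewrite hcomp_dil.
rewrite big_ord_recr big1 /= ?add0r; last first.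
  by move=> m _; rewrite T0 ?mulr0.
set S := \sum_(j < n.+1) _; set T := wtT F n x => h.
have hS : nm S <= K2.
  apply: le_trans (nm_sum _ _ _) _; apply: ler_sum => j _; rewrite nmM.
  apply: ler_wpM2l; first exact: nm_ge0.
  apply: le_trans (nm_sum _ _ _) _; apply: ler_sum => s _; rewrite nmM nm_pow//.
  by rewrite ler_piMl ?nm_ge0// exprn_ile1// ltW.
rewrite (_ : _ - _ = (F (dil t%:C x) - (t%:C ^+ n * T + t%:C ^+ n.+1 * S)) + t%:C ^+ n.+1 * S); last by ring.
apply: le_trans (nmD _ _) _; rewrite mulrDl nmM nm_pow// [K2 * _]mulrC.
have tn : 0 <= t ^+ n.+1 by rewrite exprn_ge0// ltW.
apply: lerD; last exact: ler_wpM2l.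
apply: le_trans h _; rewrite -[leRHS]mulrA; apply: ler_wpM2l; first by rewrite mulr_ge0.
rewrite -exprMn; apply: lerXn2r.
- by rewrite nnegrE divr_ge0 ?vn_ge0 ?ltW.
- by rewrite nnegrE mulr_ge0 ?divr_ge0 ?vn_ge0 ?ltW.
by rewrite [leRHS]mulrAC ler_pM2r ?invr_gt0// mulrC vn_dil.
Qed.

Definition wtTv m (P : V -> 'rV[C]_m) n x : 'rV[C]_m := \row_i wtT (fun y => P y 0 i) n x.

Lemma wtTv_lead m (P : V -> 'rV[C]_m) r n x : 0 < r ->
  (forall i, hol r (fun y => P y 0 i)) -> (forall j, (j < n)%N -> wtTv P j x = 0) ->
  lead n (fun t => P (dil t%:C x)) (wtTv P n x).
Proof.
move=> r0 hP T0.
have h i : exists K, exists2 e, 0 < e & forall t, 0 < t < e ->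
    nm (P (dil t%:C x) 0 i - t%:C ^+ n * wtTv P n x 0 i) <= K * t ^+ n.+1.
  have := @wtT_expand (fun y => P y 0 i) r n x r0 (hP i).
  rewrite /wtTv mxE; apply.
  by move=> j /T0/rowP/(_ i); rewrite !mxE.
have [K hK] := choice h.
have [e e0 he] := common_delta hK.
apply: (@leadI _ _ _ _ _ (\sum_i `|K i|) e) => // t ht.
have t0 : 0 <= t ^+ n.+1 by case/andP: ht => /ltW ? _; rewrite exprn_ge0.
apply: vn_le => [|i]; first by rewrite mulr_ge0// sumr_ge0.
rewrite !rvE; apply: le_trans (he i t ht) _; apply: ler_wpM2r => //.
apply: le_trans (ler_norm _) _; rewrite (bigD1 i)//= lerDl.
by rewrite sumr_ge0.
Qed.

End WeightedTaylor.

(** * Low weights, ordinary order, and flatness *)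

Section WeightedTaylorCoefficients.
Variables (R : realType) (d k : nat).
Local Notation C := (R[i] : numClosedFieldType).
Local Notation V := 'rV[C]_(d + k).
Implicit Types (x y v : V) (F G : V -> C) (r : R) (s : seq 'I_(d + k)).

Lemma wtT0 F x : wtT F 0 x = F 0.
Proof.
by rewrite /wtT big_ord1 invr1 mul1r /= big_mkcond big_seq1 /wt /mono !big_nil /= mul1r.
Qed.

Lemma sum_words1 (h : seq 'I_(d + k) -> C) (P : pred (seq 'I_(d + k))) :
  \sum_(s <- words _ 1 | P s) h s = \sum_i if P [:: i] then h [:: i] else 0.
Proof. by rewrite big_mkcond /= cats0 big_map big_enum. Qed.

Definition wt_part F n j x : C := \sum_(s <- words _ j | wt s == n) mono s x * spart s F 0.

Lemma wt_part0 F n x : wt_part F n.+1 0 x = 0.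
Proof. by rewrite /wt_part big_mkcond big_seq1 /wt big_nil. Qed.

Lemma wt_part1 F n x : wt_part F n 1 x =
  \sum_(i < d + k) if (d <= i).+1 == n then x 0 i * dpart i F 0 else 0.
Proof.
rewrite /wt_part sum_words1; apply: eq_bigr => i _.
by rewrite /wt /mono !big_seq1.
Qed.

Lemma wtT1 F z w : wtT F 1 (row_mx z w) = \sum_i z 0 i * dpart (lshift k i) F 0.
Proof.
have -> : wtT F 1 (row_mx z w) = (0`!%:R)^-1 * wt_part F 1 0 (row_mx z w) +
    (1`!%:R)^-1 * wt_part F 1 1 (row_mx z w) by rewrite /wtT big_ord_recl big_ord1.
rewrite wt_part0 mulr0 add0r invr1 mul1r wt_part1 big_split_ord /= [X in _ + X]big1 ?addr0.
  by apply: eq_bigr => i _; rewrite leqNgt ltn_ord row_mxEl.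
by move=> i _; rewrite leq_addr.
Qed.

(** A word whose weight equals its length involves z only. *)
Lemma mono_l s z w w' c : wt s = size s ->
  mono s (row_mx (c *: z) w) = c ^+ size s * mono s (row_mx z w' : V).
Proof.
rewrite /mono /wt; elim: s => [|i s IH]; first by rewrite !big_nil mul1r.
have := size_wt s; rewrite /wt !big_cons /= => sw E.
have [id Es] : (i < d)%N /\ (\sum_(j <- s) (d <= j).+1)%N = size s.
  move: (\sum_(j <- s) _)%N sw E => W; rewrite ltnNge; case: (d <= i)%N => /=; lia.
move: id; rewrite IH//; case: (split_ordP i) => j -> /= jd; last by (exfalso; move: jd => /=; lia).
by rewrite !row_mxEl rvZ exprS; ring.
Qed.

Lemma wtT2 F : exists2 q : 'rV[C]_d -> C, forall c z, q (c *: z) = c ^+ 2 * q z &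
  forall z w, wtT F 2 (row_mx z w) = \sum_i w 0 i * dpart (rshift d i) F 0 + q z.
Proof.
exists (fun z => (2`!%:R)^-1 * wt_part F 2 2 (row_mx z 0)) => [c z|z w].
  rewrite mulrCA; congr (_ * _).
  rewrite /wt_part mulr_sumr [LHS]big_seq_cond [RHS]big_seq_cond.
  apply: eq_bigr => s /andP[/size_words ss /eqP sw].
  by rewrite (@mono_l s z 0 0 c) ?ss// mulrA.
have -> : wtT F 2 (row_mx z w) = (0`!%:R)^-1 * wt_part F 2 0 (row_mx z w) +
    ((1`!%:R)^-1 * wt_part F 2 1 (row_mx z w) + (2`!%:R)^-1 * wt_part F 2 2 (row_mx z w)).
  by rewrite /wtT 2!big_ord_recl big_ord1.
rewrite wt_part0 mulr0 add0r; congr (_ + _ * _).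
  rewrite invr1 mul1r wt_part1 big_split_ord /= big1 ?add0r.
    by apply: eq_bigr => i _; rewrite leq_addr row_mxEr.
  by move=> i _; rewrite leqNgt ltn_ord.
rewrite /wt_part [LHS]big_seq_cond [RHS]big_seq_cond.
apply: eq_bigr => s /andP[/size_words ss /eqP sw].
by rewrite -[in LHS](scale1r z) (@mono_l s z w 0 1) ?ss// expr1n mul1r.
Qed.

Lemma wtT_low F n m x : (forall s, (size s <= n)%N -> spart s F 0 = 0) -> (m <= n)%N ->
  wtT F m x = 0.
Proof.
move=> hs mn; rewrite /wtT big1// => j _; rewrite big_seq_cond big1 ?mulr0//.
move=> s /andP[/size_words ss _]; rewrite hs ?mulr0// ss.
by have := ltn_ord j; lia.
Qed.

Lemma wtT_poly F n (g : C -> V) : pcurve g -> ispoly (fun t => wtT F n (g t)).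
Proof.
move=> gP; apply: ispoly_sum => j; apply: ispolyZ; apply: ispoly_sum => s.
by apply: ispolyM; [exact: ispoly_prod|exact: ispoly_cst].
Qed.

(** Under scaling of both z and w by t a monomial is homogeneous of its length, so each weighted
    component inherits the ordinary order of F. *)
Lemma wtT_order F n m x : (forall s, (size s <= n)%N -> spart s F 0 = 0) ->
  exists Q : {poly C}, forall t, wtT F m (t *: x) = t ^+ n.+1 * Q.[t].
Proof.
move=> hs.
exists (\sum_(j < m.+1) (j`!%:R)^-1 *:
  \sum_(s <- words _ j | wt s == m) (mono s x * spart s F 0) *: 'X^(size s - n.+1)).
move=> t; rewrite horner_sum mulr_sumr; apply: eq_bigr => j _.
rewrite hornerZ mulrCA; congr (_ * _); rewrite horner_sum mulr_sumr.
apply: eq_bigr => s _; rewrite mono_scale hornerZ hornerXn.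
have [sn|ns] := leqP (size s) n; first by rewrite hs// !(mulr0, mul0r).
by rewrite -[in LHS](subnKC ns) exprD; ring.
Qed.

(** The words of length j are spread over the weights j to 2 j. Inside one weight, scaling x by t
    separates the lengths, so each piece [c n j] vanishes by itself. *)
Lemma wtT_hcomp F j x : (forall n y, wtT F n y = 0) -> hcomp F j x 0 = 0.
Proof.
move=> T0; pose c n (i : nat) := (i`!%:R)^-1 *
  \sum_(s <- words _ i | wt s == n) mono s x * spart s F 0.
have c0 n : (j <= n)%N -> c n j = 0.
  move=> jn; pose P : {poly C} := \poly_(i < n.+1) c n i.
  have P0 : P = 0.
    apply: poly_eq_nz => t _; rewrite horner0 -(T0 n (t *: x)) horner_poly.
    apply: eq_bigr => i _; rewrite /c -mulrA mulr_suml; congr (_ * _).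
    rewrite [LHS]big_seq_cond [RHS]big_seq_cond; apply: eq_bigr => s /andP[/size_words ss _].
    by rewrite mono_scale ss; ring.
  by have := coef_poly n.+1 (c n) j; rewrite -/P P0 coef0 ltnS jn.
suff -> : hcomp F j x 0 = j`!%:R * \sum_(j <= n < (2 * j).+1) c n j.
  by rewrite big_nat big1 ?mulr0// => n /andP[/c0].
have f0 : (j`!%:R : C) != 0 by rewrite pnatr_eq0 -lt0n fact_gt0.
rewrite /c -mulr_sumr mulrA mulfV// mul1r.
under eq_bigr do rewrite big_mkcond.
rewrite exchange_big /= /hcomp [LHS]big_seq [RHS]big_seq; apply: eq_bigr => s /size_words ss.
rewrite (bigD1_seq (wt s)) ?iota_uniq//=; last first.
  by rewrite mem_index_iota -ss size_wt ltnS wt_size.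
by rewrite eqxx big1 ?addr0// => i; rewrite eq_sym => /negPf ->.
Qed.

(** On the ball of radius rho / 2 the Taylor remainder of order n is at most a constant times
    2^-n. *)
Lemma flat_zero F r : 0 < r -> hol r F -> (forall n x, wtT F n x = 0) ->
  exists2 e, 0 < e & forall x, vn x < e -> F x = 0.
Proof.
move=> r0 hF T0; have [rho rhor [M hM]] := near_bounded r0 hF.
have /andP[rho0 _] := rhor.
exists (rho / 2) => [|x /ltW xr]; first by rewrite divr_gt0.
apply: nm0_eq0; apply/le_anti; rewrite nm_ge0 andbT leNgt; apply/negP => v0.
have M0 : 0 <= M by apply: le_trans (nm_ge0 (F 0)) (hM _ _); rewrite vn0 ltW.
have h n : nm (F x) <= 4 * M * (1 / 2) ^+ n.
  have := taylor n rhor hF hM xr.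
  rewrite big1 ?subr0 => [|j _]; last by rewrite wtT_hcomp ?mulr0.
  move=> /le_trans; apply; apply: ler_wpM2l; first by rewrite mulr_ge0.
  apply: lerXn2r.
  - by rewrite nnegrE divr_ge0 ?vn_ge0 ?ltW.
  - by rewrite nnegrE divr_ge0.
  - by rewrite ler_pdivrMr// mul1r mulrC.
have [N hN] : exists N : nat, 4 * M / nm (F x) < N%:R.
  by exists (Num.truncn (4 * M / nm (F x))).+1; rewrite truncnS_gt// divr_ge0 ?mulr_ge0 ?ltW.
have := h N; rewrite expr_div_n expr1n mul1r ler_pdivlMr ?exprn_gt0// leNgt => /negP; apply.
move: hN; rewrite ltr_pdivrMr// => /lt_trans; apply.
rewrite mulrC ltr_pM2l// -natrX ltr_nat; exact: ltn_expl.
Qed.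

Lemma wtTv1 m (P : V -> 'rV[C]_m) z w : wtTv P 1 (row_mx z w) =
  z *m \matrix_(i, j) dpart (lshift k i) (fun y => P y 0 j) 0.
Proof.
by apply/rowP => j; rewrite !mxE wtT1; apply: eq_bigr => i _; rewrite mxE.
Qed.

Lemma wtTv2 m (P : V -> 'rV[C]_m) : exists2 q : 'rV[C]_d -> 'rV[C]_m,
  forall c z, q (c *: z) = c ^+ 2 *: q z &
  forall z w, wtTv P 2 (row_mx z w) =
    w *m \matrix_(i, j) dpart (rshift d i) (fun y => P y 0 j) 0 + q z.
Proof.
have h j : exists q : 'rV[C]_d -> C, (forall c z, q (c *: z) = c ^+ 2 * q z) /\
  forall z w, wtT (fun y => P y 0 j) 2 (row_mx z w) =
    \sum_i w 0 i * dpart (rshift d i) (fun y => P y 0 j) 0 + q z.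
  by have [q q1 q2] := wtT2 (fun y => P y 0 j); exists q.
have [q hq] := choice h.
exists (fun z => \row_j q j z) => [c z|z w]; apply/rowP => j.
  by rewrite rvZ !mxE (hq j).1.
rewrite mxE (hq j).2 rvD [RHS]addrC mxE addrC; congr (_ + _).
by rewrite mxE; apply: eq_bigr => i _; rewrite mxE.
Qed.

End WeightedTaylorCoefficients.

Section SesquilinearPolarisation.
Variables (C : numClosedFieldType) (d k : nat) (H : 'I_k -> 'M[C]_d).
Local Notation ii := ('i%R : C).

Lemma B_rot x y : B H (ii *: x) (cv (ii *: y)) = B H x (cv y).
Proof. by rewrite BZl cvZ BZr scalerA conjCi mulrN mulCii opprK scale1r. Qed.

Lemma cvN m (x : 'rV[C]_m) : cv (- x) = - cv x.
Proof. by rewrite -scaleN1r cvZ rmorphN1 scaleN1r. Qed.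

Lemma zero_of_opp m (x : 'rV[C]_m) : x = - x -> x = 0.
Proof.
by move=> /eqP; rewrite -addr_eq0 -mulr2n -scaler_nat scaler_eq0 pnatr_eq0 => /eqP.
Qed.

Lemma addr4 (W : zmodType) (p x x' y : W) : p + x' + (x + y) = p + (x + x' + y).
Proof. by rewrite [x + x']addrC -!addrA. Qed.

Lemma B_polar (f : 'rV[C]_d -> 'rV[C]_d -> 'rV[C]_k) :
  (forall x x' y, f (x + x') y = f x y + f x' y) ->
  (forall x y y', f x (y + y') = f x y + f x y') ->
  (forall x y, f (ii *: x) y = ii *: f x y) -> (forall x y, f x (ii *: y) = - ii *: f x y) ->
  (forall x, f x x = 0) -> forall x y, f x y = 0.
Proof.
move=> Dl Dr Zl Zr f0.
have sk x y : f y x = - f x y.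
  have := f0 (x + y); rewrite Dl !Dr !f0 add0r addr0 => /eqP.
  by rewrite addrC addr_eq0 => /eqP.
move=> x y; have := sk x (ii *: y); rewrite Zl Zr sk scaleNr opprK scalerN.
move=> /esym/zero_of_opp/eqP; rewrite scaler_eq0 (negPf (neq0Ci _)) => /eqP //.
Qed.

End SesquilinearPolarisation.

(** * From two automorphisms with equal jets to the infinitesimal equation *)

Section Linearisation.
Variables (R : realType) (d k : nat).
Local Notation C := (R[i] : numClosedFieldType).
Local Notation V := 'rV[C]_(d + k).
Local Notation ii := ('i%R : C).
Variable H : 'I_k -> 'M[C]_d.
Hypothesis Hherm : forall j, H j \is hermsymmx.
Hypothesis Hker : forall z : 'rV[C]_d, (forall j, z *m H j = 0) -> z = 0.
Implicit Types (x y : V) (z : 'rV[C]_d) (w u : 'rV[C]_k).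

Lemma quadricP x : quadric H x <->
  rsubmx x - cv (rsubmx x) = (2 * ii) *: B H (lsubmx x) (cv (lsubmx x)).
Proof.
have i2 : 2 * ii != 0 by rewrite mulf_neq0 ?neq0Ci// pnatr_eq0.
have step j : ('Im (rsubmx x 0 j) = (lsubmx x *m H j *m (map_mx Num.conj_op (lsubmx x)^T)) 0 0) <->
    (rsubmx x - cv (rsubmx x)) 0 j = ((2 * ii) *: B H (lsubmx x) (cv (lsubmx x))) 0 j.
  rewrite !rvE BjE map_trmx [cv (rsubmx x) 0 j]mxE.
  set b := (X in _ = X <-> _); set c := (X in _ <-> _ = _ * X); have -> : c = b by [].
  move: (rsubmx x 0 j) b => {c} c b; rewrite ImE.
  have E : 'i * (Num.conj_op c - c) / 2 * (2 * ii) = c - Num.conj_op c.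
    rewrite mulrA divfK ?pnatr_eq0// mulrAC mulCii; ring.
  by split=> [<-|h]; [rewrite mulrC E|apply: (mulIf i2); rewrite E h mulrC].
split=> h; first by apply/rowP => j; apply/step; exact: h.
by move=> j; apply/step; rewrite h.
Qed.

(** Parametrises the quadric by z and the real part u of w. *)
Definition mpt z u : V := row_mx z (u + ii *: B H z (cv z)).

Lemma quadric_mpt z u (t : R) : cv u = u -> quadric H (dil t%:C (mpt z u)).
Proof.
move=> cu; apply/quadricP; rewrite row_mxKl row_mxKr row_mxKl row_mxKr.
have ct : Num.conj_op (t%:C : C) = t%:C by exact: conj_real.
rewrite !cvZ rmorphXn /= ct cvD cvZ cu conjCi B_conj// cvK BZl BZr.
rewrite -scalerBr scaleNr opprD opprK addrACA subrr add0r -scalerDl.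
by rewrite !scalerA; congr (_ *: _); ring.
Qed.

Lemma pcurve_mulmx m p (g : C -> 'rV[C]_m) (A : 'M[C]_(m, p)) : pcurve g ->
  pcurve (fun t => g t *m A).
Proof.
move=> gP i; under eq_fun do rewrite mxE.
by apply: ispoly_sum => j; apply: ispolyM => //; exact: ispoly_cst.
Qed.

Lemma order_gt_mulmx m p n (g : 'rV[C]_d -> 'rV[C]_k -> 'rV[C]_m) (A : 'M[C]_(m, p)) :
  order_gt n g -> order_gt n (fun z w => g z w *m A).
Proof.
move=> og z w i; have [Q hQ] := choice (og z w).
exists (\sum_j A j i *: Q j) => t.
rewrite mxE horner_sum mulr_sumr; apply: eq_bigr => j _.
by rewrite hQ hornerZ; ring.
Qed.

Lemma pcurve_row_mx m p (g : C -> 'rV[C]_m) (h : C -> 'rV[C]_p) : pcurve g -> pcurve h ->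
  pcurve (fun t => row_mx (g t) (h t)).
Proof.
move=> gP hP i; case: (split_ordP i) => j ->.
  by under eq_fun do rewrite row_mxEl.
by under eq_fun do rewrite row_mxEr.
Qed.

Lemma wtTv_pmap2 m (P : V -> 'rV[C]_m) n : pmap2 (fun z w => wtTv P n (row_mx z w)).
Proof.
move=> g h gP hP i; under eq_fun do rewrite mxE.
by apply: wtT_poly; exact: pcurve_row_mx.
Qed.

Lemma wtTv_order m (P : V -> 'rV[C]_m) n j :
  (forall i s, (size s <= n)%N -> spart s (fun y => P y 0 i) 0 = 0) ->
  order_gt n (fun z w => wtTv P j (row_mx z w)).
Proof.
move=> hs z w i; have [Q hQ] := wtT_order j (row_mx z w : V) (hs i).
by exists Q => t; rewrite mxE -hQ scale_row_mx.
Qed.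

Variables (n rk : nat).
Hypothesis D1 : sums_fill H rk.
Hypothesis rn : (2 * rk <= n)%N.
Hypothesis D2 : (2 * rk < n)%N \/ sums_detect H rk.
Hypothesis n2 : (2 <= n)%N.

Variables (F G : V -> V) (rho : R).
Hypothesis rho0 : 0 < rho.
Hypotheses (hF : forall i, hol rho (fun y => F y 0 i)) (hG : forall i, hol rho (fun y => G y 0 i)).
Hypothesis G0 : G 0 = 0.
Hypothesis jets : forall i s, (size s <= n)%N ->
  spart s (fun y => F y 0 i) 0 = spart s (fun y => G y 0 i) 0.
Hypothesis FM : forall x, vn x < rho -> quadric H x -> quadric H (F x).
Hypothesis GM : forall x, vn x < rho -> quadric H x -> quadric H (G x).
Hypothesis Gunit : \matrix_(i, j) dpart i (fun y => G y 0 j) 0 \in unitmx.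

Let Gz y := lsubmx (G y).
Let Gw y := rsubmx (G y).
Let Ez y := lsubmx (F y - G y).
Let Ew y := rsubmx (F y - G y).

Let hGz i : hol rho (fun y => Gz y 0 i).
Proof. by under eq_fun do rewrite mxE; exact: hG. Qed.
Let hGw i : hol rho (fun y => Gw y 0 i).
Proof. by under eq_fun do rewrite mxE; exact: hG. Qed.

Let EE i : (fun y => (F y - G y) 0 i) = (fun y => F y 0 i + (-1) * G y 0 i).
Proof. by apply/funext => y; rewrite !rvE mulN1r. Qed.
Let hE i : hol rho (fun y => (F y - G y) 0 i).
Proof. rewrite EE; exact: hol_lin (hF i) (hG i). Qed.
Let hEz i : hol rho (fun y => Ez y 0 i).
Proof. by rewrite (_ : (fun y => _) = (fun y => (F y - G y) 0 (lshift k i))); [exact: hE|apply/funext => y; rewrite mxE]. Qed.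
Let hEw i : hol rho (fun y => Ew y 0 i).
Proof. by rewrite (_ : (fun y => _) = (fun y => (F y - G y) 0 (rshift d i))); [exact: hE|apply/funext => y; rewrite mxE]. Qed.

Let jE i s : (size s <= n)%N -> spart s (fun y => (F y - G y) 0 i) 0 = 0.
Proof.
move=> sn; rewrite EE; have v0 : vn (0 : V) < rho by rewrite vn0.
apply: etrans (spart_lin (-1) s (hF i) (hG i) v0) _.
by rewrite (jets i sn) mulN1r subrr.
Qed.
Let jEz i s : (size s <= n)%N -> spart s (fun y => Ez y 0 i) 0 = 0.
Proof. by rewrite (_ : (fun y => _) = (fun y => (F y - G y) 0 (lshift k i))); [exact: jE|apply/funext => y; rewrite mxE]. Qed.
Let jEw i s : (size s <= n)%N -> spart s (fun y => Ew y 0 i) 0 = 0.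
Proof. by rewrite (_ : (fun y => _) = (fun y => (F y - G y) 0 (rshift d i))); [exact: jE|apply/funext => y; rewrite mxE]. Qed.

Let dil_small x : exists2 e, 0 < e & forall t : R, 0 < t < e -> vn (dil t%:C x) < rho.
Proof.
have vx1 : 0 < vn x + 1 by rewrite ltr_pwDr ?vn_ge0.
exists (Num.min 1 (rho / (vn x + 1))); first by rewrite lt_min ltr01 divr_gt0.
move=> t; rewrite lt_min => /and3P[t0 t1].
rewrite ltr_pdivlMr// => tr; apply: le_lt_trans (vn_dil x _) _; first by rewrite t0 ltW.
by apply: le_lt_trans tr; rewrite ler_pM2l// lerDl.
Qed.

Let A := \matrix_(i, j) dpart (lshift k i) (fun y => Gz y 0 j) 0.
Let Cw := \matrix_(i, j) dpart (rshift d i) (fun y => Gw y 0 j) 0.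

Let leadGz x : lead 1 (fun t => Gz (dil t%:C x)) (lsubmx x *m A).
Proof.
rewrite -(wtTv1 Gz _ (rsubmx x)) hsubmxK; apply: wtTv_lead rho0 hGz _ => j; case: j => // _.
by apply/rowP => i; rewrite mxE wtT0 /Gz G0 !mxE.
Qed.

Let Gw0 x : wtTv Gw 0 x = 0.
Proof. by apply/rowP => i; rewrite mxE wtT0 /Gw G0 !mxE. Qed.

Let G_eq x : vn x < rho -> quadric H x -> Gw x - cv (Gw x) = (2 * ii) *: B H (Gz x) (cv (Gz x)).
Proof. by move=> xr /(GM xr)/quadricP. Qed.

Let Gw_eq z u e : cv u = u -> lead 2 (fun t => Gw (dil t%:C (mpt z u))) e ->
  e - cv e = (2 * ii) *: B H (z *m A) (cv (z *m A)).
Proof.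
move=> cu le; have [r r0 hr] := dil_small (mpt z u).
have h1 := leadB le (lead_cv le).
apply: lead_uniq h1 _.
have lz := leadGz (mpt z u); rewrite row_mxKl in lz.
apply: lead_ext r0 _ (leadZ (2 * ii) (lead_B H lz (lead_cv lz))) => t ht.
by rewrite -G_eq; [|exact: hr|exact: quadric_mpt].
Qed.

(** The right side of the equation of the quadric starts in weight 2, so the weight 1 part of [Gw]
    is real; being complex linear in z, it vanishes. *)
Let Gw1 x : wtTv Gw 1 x = 0.
Proof.
have real z : cv (wtTv Gw 1 (row_mx z 0)) = wtTv Gw 1 (row_mx z 0).
  have m1 : wtTv Gw 1 (row_mx z 0) = wtTv Gw 1 (mpt z 0) by rewrite !wtTv1.
  have l1 : lead 1 (fun t => Gw (dil t%:C (mpt z 0))) (wtTv Gw 1 (mpt z 0)).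
    by apply: wtTv_lead rho0 hGw _; case.
  have [r r0 hr] := dil_small (mpt z 0).
  have h1 := leadB l1 (lead_cv l1).
  apply/esym/eqP; rewrite -subr_eq0 m1; apply/eqP; apply: lead_uniq h1 _.
  have lz := leadGz (mpt z 0).
  apply: leadW (lead_ext r0 _ (leadZ (2 * ii) (lead_B H lz (lead_cv lz)))) => // t ht.
  by rewrite -G_eq; [|exact: hr|apply: quadric_mpt; rewrite cv0].
rewrite -[x]hsubmxK wtTv1; move: (lsubmx x) => z.
have := real (ii *: z); have := real z; rewrite !wtTv1 -scalemxAl cvZ conjCi => ->.
move=> /eqP; rewrite -subr_eq0 -scalerBl scaler_eq0 => /orP[|/eqP//].
by rewrite -opprD oppr_eq0 -mulr2n mulrn_eq0 (negPf (neq0Ci _)).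
Qed.

Let Gw2 : exists2 q : 'rV[C]_d -> 'rV[C]_k, forall c z, q (c *: z) = c ^+ 2 *: q z &
  forall z u, cv u = u -> let e := (u + ii *: B H z (cv z)) *m Cw + q z in
    e - cv e = (2 * ii) *: B H (z *m A) (cv (z *m A)).
Proof.
have [q qZ hq] := wtTv2 Gw; exists q => // z u cu /=; rewrite -hq.
apply: (Gw_eq cu); apply: wtTv_lead rho0 hGw _; case=> [|[|]]// _.
Qed.

Let Cw_real u : cv (u *m Cw) = cv u *m Cw.
Proof.
have [q qZ hq] := Gw2.
have q0 : q 0 = 0 by rewrite -(scale0r 0) qZ expr0n scale0r.
have creal v : cv v = v -> cv (v *m Cw) = v *m Cw.
  move=> /(hq 0) /=; rewrite q0 cv0 B0r scaler0 !addr0 mul0mx cv0 B0r scaler0.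
  by move=> /eqP; rewrite subr_eq0 => /eqP.
rewrite /cv map_mxM; congr (_ *m _); apply/matrixP => i j; rewrite mxE.
have dR : cv (delta_mx 0 i : 'rV[C]_k) = delta_mx 0 i.
  by apply/rowP => l; rewrite !mxE; case: (_ && _); rewrite ?rmorph1 ?rmorph0.
by have /rowP/(_ j) := creal _ dR; rewrite mxE -rowE !mxE.
Qed.

(** Replacing z by i z preserves B z (cv z) and changes the sign of the quadratic part q, so both
    sides of the weight 2 equation equal their own opposites. *)
Let BA_diag z : B H (z *m A) (cv (z *m A)) = B H z (cv z) *m Cw.
Proof.
have i2 : 2 * ii != 0 by rewrite mulf_neq0 ?neq0Ci// pnatr_eq0.
have [q qZ hq] := Gw2.
have h v : q v - cv (q v) = (2 * ii) *: (B H (v *m A) (cv (v *m A)) - B H v (cv v) *m Cw).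
  have := hq v 0 (cv0 _ _); rewrite /= add0r scalerBr => <-.
  rewrite cvD Cw_real cvZ conjCi B_conj// cvK -!scalemxAl.
  by apply/rowP => l; rewrite !rvE; ring.
have hz := h z; have := h (ii *: z).
rewrite qZ sqrCi scaleN1r -scalemxAl !B_rot -hz cvN -opprD => /esym/zero_of_opp.
rewrite hz => /eqP; rewrite scaler_eq0 (negPf i2) subr_eq0 => /eqP //.
Qed.

Let BA (x y : 'rV[C]_d) : B H (x *m A) (cv (y *m A)) = B H x (cv y) *m Cw.
Proof.
apply/eqP; rewrite -subr_eq0; apply/eqP.
pose f (x y : 'rV[C]_d) := B H (x *m A) (cv (y *m A)) - B H x (cv y) *m Cw.
apply: (@B_polar _ _ _ f) => {x y} [x x' y|x y y'|x y|x y|x]; rewrite /f.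
- by rewrite mulmxDl !BDl mulmxDl opprD addrACA.
- by rewrite mulmxDl !cvD !BDr mulmxDl opprD addrACA.
- by rewrite -scalemxAl !BZl -scalemxAl scalerBr.
- by rewrite -scalemxAl !cvZ !BZr -scalemxAl conjCi scalerBr.
- by rewrite BA_diag subrr.
Qed.

(** By [Gw1] the w-components of G have no linear term in z, so the Jacobian at 0 is block
    triangular. *)
Let AC_unit : A \in unitmx /\ Cw \in unitmx.
Proof.
have := Gunit; set J := \matrix_(i, j) _ => uJ.
have JE : J = block_mx A 0 (dlsubmx J) Cw.
  rewrite -[LHS]submxK; congr block_mx; apply/matrixP => i j; rewrite !mxE.
  - by congr (dpart _ _ _); apply/funext => y; rewrite mxE.
  - have := Gw1 (row_mx (delta_mx 0 i) 0); rewrite wtTv1 -rowE => /rowP/(_ j).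
    rewrite !mxE => <-; congr (dpart _ _ _); apply/funext => y; rewrite mxE //.
  - by congr (dpart _ _ _); apply/funext => y; rewrite mxE.
move: uJ; rewrite JE unitmxE det_lblock unitrM -!unitmxE => /andP //.
Qed.

Let E_eq x : vn x < rho -> quadric H x -> Ew x - cv (Ew x) =
  (2 * ii) *: (B H (Ez x) (cv (Gz x)) + cv (B H (Ez x) (cv (Gz x))) + B H (Ez x) (cv (Ez x))).
Proof.
move=> xr Mx; have := G_eq xr Mx; have /quadricP := FM xr Mx.
have -> : rsubmx (F x) = Gw x + Ew x by rewrite /Gw /Ew linearB /= addrC subrK.
have -> : lsubmx (F x) = Gz x + Ez x by rewrite /Gz /Ez linearB /= addrC subrK.
rewrite !cvD !BDl !BDr B_conj// cvK => hE' hG'.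
rewrite opprD addrACA hG' in hE'.
apply: (addrI ((2 * ii) *: B H (Gz x) (cv (Gz x)))); rewrite hE' -scalerDr; congr (_ *: _).
exact: addr4.
Qed.

(** The weights nu for w and nu - 1 for z match because the form pairs the z-part of F - G with
    [Gz], of weight 1. The term quadratic in F - G has weight at least 2 (nu - 1) > nu, as nu > n >=
    2. Undoing the linear parts [A] and [Cw] of G, which [BA] intertwines with the form, leaves the
    infinitesimal equation. *)
Let main nu : (n < nu)%N -> (forall j, (j < nu)%N -> forall x, wtTv Ew j x = 0) ->
  (forall j, (j < nu.-1)%N -> forall x, wtTv Ez j x = 0) ->
  forall x, wtTv Ew nu x = 0 /\ wtTv Ez nu.-1 x = 0.
Proof.
move=> nnu hw hz; have [uA uC] := AC_unit.
pose p z w := wtTv Ez nu.-1 (row_mx z w) *m invmx A.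
pose q z w := wtTv Ew nu (row_mx z w) *m invmx Cw.
have pE z w : wtTv Ez nu.-1 (row_mx z w) = p z w *m A by rewrite mulmxKV.
have qE z w : wtTv Ew nu (row_mx z w) = q z w *m Cw by rewrite mulmxKV.
have hp : pmap2 p by move=> g h gP hP; apply: pcurve_mulmx; exact: wtTv_pmap2.
have hq : pmap2 q by move=> g h gP hP; apply: pcurve_mulmx; exact: wtTv_pmap2.
have op : order_gt n p by apply: order_gt_mulmx; exact: wtTv_order jEz.
have oq : order_gt n q by apply: order_gt_mulmx; exact: wtTv_order jEw.
have heq z u : cv u = u -> let w := u + ii *: B H z (cv z) in
    q z w - cv (q z w) = (2 * ii) *: (B H (p z w) (cv z) + cv (B H (p z w) (cv z))).
  move=> cu w; set x := mpt z u.
  have lw : lead nu (fun t => Ew (dil t%:C x)) (wtTv Ew nu x) by exact: wtTv_lead rho0 hEw (fun j jn => hw j jn x).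
  have lz : lead nu.-1 (fun t => Ez (dil t%:C x)) (wtTv Ez nu.-1 x) by exact: wtTv_lead rho0 hEz (fun j jn => hz j jn x).
  have lg := leadGz x; rewrite row_mxKl in lg.
  have h1 := leadB lw (lead_cv lw).
  have lzg := lead_B H lz (lead_cv lg).
  have lzz := lead_B H lz (lead_cv lz).
  have n1 : (nu.-1 + 1 = nu)%N by lia.
  have n3 : (nu < nu.-1 + nu.-1)%N by lia.
  rewrite n1 in lzg; have lzz0 := leadW n3 lzz.
  have h2 := leadZ (2 * ii) (leadD (leadD lzg (lead_cv lzg)) lzz0).
  have [r r0 hr] := dil_small x.
  have EQ t : 0 < t < r -> (2 * ii) *: (B H (Ez (dil t%:C x)) (cv (Gz (dil t%:C x))) +
      cv (B H (Ez (dil t%:C x)) (cv (Gz (dil t%:C x)))) +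
      B H (Ez (dil t%:C x)) (cv (Ez (dil t%:C x)))) = Ew (dil t%:C x) - cv (Ew (dil t%:C x)).
    by move=> ht; rewrite E_eq//; [exact: hr|exact: quadric_mpt].
  have := lead_uniq h1 (lead_ext r0 EQ h2); rewrite addr0 pE qE BA !Cw_real.
  rewrite -mulmxBl -mulmxDl scalemxAl => /(congr1 (mulmx^~ (invmx Cw))).
  by rewrite !mulmxK.
have pq z w : p z w = 0 /\ q z w = 0.
  exact: (infinitesimal_automorphism_zero Hherm Hker hp hq op oq heq D1 rn D2).
move=> x; rewrite -[x]hsubmxK pE qE; have [-> ->] := pq (lsubmx x) (rsubmx x).
by rewrite !mul0mx.
Qed.

Let all_zero nu : (forall x, wtTv Ew nu x = 0) /\ (forall x, wtTv Ez nu.-1 x = 0).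
Proof.
have low m (P : V -> 'rV[C]_m) j : (forall i s, (size s <= n)%N -> spart s (fun y => P y 0 i) 0 = 0) ->
    (j <= n)%N -> forall x, wtTv P j x = 0.
  by move=> hs jn x; apply/rowP => i; rewrite !mxE (wtT_low x (hs i) jn).
elim/ltn_ind: nu => nu IH; have [nun|nnu] := leqP nu n.
  by split=> x; apply: low => //; exact: leq_trans (leq_pred _) nun.
have IHz j : (j < nu.-1)%N -> forall x, wtTv Ez j x = 0.
  by move=> jn x; apply: (proj2 (IH j.+1 _)); lia.
have M := main nnu (fun j jn => (IH j jn).1) IHz.
by split=> x; have [] := M x.
Qed.

Lemma jet_determination : exists2 e, 0 < e & forall x, vn x < e -> F x = G x.
Proof.
have h (i : 'I_(d + k)) : exists2 e, 0 < e & forall x, vn x < e -> (F x - G x) 0 i = 0.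
  apply: (flat_zero rho0 (hE i)) => nu x; case: (split_ordP i) => j ->.
    have /rowP/(_ j) := (all_zero nu.+1).2 x; rewrite !mxE /= => <-.
    by congr (wtT _ _ _); apply/funext => y; rewrite [RHS]mxE.
  have /rowP/(_ j) := (all_zero nu).1 x; rewrite !mxE /= => <-.
  by congr (wtT _ _ _); apply/funext => y; rewrite [RHS]mxE.
have h' i : exists2 e, 0 < e & forall t, 0 < t < e -> forall x, vn x < t -> (F x - G x) 0 i = 0.
  have [e e0 he] := h i; exists e => // t /andP[_ te] x xt; apply: he; exact: lt_trans xt te.
have [e e0 he] := common_delta h'.
exists (e / 2) => [|x xe]; first by rewrite divr_gt0.
apply/eqP; rewrite -subr_eq0; apply/eqP/rowP => i; rewrite rv0.
by apply: he xe; lra.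
Qed.

End Linearisation.

(** * Translations of the quadric *)

Section HeisenbergTranslation.
Variables (C : numClosedFieldType) (d k : nat) (H : 'I_k -> 'M[C]_d).
Local Notation ii := ('i%R : C).
Hypothesis Hherm : forall j, H j \is hermsymmx.

(** Translation by a point (a, b) of the quadric in its Heisenberg group structure; the correction
    of w, linear in z - a, absorbs the cross terms of the Hermitian form. *)
Lemma heis_identity (z a : 'rV[C]_d) (w b : 'rV[C]_k) :
  w - cv w = (2 * ii) *: B H z (cv z) -> b - cv b = (2 * ii) *: B H a (cv a) ->
  let w' := w - b - (2 * ii) *: B H (z - a) (cv a) in
  w' - cv w' = (2 * ii) *: B H (z - a) (cv (z - a)).
Proof.
move=> hw hb /=.
have Bl x y v : B H (x - y) v = B H x v - B H y v by rewrite -scaleN1r BDl BZl scaleN1r.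
have Br x y v : B H v (x - y) = B H v x - B H v y by rewrite -scaleN1r BDr BZr scaleN1r.
have cB x y : cv (2 * ii *: B H x (cv y)) = - (2 * ii) *: B H y (cv x).
  by rewrite cvZ rmorphM /= rmorph_nat conjCi B_conj// cvK mulrN.
have cwE : cv w = w - (2 * ii) *: B H z (cv z) by rewrite -hw opprB addrC subrK.
have cbE : cv b = b - (2 * ii) *: B H a (cv a) by rewrite -hb opprB addrC subrK.
rewrite !(cvD, cvN) cB !(cvD, cvN) cwE cbE !(Bl, Br).
by apply/rowP => j; rewrite !rvE; ring.
Qed.

End HeisenbergTranslation.

Section JetDetermination.
Variables (R : realType) (d k : nat).
Local Notation C := (R[i] : numClosedFieldType).
Local Notation V := 'rV[C]_(d + k).
Local Notation ii := ('i%R : C).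
Variable H : 'I_k -> 'M[C]_d.
Implicit Types (x y c : V) (F G : V -> V).

(* The affine automorphism of the quadric that moves its point c to the origin
   is x |-> (x - c) *m heis_mx c. *)
Definition heis_mx c : 'M[C]_(d + k) :=
  block_mx 1%:M (- (2 * ii) *: \matrix_(i, j) (H j *m (cv (lsubmx c))^T) i 0) 0 1%:M.

Lemma heis_mx_unit c : heis_mx c \in unitmx.
Proof. by rewrite unitmxE det_ublock !det1 mulr1 unitr1. Qed.

Lemma B_mulmx (z y : 'rV[C]_d) : B H z y = z *m \matrix_(i, j) (H j *m y^T) i 0.
Proof.
apply/rowP => j; rewrite BjE -mulmxA !mxE; apply: eq_bigr => i _.
by rewrite [in RHS]mxE.
Qed.

Lemma heis_mxE x c : x *m heis_mx c =
  row_mx (lsubmx x) (rsubmx x - (2 * ii) *: B H (lsubmx x) (cv (lsubmx c))).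
Proof.
rewrite -[x in LHS]hsubmxK mul_row_block !mulmx1 mulmx0 addr0 B_mulmx.
by rewrite -scalemxAr scaleNr addrC.
Qed.

Hypothesis Hherm : forall j, H j \is hermsymmx.

Lemma quadric_heis x c : quadric H c -> quadric H x -> quadric H ((x - c) *m heis_mx c).
Proof.
move=> /(quadricP _ _) hc /(quadricP _ _) hx; apply/quadricP.
rewrite heis_mxE row_mxKl row_mxKr !linearB /=.
have h := heis_identity Hherm hx hc. exact: h.
Qed.

Lemma dpart_mulmx F (A : 'M[C]_(d + k)) x i j : differentiable F x ->
  dpart i (fun y => (F y *m A) 0 j) x = \sum_l dpart i (fun y => F y 0 l) x * A l j.
Proof.
move=> dF.
have e1 : (fun y => (F y *m A) 0 j) = (fun y => linform (A^~ j) (F y)).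
  by apply/funext => y; rewrite mxE.
have e2 l : (fun y => F y 0 l) = (fun y => linform (fun m => (m == l)%:R) (F y)).
  by apply/funext => y; rewrite linform_delta.
rewrite e1 /dpart; apply: etrans ((diff_linform_comp _ dF).2 _) _.
apply: eq_bigr => l _; congr (_ * _); rewrite e2; apply/esym.
apply: etrans ((diff_linform_comp _ dF).2 _) _; exact: linform_delta.
Qed.

Definition jacobian F x : 'M[C]_(d + k) := \matrix_(i, j) dpart i (fun y => F y 0 j) x.

Lemma jacobianE F x i j : jacobian F x i j = dpart i (fun y => F y 0 j) x.
Proof. by rewrite mxE. Qed.

Lemma mulmx_coef (A A' : 'M[C]_(d + k)) i j : (A *m A') i j = \sum_l A i l * A' l j.
Proof. by rewrite mxE. Qed.

Lemma jacobian_unit F : biholomorphic_near 0 F -> jacobian F 0 \in unitmx.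
Proof.
move=> [holF [G [holG GF _]]].
have dF := nbhs_singleton holF : differentiable F 0.
have dG := nbhs_singleton holG : differentiable G (F 0).
suff E : jacobian F 0 *m jacobian G (F 0) = 1%:M by exact: (mulmx1_unit E).1.
apply/matrixP => i j; rewrite [RHS]mxE.
have dGj := diff_coord j dG.
have h1 := congr1 (fun f => f (delta_mx 0 i)) (diff_comp dF dGj).
have nid : \forall y \near (0 : V), (fun y => y 0 j : C) y = ((fun y => G y 0 j) \o F) y.
  have /nearP[e e0 he] := GF; apply/(nearP 0 [set y : V | y 0 j = G (F y) 0 j]).
  by exists e => // y /he /= ->.
have did : differentiable (fun y : V => y 0 j : C) 0 by exact: differentiable_coord.
have [_ h2] := near_differentiable nid did.
have h3 : 'd (fun y : V => y 0 j : C) 0 (delta_mx 0 i) = (i == j)%:R.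
  have lj : (fun y : V => y 0 j : C) = linform (fun m => (m == j)%:R).
    by apply/funext => y; rewrite linform_delta.
  have h := congr1 (fun f => f (delta_mx 0 i)) (diff_lin (0 : V) (@linform_continuous R _ (fun m => (m == j)%:R))).
  rewrite lj; transitivity (linform (fun m => (m == j)%:R) (delta_mx 0 i : V)); first exact: h.
  by rewrite linform_delta mxE eqxx eq_sym.
rewrite -h3; apply: etrans (congr1 (fun f => f (delta_mx 0 i)) h2).
have h4 := congr1 (fun f => f ('d F 0 (delta_mx 0 i))) (diff_linform (fun y => G y 0 j : C) (F 0)).
apply: etrans (esym (etrans h1 h4)); apply: etrans (mulmx_coef _ _ _ _) _.
apply: eq_bigr => l _; apply: (congr2 (fun a b : C => a * b)); last exact: jacobianE.
apply: etrans (jacobianE _ _ _ _) _; rewrite /dpart.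
have e2 : (fun y => F y 0 l) = (fun y => linform (fun m => (m == l)%:R) (F y)).
  by apply/funext => y; rewrite linform_delta.
rewrite e2; apply: etrans ((diff_linform_comp _ dF).2 _) _; exact: linform_delta.
Qed.

End JetDetermination.

Section JetDeterminationGerms.
Variables (R : realType) (d k : nat).
Local Notation C := (R[i] : numClosedFieldType).
Local Notation V := 'rV[C]_(d + k).
Variable H : 'I_k -> 'M[C]_d.
Implicit Types (x y c : V) (F G : V -> V).

Lemma quadric0 : quadric H (0 : V).
Proof. by apply/quadricP; rewrite !linear0 B0l cv0 scaler0 subrr. Qed.

Lemma translate_coord F c (A : 'M[C]_(d + k)) i : (fun x => ((F x - c) *m A) 0 i) =
  (fun x => linform (A^~ i) (F x) + (-1) * linform (A^~ i) c).
Proof.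
by apply/funext => x; rewrite mulmxBl !mxE mulN1r.
Qed.

Lemma hol_linform F rho l : (forall x, vn x < rho -> differentiable F x) ->
  hol rho (fun x => linform l (F x)).
Proof. by move=> dF x xr; exact: (diff_linform_comp l (dF x xr)).1. Qed.

Lemma hol_cst rho (a : C) : hol rho (fun _ : V => a).
Proof. by move=> x _; exact: differentiable_cst. Qed.

Lemma dpart_cst i (a : C) x : dpart i (fun=> a) x = 0.
Proof.
exact: (congr1 (fun f => f (delta_mx 0 i)) (diff_cst a x)).
Qed.

Hypothesis Hherm : forall j, H j \is hermsymmx.
Hypothesis Hker : forall z : 'rV[C]_d, (forall j, z *m H j = 0) -> z = 0.
Variables (n rk : nat).
Hypothesis D1 : sums_fill H rk.
Hypothesis rn : (2 * rk <= n)%N.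
Hypothesis D2 : (2 * rk < n)%N \/ sums_detect H rk.
Hypothesis n2 : (2 <= n)%N.

Lemma jets_determine F G : automorphism_germ 0 (quadric H) F ->
  automorphism_germ 0 (quadric H) G -> same_jet n 0 F G -> germ_eq 0 F G.
Proof.
move=> [[holF _] sF] [[holG invG] sG] jFG.
have JG := jacobian_unit (conj holG invG).
have /nearP[e1 e10 h1] := holF; have /nearP[e2 e20 h2] := holG.
have /nearP[e3 e30 h3] := sF; have /nearP[e4 e40 h4] := sG.
pose rho := Num.min (Num.min e1 e2) (Num.min e3 e4).
have rho0 : 0 < rho by rewrite !lt_min e10 e20 e30.
have rhoP x : vn x < rho -> [/\ differentiable F x, differentiable G x,
    (quadric H x -> quadric H (F x)) & (quadric H x -> quadric H (G x))].
  rewrite !lt_min => /andP[/andP[/h1 f1 /h2 f2] /andP[/h3 f3 /h4 f4]].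
  by rewrite !add0r in f1 f2 f3 f4.
pose c := G 0; have Mc : quadric H c.
  by have [_ _ _] := rhoP 0 (eq_ind_r (fun a => a < rho) rho0 (vn0 _ _)); apply; exact: quadric0.
pose A := heis_mx H c.
pose F' x := (F x - c) *m A; pose G' x := (G x - c) *m A.
have dF x : vn x < rho -> differentiable F x by case/rhoP.
have dG x : vn x < rho -> differentiable G x by case/rhoP.
have v0 : vn (0 : V) < rho by rewrite vn0.
have hcs i : hol rho (fun _ : V => linform (A^~ i) c) by exact: hol_cst.
have hF' i : hol rho (fun y => F' y 0 i).
  by rewrite translate_coord; apply: hol_lin; [exact: hol_linform dF|exact: hcs].
have hG' i : hol rho (fun y => G' y 0 i).
  by rewrite translate_coord; apply: hol_lin; [exact: hol_linform dG|exact: hcs].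
have G'0 : G' 0 = 0 by rewrite /G' subrr mul0mx.
have jets i s : (size s <= n)%N -> spart s (fun y => F' y 0 i) 0 = spart s (fun y => G' y 0 i) 0.
  move=> sn; rewrite !translate_coord.
  apply: etrans (spart_lin (-1) s (hol_linform _ dF) (hcs i) v0) _.
  apply: etrans (esym (spart_lin (-1) s (hol_linform _ dG) (hcs i) v0)).
  congr (_ + _); apply: etrans (partials_spart _ s dF v0).2 _.
  apply: etrans (esym (partials_spart _ s dG v0).2); congr (linform _ _); exact: jFG.
have FM x : vn x < rho -> quadric H x -> quadric H (F' x).
  by move=> /rhoP[_ _ h _] /h; exact: quadric_heis.
have GM x : vn x < rho -> quadric H x -> quadric H (G' x).
  by move=> /rhoP[_ _ _ h] /h; exact: quadric_heis.
have G'unit : jacobian G' 0 \in unitmx.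
  suff -> : jacobian G' 0 = jacobian G 0 *m A by rewrite unitmx_mul JG heis_mx_unit.
  apply/matrixP => i j; apply: etrans (jacobianE _ _ _ _) _.
  apply: etrans (_ : spart [:: i] (fun y => G' y 0 j) 0 = _); first by [].
  rewrite translate_coord.
  apply: etrans (spart_lin (-1) [:: i] (hol_linform _ dG) (hcs j) v0) _.
  rewrite /= dpart_cst mulr0 addr0.
  have -> : (fun y => linform (A^~ j) (G y)) = (fun y => (G y *m A) 0 j).
    by apply/funext => y; rewrite mxE.
  apply: etrans (dpart_mulmx A i j (dG 0 v0)) _; apply: esym.
  apply: etrans (mulmx_coef _ _ _ _) _; apply: eq_bigr => l _.
  by apply: (congr1 (fun a : C => a * A l j)); exact: jacobianE.
have [e e0 he] := jet_determination Hherm Hker D1 rn D2 n2 rho0 hF' hG' G'0 jets FM GM G'unit.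
apply/(nearP 0 [set x | F x = G x]); exists e => // y /he; rewrite add0r /F' /G' /=.
move=> /(congr1 (mulmx^~ (invmx A))); rewrite !mulmxK ?heis_mx_unit//.
by move=> /(congr1 (fun x => x + c)); rewrite !subrK.
Qed.

End JetDeterminationGerms.

(** * The model quadrics *)

Section PolynomialShears.
Variables (R : realType) (N : nat).
Local Notation C := (R[i] : numClosedFieldType).
Local Notation V := 'rV[C]_N.
Implicit Types (x y v : V) (F G : V -> C).

Lemma exprS_mul (c a : C) n : c ^+ n.+1 * a = c * (c ^+ n * a).
Proof. by rewrite exprS mulrA. Qed.

(** With c != 0 the factor c produced by the chain rule can be cancelled, so that homogeneity passes
    to partial derivatives. *)
Definition homog F n := forall (c : C) x, c != 0 -> F (c *: x) = c ^+ n * F x.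

Lemma dpart_homog F n i : (forall x, differentiable F x) -> homog F n.+1 ->
  homog (dpart i F) n.
Proof.
move=> dF hF c x c0; pose v : V := delta_mx 0 i.
have h1 := line_cdiff (v := c *: v) (dF (c *: x + (0 : C) *: (c *: v))).
have h2 := cdiffZ (c ^+ n.+1) (line_cdiff (v := v) (dF (x + (0 : C) *: v))).
have e : (fun t : R[i] => F (c *: x + t *: (c *: v))) = (fun t : R[i] => c ^+ n.+1 * F (x + t *: v)).
  by apply/funext => t; rewrite -hF// scalerDr !scalerA mulrC.
have e1 : c *: x + (0 : C) *: (c *: v) = c *: x by rewrite scale0r addr0.
have e2 : x + (0 : C) *: v = x by rewrite scale0r addr0.
rewrite e in h1; have h := cdiff_uniq h1 h2.
have g1 := congr1 (fun y => 'd F y (c *: v)) e1.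
have g2 := congr1 (fun y => c ^+ n.+1 * 'd F y v) e2.
have h3 := etrans (esym g1) (etrans h g2).
have h4 := etrans (esym (diff_scale F (c *: x) c v)) h3.
apply: (mulfI c0); apply: etrans h4 _; exact: exprS_mul.
Qed.

Definition entire F := forall x, differentiable F x.

Lemma entire_spart F s : entire F -> entire (spart s F).
Proof.
move=> dF x; have h : hol (vn x + 1) F by move=> y _; exact: dF.
by apply: hol_spart h _ _; rewrite ltrDl.
Qed.

Lemma spart_homog F n s : entire F -> homog F n -> (size s <= n)%N ->
  homog (spart s F) (n - size s).
Proof.
move=> dF hF; elim: s => [|i s IH] sn; first by rewrite subn0.
apply: dpart_homog; first exact: entire_spart.
by rewrite /= subnSK//; apply: IH; exact: ltnW.
Qed.

(** At the origin, homogeneity of positive degree with the factor 2 multiplies the value by a power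
    of 2 other than 1. *)
Lemma spart_homog0 F n s : entire F -> homog F n -> (size s < n)%N -> spart s F 0 = 0.
Proof.
move=> dF hF sn; have two : (2 : C) != 0 by rewrite pnatr_eq0.
have := spart_homog dF hF (ltnW sn) 0 two; rewrite scaler0.
move: (spart s F 0) => a /eqP; rewrite -subr_eq0 -{1}[a]mul1r -mulrBl mulf_eq0 => /orP[|/eqP//].
rewrite -natrX subr_eq0 eq_sym (eqr_nat _ _ 1) -[X in _ == X](expn0 2) eqn_exp2l//.
by rewrite subn_eq0 leqNgt sn.
Qed.

Lemma entire_coord i : entire (fun x => x 0 i : C).
Proof. by move=> x; exact: differentiable_coord. Qed.

Lemma entire_cst (a : C) : entire (fun=> a).
Proof. by move=> x; exact: differentiable_cst. Qed.

Lemma entireD F G : entire F -> entire G -> entire (fun x => F x + G x).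
Proof. by move=> dF dG x; exact: (differentiableD (dF x) (dG x)). Qed.

Lemma entireM F G : entire F -> entire G -> entire (fun x => F x * G x).
Proof. by move=> dF dG x; exact: (differentiableM (dF x) (dG x)). Qed.

Lemma entireN F : entire F -> entire (fun x => - F x).
Proof. by move=> dF x; exact: (differentiableN (dF x)). Qed.

Lemma entire_sum (I : finType) (F : I -> V -> C) : (forall i, entire (F i)) ->
  entire (fun x => \sum_i F i x).
Proof.
move=> dF; rewrite unlock /=; elim: (index_enum I) => [|i s IH] /=; first exact: entire_cst.
by apply: entireD.
Qed.

Lemma entire_prod (I : finType) (F : I -> V -> C) : (forall i, entire (F i)) ->
  entire (fun x => \prod_i F i x).
Proof.
move=> dF; rewrite unlock /=; elim: (index_enum I) => [|i s IH] /=; first exact: entire_cst.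
by apply: entireM.
Qed.

Lemma entire_det m (A : V -> 'M[C]_m) : (forall i j, entire (fun x => A x i j)) ->
  entire (fun x => \det (A x)).
Proof.
move=> dA; apply: entire_sum => s; apply: entireM; first exact: entire_cst.
exact: entire_prod.
Qed.

Lemma near_all (Q : V -> Prop) (p : V) : (forall x, Q x) -> \forall x \near p, Q x.
Proof. by move=> hQ; apply/(nearP p [set x | Q x]); exists 1 => // y _; exact: hQ. Qed.

Variables (M : set V) (P : V -> V) (n : nat).
Hypotheses (n0 : (0 < n)%N) (dP : forall i, entire (fun x => P x 0 i)).
Hypothesis PZ : forall (c : C) x, P (c *: x) = c ^+ n *: P x.
Hypothesis PP : forall c x y, P (x + c *: P y) = P x.
Hypothesis PM : forall x, M x -> M (x + P x).
Hypothesis Pnz : exists x, P x != 0.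

Let P0 : P 0 = 0.
Proof. by have := PZ 0 0; rewrite scale0r expr0n eqn0Ngt n0 scale0r. Qed.

Let P_entire x : differentiable P x.
Proof. by apply: diff_components => i; exact: dP. Qed.

Let id_diff x : differentiable (id : V -> V) x.
Proof. by apply: diff_components => i; exact: entire_coord. Qed.

Let id_hol p : holomorphic_near p (id : V -> V).
Proof. by apply: near_all => x; exact: id_diff. Qed.

Let shear_hol c p : holomorphic_near p (fun x : V => x + c *: P x).
Proof.
apply: near_all => x.
exact: (differentiableD (id_diff x) (differentiableZ c (P_entire x))).
Qed.

(** By [PP] the map x - P x inverts x + P x. Compared with the identity, the shear differs by a map
    homogeneous of degree n, which is invisible in the jet of order n - 1; homogeneity also makes it
    nonzero arbitrarily close to 0. *)
Lemma shear_not_determined : exists F G : V -> V, [/\ automorphism_germ 0 M F,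
  automorphism_germ 0 M G, same_jet n.-1 0 F G & ~ germ_eq 0 F G].
Proof.
pose F x : V := x + 1 *: P x.
have F0 : F 0 = 0 by rewrite /F P0 scaler0 addr0.
exists F, id; split.
- split; last by apply: near_all => x; rewrite /F scale1r; exact: PM.
  split; first exact: shear_hol.
  exists (fun x => x + (-1) *: P x); rewrite F0; split; first exact: shear_hol.
  + by apply: near_all => x; rewrite /F PP -addrA -scalerDl subrr scale0r addr0.
  + by apply: near_all => x; rewrite /F PP -addrA -scalerDl addNr scale0r addr0.
- split; last by apply: near_all.
  split; first exact: id_hol.
  by exists id; split; [exact: id_hol|apply: near_all|apply: near_all].
- move=> s sn; have sn' : (size s < n)%N by move: n0 sn; lia.
  have dF x : vn x < 1 -> differentiable F x.
    by move=> _; exact: nbhs_singleton (shear_hol 1 x).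
  have did x : vn x < 1 -> differentiable (id : V -> V) x.
    by move=> _; exact: id_diff.
  have v0 : vn (0 : V) < 1 by rewrite vn0.
  apply/rowP => j; pose l (k : 'I_N) : C := (k == j)%:R.
  rewrite -!(linform_delta j); apply: etrans (esym (partials_spart l s dF v0).2) _.
  apply: etrans (partials_spart l s did v0).2.
  have -> : (fun y => linform l (F y)) = (fun y => linform l (id y) + 1 * (P y 0 j)).
    by apply/funext => y; rewrite !linform_delta /F !mxE.
  have hl : hol 1 (fun y : V => linform l (id y)).
    by move=> y /did dy; exact: (diff_linform_comp l dy).1.
  have hPj : hol 1 (fun y => P y 0 j) by move=> y _; exact: dP.
  apply: etrans (spart_lin 1 s hl hPj v0) _.
  have -> : spart s (fun y => P y 0 j) 0 = 0; last by rewrite mulr0 addr0.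
  have hom : homog (fun y => P y 0 j) n by move=> c x _; rewrite PZ rvZ.
  exact: spart_homog0 (dP j) hom sn'.
move=> /nearP[e e0 he]; have [x /eqP[]] := Pnz.
pose a : R := e / 2 / (vn x + 1).
have vx1 : 0 < vn x + 1 by rewrite ltr_pwDr ?vn_ge0.
have a0 : 0 < a by rewrite !divr_gt0.
have vy : vn (a%:C *: x) < e.
  rewrite vnZ nm_real gtr0_norm// /a mulrAC ltr_pdivrMr//.
  by have := mulr_ge0 (ltW e0) (vn_ge0 x); lra.
have := he _ vy; rewrite add0r /F scale1r => /(congr1 (fun y => y - a%:C *: x)).
rewrite addrAC subrr add0r PZ => /eqP; rewrite scaler_eq0 expf_eq0 n0 /=.
have -> : (a%:C == 0) = false by apply/negbTE; rewrite -nm_gt0 nm_real gtr0_norm.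
by move=> /eqP.
Qed.

End PolynomialShears.

(** * Bordered determinants and their reality on the quadric *)

Section BorderedDeterminant.
Variables (C : numClosedFieldType) (p : nat).
Implicit Types (x : 'rV[C]_p) (z : 'cV[C]_p) (W : 'M[C]_p).
Local Notation cj := (@Num.conj_op C).
Local Notation ii := ('i%R : C).

(** Equal to - x adj(W) z; in bordered form, invariance under row and column operations is
    immediate. *)
Definition bdet x z W : C := \det (block_mx (0 : 'M[C]_1) x z W).

Lemma det_top_linear (u v : 'M[C]_1) x x' z W (b c : C) :
  \det (block_mx (b *: u + c *: v) (b *: x + c *: x') z W) =
  b * \det (block_mx u x z W) + c * \det (block_mx v x' z W).
Proof.
have r0 (u' : 'M[C]_1) y : row (lshift p 0) (block_mx u' y z W) = row_mx u' y.
  by rewrite /block_mx rowKu; apply/rowP => j; rewrite mxE.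
have r' (u' v' : 'M[C]_1) y y' : row' (lshift p 0) (block_mx u' y z W) =
    row' (lshift p 0) (block_mx v' y' z W).
  rewrite /block_mx !(@row'Ku _ 0); apply: (congr1 (fun t => @col_mx C 0 p (1 + p) t (row_mx z W))).
  by apply/matrixP => -[].
apply: (@determinant_multilinear _ _ _ _ _ (lshift p 0)); [|exact: r'|exact: r'].
by rewrite !r0 !scale_row_mx add_row_mx.
Qed.

Lemma bdet_lin x x' z W (b c : C) :
  bdet (b *: x + c *: x') z W = b * bdet x z W + c * bdet x' z W.
Proof. by rewrite -det_top_linear !scaler0 addr0. Qed.

Lemma bdetZ x z W (b : C) : bdet (b *: x) z W = b * bdet x z W.
Proof.
by have := bdet_lin x 0 z W b 0; rewrite scaler0 addr0 mul0r addr0.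
Qed.

Lemma bdetD x x' z W : bdet (x + x') z W = bdet x z W + bdet x' z W.
Proof. by have := bdet_lin x x' z W 1 1; rewrite !scale1r !mul1r. Qed.

Lemma bdet0 z W : bdet 0 z W = 0.
Proof. by rewrite -(scale0r 0) bdetZ mul0r. Qed.

Lemma bdet_sum x z W : bdet x z W = \sum_j x 0 j * bdet (delta_mx 0 j) z W.
Proof.
rewrite {1}[x]row_sum_delta; elim/big_rec2: _ => [|j a b _ <-]; first exact: bdet0.
by rewrite bdetD bdetZ.
Qed.

(** Elimination with a corner entry 1 gives det (W - z x); linearity in the top row then separates
    the corner from the border. *)
Lemma bdet_shift x z W : \det (W - z *m x) = \det W + bdet x z W.
Proof.
have E : block_mx 1%:M x z W = block_mx 1%:M 0 z 1%:M *m block_mx 1%:M x 0 (W - z *m x).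
  by rewrite mulmx_block !mul1mx !mul0mx !mulmx1 !addr0 addrC subrK.
have := det_mulmx (block_mx 1%:M 0 z 1%:M) (block_mx 1%:M x 0 (W - z *m x)).
rewrite -E det_lblock det_ublock !det1 !mul1r => <-.
have := det_top_linear 1%:M 0 0 x z W 1 1.
rewrite !scale1r addr0 add0r !mul1r => ->.
by rewrite det_lblock det1 mul1r.
Qed.

Lemma bdet_addl x z W (y : 'cV[C]_p) : bdet x z (W + y *m x) = bdet x z W.
Proof.
rewrite /bdet (_ : block_mx _ _ _ (W + _) = block_mx 1%:M 0 y 1%:M *m block_mx 0 x z W).
  by rewrite det_mulmx det_lblock !det1 !mul1r.
by rewrite mulmx_block !mul1mx !mul0mx mulmx0 !addr0 add0r addrC.
Qed.

Lemma bdet_tr x z W : bdet x z W = bdet z^T x^T W^T.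
Proof. by rewrite /bdet -det_tr tr_block_mx trmx0. Qed.

Lemma bdet_addr x z W (y : 'rV[C]_p) : bdet x z (W + z *m y) = bdet x z W.
Proof.
by rewrite bdet_tr linearD /= trmx_mul bdet_addl -bdet_tr.
Qed.

Lemma bdet_homog x z W (c : C) : bdet x (c *: z) (c *: W) = c ^+ p * bdet x z W.
Proof.
rewrite /bdet (_ : block_mx _ _ (c *: z) _ = block_mx 1%:M 0 0 c%:M *m block_mx 0 x z W).
  by rewrite det_mulmx det_lblock det1 mul1r det_scalar.
by rewrite mulmx_block !mul1mx !mul0mx !mul_scalar_mx !addr0 !add0r.
Qed.

Lemma bdet_conj x z W : cj (bdet x z W) = bdet (map_mx cj x) (map_mx cj z) (map_mx cj W).
Proof. by rewrite /bdet -det_map_mx map_block_mx map_mx0. Qed.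

Lemma bdetNr x z W : bdet x (- z) W = - bdet x z W.
Proof.
have trN (m n : nat) (X : 'M[C]_(m, n)) : (- X)^T = - X^T by exact: linearN.
by rewrite bdet_tr trN -scaleN1r bdetZ -bdet_tr mulN1r.
Qed.

(** Transposition exchanges the borders and turns W into - W; for odd p the sign of W cancels
    against that of one border. *)
Lemma bdet_skew_sym x y W : odd p -> W^T = - W -> bdet x y^T W = bdet y x^T W.
Proof.
move=> op Wsk; rewrite bdet_tr trmxK Wsk.
have -> : x^T = (-1) *: (- x^T) by rewrite scaleN1r opprK.
rewrite -[- W]scaleN1r bdet_homog -signr_odd op expr1 bdetNr.
by rewrite mulrNN mul1r scaleN1r opprK.
Qed.

(* The point (a, w) of the first quadric satisfies W - W^* = 2i a^T conj(a);
   then Im det W = - bdet conj(a) a^T W. *)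
Lemma det_square_invariant (a : 'rV[C]_p) W :
  W - (map_mx cj W)^T = (2 * ii) *: (a^T *m map_mx cj a) ->
  let be := - \det W * bdet (map_mx cj a) a^T W in
  \det W ^+ 2 - cj (\det W ^+ 2) = (2 * ii) * (be + cj be).
Proof.
move=> hW; set D := bdet _ _ _ => /=; set de := \det W.
have E : cj de = de + 2 * ii * D.
  rewrite /de -det_map_mx -det_tr -bdetZ -bdet_shift; congr (\det _).
  by rewrite -scalemxAr -hW opprB addrC subrK.
have DE : cj D = D.
  have := congr1 cj E; rewrite rmorphD !rmorphM /= conjCK rmorph_nat conjCi E => h.
  have i2 : 2 * ii != 0 by rewrite mulf_neq0 ?neq0Ci// pnatr_eq0.
  have := subrr de; rewrite {1}h; rewrite mulrN mulNr => h'.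
  have /(mulfI i2) -> // : 2 * ii * cj D = 2 * ii * D.
  by apply/eqP; rewrite -subr_eq0 -oppr_eq0 -h'; apply/eqP; ring.
by rewrite rmorphXn !rmorphM rmorphN /= E DE; ring.
Qed.

(* Modulo the two families of operations that leave bdet unchanged, W is real for
   each of the real vectors xi and et, where a = xi + i et. *)
Lemma bdet_skew_real (a : 'rV[C]_p) W : odd p -> W^T = - W ->
  W - map_mx cj W = - 2 *: (a^T *m map_mx cj a - (map_mx cj a)^T *m a) ->
  cj (bdet (map_mx cj a) a^T W) = bdet (map_mx cj a) a^T W.
Proof.
move=> op Wsk hW; set b := map_mx cj a.
have ii2 : ii * ii = -1 by exact: mulCii.
pose xi := 2^-1 *: (a + b); pose et := (2 * ii)^-1 *: (a - b).
have aE : a = xi + ii *: et.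
  apply/rowP => j; rewrite !mxE; field; exact: neq0Ci.
have bE : b = xi + (- ii) *: et.
  apply/rowP => j; rewrite !mxE; field; exact: neq0Ci.
have xr : map_mx cj xi = xi.
  by apply/rowP => j; rewrite !mxE rmorphM rmorphD /= fmorphV rmorph_nat conjCK addrC.
have er : map_mx cj et = et.
  apply/rowP => j; rewrite !mxE rmorphM rmorphB /= fmorphV rmorphM rmorph_nat /= conjCi conjCK.
  by rewrite mulrN invrN mulNr -mulrN opprB.
have WE : map_mx cj W = W + (4 * ii) *: (et^T *m xi) - (4 * ii) *: (xi^T *m et).
  have -> : map_mx cj W = W - (- 2) *: (a^T *m b - b^T *m a) by rewrite -hW opprB addrC subrK.
  move: (xi) (et) aE bE => x' e' -> ->; apply/matrixP => i j.
  rewrite !mxE !big_ord1 !mxE.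
  by move: (xi 0 i) (xi 0 j) (et 0 i) (et 0 j) (W i j) => x1 x2 e1 e2 w; ring.
clearbody xi et; have symW (x y : 'rV[C]_p) := bdet_skew_sym x y op Wsk.
have bD : bdet b a^T W = bdet xi xi^T W + bdet et et^T W.
  have aD y : bdet a y^T W = bdet xi y^T W + ii * bdet et y^T W.
    by rewrite {1}aE bdetD bdetZ.
  rewrite bE bdetD bdetZ (symW xi a) (symW et a) !aD (symW et xi).
  move: (bdet xi xi^T W) (bdet xi et^T W) (bdet et et^T W) => t u v.
  by rewrite (_ : _ + _ = t - (ii * ii) * v); [rewrite ii2|]; ring.
have WE1 : map_mx cj W = W + ((4 * ii) *: et^T) *m xi + xi^T *m (- (4 * ii) *: et).
  by rewrite WE -scalemxAl -scalemxAr scaleNr.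
have WE2 : map_mx cj W = W + (- (4 * ii) *: xi^T) *m et + et^T *m ((4 * ii) *: xi).
  by rewrite WE -scalemxAl -scalemxAr scaleNr addrAC.
rewrite bD rmorphD /= !bdet_conj -!map_trmx xr er {1}WE1 WE2.
by rewrite !bdet_addr !bdet_addl.
Qed.

End BorderedDeterminant.

Lemma sumB_cons (C : numClosedFieldType) d k (H : 'I_k -> 'M[C]_d) y s :
  sumB H (y :: s) = B H y.1 y.2 + sumB H s.
Proof. exact: big_cons. Qed.

(** * The model quadric and sums of values of its form *)

Section ModelQuadric.
Variables (C : numClosedFieldType) (p q x : nat) (E : 'I_q -> 'M[C]_p).
Local Notation cj := (@Num.conj_op C).

Definition modelH (j : 'I_(q + 1 + x)) : 'M[C]_(p + p + x) :=
  match fintype.split j with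
  | inl j' => match fintype.split j' with
    | inl t => block_mx (block_mx (E t) 0 0 0) 0 0 0
    | inr _ => block_mx (block_mx 0 1%:M 1%:M 0) 0 0 0
    end
  | inr s => block_mx 0 0 0 (delta_mx s s)
  end.

Lemma modelH1 t : modelH (lshift x (lshift 1 t)) = block_mx (block_mx (E t) 0 0 0) 0 0 0.
Proof. by rewrite /modelH (unsplitK (inl _)) (unsplitK (inl _)). Qed.

Lemma modelH2 (o : 'I_1) : modelH (lshift x (rshift q o)) = block_mx (block_mx 0 1%:M 1%:M 0) 0 0 0.
Proof. by rewrite /modelH (unsplitK (inl _)) (unsplitK (inr _)). Qed.

Lemma modelH3 s : modelH (rshift (q + 1) s) = block_mx 0 0 0 (delta_mx s s).
Proof. by rewrite /modelH (unsplitK (inr _)). Qed.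

Lemma modelHP (P : 'I_(q + 1 + x) -> Prop) : (forall t, P (lshift x (lshift 1 t))) ->
  (forall o, P (lshift x (rshift q o))) -> (forall s, P (rshift (q + 1) s)) -> forall j, P j.
Proof.
move=> h1 h2 h3 j; case: (split_ordP j) => j' ->; last exact: h3.
by case: (split_ordP j') => t ->; [exact: h1|exact: h2].
Qed.

Definition mk (a b : 'rV[C]_p) (c : 'rV[C]_x) : 'rV[C]_(p + p + x) := row_mx (row_mx a b) c.

Lemma B_model a b c a' b' c' : B modelH (mk a b c) (mk a' b' c') =
  row_mx (row_mx (B E a a') (a *m b'^T + b *m a'^T)) (\row_s (c 0 s * c' 0 s)).
Proof.
pose simp := (@mulmx0 C, @mul0mx C, @mulmx1 C, @addr0, @add0r, @mul_row_col C, @mul_row_block C).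
apply/rowP; apply: modelHP => [t|o|s]; rewrite BjE !(row_mxEl, row_mxEr).
- rewrite modelH1 BjE /mk !tr_row_mx !(mul_row_block, mul_row_col).
  by rewrite !simp.
- rewrite modelH2 /mk !tr_row_mx !(mul_row_block, mul_row_col).
  by rewrite !simp (ord1 o) addrC.
rewrite modelH3 /mk !tr_row_mx !(mul_row_block, mul_row_col).
rewrite !simp !mxE (bigD1 s)//= big1 ?addr0; last first.
  by move=> j js; rewrite !mxE big1 ?mul0r// => i _; rewrite !mxE (negPf js) andbF mulr0.
rewrite !mxE (bigD1 s)//= big1 ?addr0 => [|i js]; rewrite !mxE ?eqxx ?mulr1//.
by rewrite (negPf js) mulr0.
Qed.

Hypothesis Eherm : forall t, E t \is hermsymmx.

Lemma modelH_herm j : modelH j \is hermsymmx.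
Proof.
have hE t : E t = map_mx cj (E t)^T.
  by have /is_hermitianmxP := Eherm t; rewrite expr0 scale1r.
move: j; apply: modelHP => [t|o|s]; apply/is_hermitianmxP; rewrite expr0 scale1r.
- by rewrite modelH1 !tr_block_mx !map_block_mx !trmx0 !map_mx0 -hE.
- by rewrite modelH2 !tr_block_mx !map_block_mx !trmx0 !trmx1 !map_mx0 !map_mx1.
by rewrite modelH3 !tr_block_mx !map_block_mx !trmx0 trmx_delta map_delta_mx !map_mx0.
Qed.

Lemma modelH_ker : trivial_common_kernel modelH.
Proof.
move=> z; rewrite -[z]hsubmxK -[lsubmx z]hsubmxK.
move: (lsubmx (lsubmx z)) (rsubmx (lsubmx z)) (rsubmx z) => a b c h.
have := h (lshift x (rshift q 0)); rewrite modelH2 !mul_row_block !mulmx0 !mulmx1 !addr0 !add0r.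
rewrite -[RHS]row_mx0 => /eq_row_mx[/eqP]; rewrite -row_mx0 => /eqP/eq_row_mx[-> ->] _.
suff -> : c = 0 by rewrite !row_mx0.
apply/rowP => s; have := h (rshift (q + 1) s); rewrite modelH3 mul_row_block !mulmx0 !add0r.
rewrite -[RHS]row_mx0 => /eq_row_mx[_] /rowP/(_ s); rewrite mxE (bigD1 s)//= big1 ?addr0.
  by rewrite !mxE !eqxx mulr1.
by move=> i si; rewrite !mxE (negPf si) mulr0.
Qed.

Definition lift0 (y : 'rV[C]_p * 'rV[C]_p) := (mk y.1 0 0, mk y.2 0 0).

Lemma sumB_lift0 s : sumB modelH (map lift0 s) = row_mx (row_mx (sumB E s) 0) 0.
Proof.
rewrite /sumB big_map; elim: s => [|[a a'] s IH]; first by rewrite !big_nil !row_mx0.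
rewrite !big_cons IH /= B_model trmx0 mulmx0 mul0mx addr0 !add_row_mx addr0.
by congr (row_mx _ _); apply/rowP => i; rewrite !mxE mul0r addr0.
Qed.

(** The later terms have vanishing b and c parts and contribute to w_1 only. The first term then has
    to produce the other coordinates alone: a nonzero entry of a lets b' fix w_0, and the nonzero
    entries of c let c' fix each w_s. *)
Lemma sumB_complete (a b a' : 'rV[C]_p) (c : 'rV[C]_x) s (u0 : 'rV[C]_1) us : a != 0 ->
  (forall i, c 0 i != 0) -> exists b' c',
  sumB modelH ((mk a b c, mk a' b' c') :: map lift0 s) =
    row_mx (row_mx (sumB E ((a, a') :: s)) u0) us.
Proof.
move=> a0 c0; have [i ai] : exists i, a 0 i != 0.
  apply/existsP; apply: contra_neqT a0; rewrite negb_exists => /forallP h.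
  by apply/rowP => i; rewrite mxE; apply/eqP; rewrite -[_ == _]negbK h.
exists (((u0 - b *m a'^T) 0 0 / a 0 i) *: delta_mx 0 i), (\row_s (us 0 s / c 0 s)).
rewrite !sumB_cons sumB_lift0 /= B_model !add_row_mx !addr0.
congr (row_mx (row_mx _ _) _); last first.
  by apply/rowP => j; rewrite !mxE mulrC divfK.
rewrite linearZ /= trmx_delta -scalemxAr -colE.
apply/rowP => o; rewrite (ord1 o) rvD rvZ [col _ _ 0 0]mxE divfK//.
by rewrite rvD rvN subrK.
Qed.

Variable r : nat.

Lemma model_fill : (forall u, exists a a' s,
    [/\ (size s < r)%N, a != 0 & sumB E ((a, a') :: s) = u]) -> sums_fill modelH r.
Proof.
move=> h u; rewrite -[u]hsubmxK -[lsubmx u]hsubmxK.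
have [a [a' [s [sr a0 <-]]]] := h (lsubmx (lsubmx u)).
have one i : (const_mx 1 : 'rV[C]_x) 0 i != 0 by rewrite mxE oner_neq0.
have [b' [c' <-]] := sumB_complete 0 a' s (rsubmx (lsubmx u)) (rsubmx u) a0 one.
by exists ((mk a 0 (const_mx 1), mk a' b' c') :: map lift0 s) => //=; rewrite size_map.
Qed.

(** By [sumB_complete] a vector (e_i, b, c) opens a decomposition of u for every b and every c
    without zero entry. Differences of such vectors give all of the b and c directions, and then the
    e_i. *)
Lemma model_detect : (0 < p)%N -> (forall u i, exists a' s,
    (size s < r)%N /\ sumB E ((delta_mx 0 i, a') :: s) = u) -> sums_detect modelH r.
Proof.
move=> p0 h u T TD TZ Tu.
have T0 : T 0 = 0 by have := TZ 0 0; rewrite !scale0r.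
have TN y : T (- y) = - T y by rewrite -scaleN1r TZ scaleN1r.
have key i b (c : 'rV[C]_x) : (forall j, c 0 j != 0) -> T (mk (delta_mx 0 i) b c) = 0.
  move=> c0; have [a' [s [sr su]]] := h (lsubmx (lsubmx u)) i.
  have d0 : delta_mx 0 i != 0 :> 'rV[C]_p.
    by apply/eqP => /rowP/(_ i)/eqP; rewrite !mxE !eqxx oner_eq0.
  have [b' [c' e]] := sumB_complete b a' s (rsubmx (lsubmx u)) (rsubmx u) d0 c0.
  by apply: (Tu _ (mk a' b' c') (map lift0 s)); rewrite ?size_map// e su !hsubmxK.
have mkB a b c a' b' c' : mk a b c - mk a' b' c' = mk (a - a') (b - b') (c - c').
  by rewrite /mk !opp_row_mx !add_row_mx.
pose o : 'rV[C]_x := const_mx 1; pose i0 := Ordinal p0.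
have o0 i : o 0 i != 0 by rewrite mxE oner_neq0.
have diff y y' : T y = 0 -> T y' = 0 -> T (y - y') = 0.
  by move=> ty ty'; rewrite TD TN ty ty' subrr.
have Tb b : T (mk 0 b 0) = 0.
  by have := diff _ _ (key i0 b o o0) (key i0 0 o o0); rewrite mkB !subrr subr0.
have Tc s : T (mk 0 0 (delta_mx 0 s)) = 0.
  have od i : (o + delta_mx 0 s) 0 i != 0.
    by rewrite !mxE eqxx /= -(natrD _ 1) pnatr_eq0.
  by have := diff _ _ (key i0 0 _ od) (key i0 0 o o0); rewrite mkB !subrr addrAC subrr add0r.
have Tsum (I : finType) (f : I -> 'rV[C]_(p + p + x)) : (forall i, T (f i) = 0) -> T (\sum_i f i) = 0.
  by move=> Tf; elim/big_ind: _ => // y y' hy hy'; rewrite TD hy hy' addr0.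
have Tcs c : T (mk 0 0 c) = 0.
  have -> : mk 0 0 c = \sum_s c 0 s *: mk 0 0 (delta_mx 0 s).
    rewrite {1}[c]row_sum_delta; elim/big_rec2: _ => [|s y z _ <-]; first by rewrite /mk !row_mx0.
    by rewrite /mk scale_row_mx add_row_mx !row_mx0 scaler0 addr0.
  by apply: Tsum => s; rewrite TZ Tc scaler0.
have Ta a : T (mk a 0 0) = 0.
  have -> : mk a 0 0 = \sum_i a 0 i *: mk (delta_mx 0 i) 0 0.
    rewrite {1}[a]row_sum_delta; elim/big_rec2: _ => [|s y z _ <-]; first by rewrite /mk !row_mx0.
    by rewrite /mk !scale_row_mx !add_row_mx !scaler0 !addr0.
  apply: Tsum => i; rewrite TZ.
  have := diff _ _ (key i 0 o o0) (Tcs o); rewrite mkB !subr0 subrr => ->.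
  by rewrite scaler0.
move=> z; rewrite -[z]hsubmxK -[lsubmx z]hsubmxK.
have -> : row_mx (row_mx (lsubmx (lsubmx z)) (rsubmx (lsubmx z))) (rsubmx z) =
    mk (lsubmx (lsubmx z)) 0 0 + mk 0 (rsubmx (lsubmx z)) 0 + mk 0 0 (rsubmx z).
  by rewrite /mk !add_row_mx !(addr0, add0r).
by rewrite !TD Ta Tb Tcs !addr0.
Qed.

End ModelQuadric.

(** A linear relation among the matrices annihilates every value of [B], hence every sum of such
    values, and these fill the space. *)
Lemma fill_real_independent (C : numClosedFieldType) d k (H : 'I_k -> 'M[C]_d) r :
  sums_fill H r -> real_independent H.
Proof.
move=> fill c _ c0 j.
have h (x y : 'rV[C]_d) : \sum_j c j * B H x y 0 j = 0.
  transitivity ((x *m (\sum_j c j *: H j) *m y^T) 0 0); last by rewrite c0 mulmx0 mul0mx mxE.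
  rewrite mulmx_sumr mulmx_suml summxE.
  by apply: eq_bigr => i _; rewrite BjE -scalemxAr -scalemxAl [in RHS]mxE.
have [s _ su] := fill (delta_mx 0 j).
have : \sum_i c i * sumB H s 0 i = 0.
  rewrite /sumB; under eq_bigr do rewrite summxE mulr_sumr.
  by rewrite exchange_big big1.
rewrite su (bigD1 j)//= big1 ?addr0 => [|i ij]; last by rewrite !mxE (negPf ij) andbF mulr0.
by rewrite !mxE !eqxx mulr1.
Qed.

(** * Hermitian families: all matrices, and i times the real skew ones *)

Section MatrixFamilies.
Variables (C : numClosedFieldType).
Local Notation cj := (@Num.conj_op C).
Local Notation ii := ('i%R : C).

(** Turns the coordinates w_1 into the matrix W. In both families below S is chosen so that the
    value of the form at (a, b) becomes a^T b, respectively i times the wedge of a and b. *)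
Definition comb p q (S : 'I_q -> 'M[C]_p) (w : 'rV[C]_q) : 'M[C]_p := \sum_t w 0 t *: S t.

Lemma comb_lin p q (S : 'I_q -> 'M[C]_p) (c : C) w w' :
  comb S (c *: w + w') = c *: comb S w + comb S w'.
Proof.
rewrite /comb scaler_sumr -big_split; apply: eq_bigr => t _.
by rewrite rvD rvZ scalerDl scalerA.
Qed.

Lemma combZ p q (S : 'I_q -> 'M[C]_p) (c : C) w : comb S (c *: w) = c *: comb S w.
Proof. by rewrite /comb scaler_sumr; apply: eq_bigr => t _; rewrite rvZ scalerA. Qed.

Lemma combB p q (S : 'I_q -> 'M[C]_p) w w' : comb S (w - w') = comb S w - comb S w'.
Proof. by rewrite addrC -[- w']scaleN1r comb_lin scaleN1r addrC. Qed.

Lemma comb_sum p q (S : 'I_q -> 'M[C]_p) (I : Type) (s : seq I) (P : pred I) w :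
  comb S (\sum_(i <- s | P i) w i) = \sum_(i <- s | P i) comb S (w i).
Proof.
elim/big_rec2: _ => [|i y1 y2 _ <-]; first by rewrite -(scale0r 0) combZ scale0r.
by rewrite -[w i]scale1r comb_lin !scale1r.
Qed.

Section FullFamily.
Variable m : nat.

(** With this constant, al e_ij + conj(al) e_ji runs through a basis of the Hermitian matrices as
    (i, j) runs through all pairs, with no distinction between diagonal and off-diagonal entries: al
    + conj(al) = 1, and al and its conjugate are independent over the reals. *)
Definition al : C := (1 + ii) / 2.
Definition al' : C := (1 - ii) / 2.

Lemma alC : cj al = al'.
Proof. by rewrite rmorphM rmorphD /= fmorphV rmorph_nat rmorph1 conjCi. Qed.
Lemma alC' : cj al' = al.
Proof. by rewrite -alC conjCK. Qed.
Lemma al_al' : al * al' + al' * al = 1.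
Proof.
rewrite (_ : _ + _ = (1 - ii * ii) / 2); last by rewrite /al /al'; field.
by rewrite mulCii opprK divff// pnatr_eq0.
Qed.
Lemma al_sq : al * al + al' * al' = 0.
Proof.
rewrite (_ : _ + _ = (1 + ii * ii) / 2); last by rewrite /al /al'; field.
by rewrite mulCii subrr mul0r.
Qed.

Definition fullE (t : 'I_(m * m)) : 'M[C]_m :=
  al *: vec_mx (delta_mx 0 t) + al' *: (vec_mx (delta_mx 0 t))^T.
(* The dual basis of fullE. *)
Definition fullS (t : 'I_(m * m)) : 'M[C]_m :=
  al' *: vec_mx (delta_mx 0 t) + al *: (vec_mx (delta_mx 0 t))^T.

Lemma trlin (M N : 'M[C]_m) (c b : C) : (c *: M + b *: N)^T = c *: M^T + b *: N^T.
Proof. by rewrite linearP linearZ. Qed.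

Lemma maplin (M N : 'M[C]_m) (c b : C) :
  map_mx cj (c *: M + b *: N) = cj c *: map_mx cj M + cj b *: map_mx cj N.
Proof. by apply/matrixP => i j; rewrite !mxE rmorphD !rmorphM. Qed.

Lemma fullE_herm t : fullE t \is hermsymmx.
Proof.
apply/is_hermitianmxP; rewrite expr0 scale1r /fullE trlin trmxK maplin alC alC'.
by rewrite -!map_trmx !map_vec_mx !map_delta_mx addrC.
Qed.

Lemma comb_full w : comb fullS w = al' *: vec_mx w + al *: (vec_mx w)^T.
Proof.
have vE : vec_mx w = \sum_t w 0 t *: vec_mx (delta_mx 0 t) :> 'M[C]_m.
  by rewrite {1}[w]row_sum_delta linear_sum; apply: eq_bigr => t _; rewrite linearZ.
have vT : (vec_mx w)^T = \sum_t w 0 t *: (vec_mx (delta_mx 0 t))^T :> 'M[C]_m.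
  by rewrite vE linear_sum; apply: eq_bigr => t _ /=; rewrite linearZ.
rewrite vE -vE vT vE /comb !scaler_sumr -big_split; apply: eq_bigr => t _ /=.
by rewrite /fullS scalerDr !scalerA ![w _ _ * _]mulrC.
Qed.

Lemma B_full a b : B fullE a b = mxvec (al *: (a^T *m b) + al' *: (a^T *m b)^T).
Proof.
apply/rowP => t; case/mxvec_indexP: t => i j.
rewrite mxvecE BjE /fullE vec_mx_delta mulmxDr mulmxDl -!scalemxAr -!scalemxAl.
rewrite trmx_delta !mxE !big_ord1 !mxE.
have delta i' j' : (a *m delta_mx i' j' *m b^T) 0 0 = a 0 i' * b 0 j'.
  rewrite -(mul_delta_mx (0 : 'I_1)) mulmxA -colE -mulmxA -rowE.
  by rewrite mxE big_ord1 !mxE.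
by congr (_ * _ + _ * _); rewrite -delta mxE.
Qed.

Lemma comb_B_full a b : comb fullS (B fullE a b) = a^T *m b.
Proof.
rewrite B_full comb_full mxvecK trlin trmxK !scalerDr !scalerA.
move: (a^T *m b) => X; rewrite [X in _ + X]addrC addrACA -!scalerDl.
by rewrite [al' * al + _]addrC [al' * al' + _]addrC al_al' al_sq scale1r scale0r addr0.
Qed.

Lemma comb_full_conj w : comb fullS (cv w) = (map_mx cj (comb fullS w))^T.
Proof.
rewrite !comb_full maplin alC alC' trlin -!map_trmx trmxK /cv -map_vec_mx addrC.
by rewrite map_trmx.
Qed.

Lemma comb_full_inj w : comb fullS w = 0 -> w = 0.
Proof.
rewrite comb_full => h; suff : vec_mx w = 0 by move=> /(congr1 mxvec); rewrite vec_mxK linear0.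
move: h; move: (vec_mx w) => M h; have := congr1 trmx h; rewrite trlin trmxK trmx0 => h'.
have := congr2 (fun x y => al *: x + al' *: y) h h'.
rewrite !scaler0 addr0 !scalerDr !scalerA [X in _ + X = _]addrC addrACA -!scalerDl.
by rewrite al_al' al_sq scale1r scale0r addr0.
Qed.

(** W is the sum over l of e_l^T times its l-th row; the term l = i is put first and m - 1 others
    follow. *)
Lemma full_decomposition u i : exists a' s,
  (size s < m)%N /\ sumB fullE ((delta_mx 0 i, a') :: s) = u.
Proof.
pose M := comb fullS u.
exists (row i M), [seq (delta_mx 0 l, row l M) | l <- enum (predC1 i)]; split.
  rewrite size_map -cardE cardC1 card_ord.
  by case: m i {u M} => [[]|].
rewrite sumB_cons /sumB big_map big_enum /=.
have -> : B fullE (delta_mx 0 i) (row i M) +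
    \sum_(l in predC1 i) B fullE (delta_mx 0 l) (row l M) =
    \sum_l B fullE (delta_mx 0 l) (row l M).
  by rewrite [RHS](bigD1 i).
apply/eqP; rewrite -subr_eq0; apply/eqP/comb_full_inj; rewrite combB.
rewrite comb_sum; apply/eqP; rewrite subr_eq0; apply/eqP/matrixP => a b.
rewrite summxE (bigD1 a)//= big1 ?addr0 => [|l la]; rewrite comb_B_full mxE big_ord1 !mxE.
  by rewrite !eqxx mul1r.
by rewrite [a == l]eq_sym (negPf la) mul0r.
Qed.

End FullFamily.

Section SkewFamily.
Variable n : nat.

Definition pairs : {set 'I_n * 'I_n} := [set ij : 'I_n * 'I_n | (ij.1 < ij.2)%N].
Definition skE1 (t : 'I_#|pairs|) : 'M[C]_n := delta_mx (enum_val t).1 (enum_val t).2.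
Definition skewS (t : 'I_#|pairs|) : 'M[C]_n := skE1 t - (skE1 t)^T.
Definition skewE t := ii *: skewS t.

Lemma card_pairs : #|pairs| = 'C(n, 2).
Proof.
rewrite -bin2_sum big_mkord -sum1_card.
rewrite (eq_bigl (fun ij : 'I_n * 'I_n => true && (ij.1 < ij.2)%N)) => [|ij]; last by rewrite inE.
rewrite -(pair_big_dep xpredT (fun i j : 'I_n => (i < j)%N) (fun _ _ => 1%N)) /=.
rewrite (exchange_big_dep xpredT)//=; apply: eq_bigr => j _.
by rewrite (big_ord_narrow (ltnW (ltn_ord j))) sum_nat_const card_ord muln1.
Qed.

Lemma skew_ext (M : 'M[C]_n) : M^T = - M -> (forall i j : 'I_n, (i < j)%N -> M i j = 0) -> M = 0.
Proof.
move=> Msk h; have sk i j : M j i = - M i j by have /matrixP/(_ i j) := Msk; rewrite !mxE.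
apply/matrixP => i j; rewrite mxE; case: (ltngtP i j) => [/h//|/h ji|/val_inj <-].
  by rewrite sk ji oppr0.
by have /eqP := sk i i; rewrite -addr_eq0 -mulr2n mulrn_eq0 => /eqP.
Qed.

Lemma skewS_tr t : (skewS t)^T = - skewS t.
Proof. by rewrite /skewS linearB /= trmxK opprB. Qed.

Lemma skewS_conj t : map_mx cj (skewS t) = skewS t.
Proof. by rewrite /skewS /skE1 map_mxB -map_trmx map_delta_mx. Qed.

Lemma skewE_herm t : skewE t \is hermsymmx.
Proof.
apply/is_hermitianmxP; rewrite expr0 scale1r /skewE linearZ /= skewS_tr map_mxZ map_mxN.
by rewrite skewS_conj /= conjCi scaleNr scalerN opprK.
Qed.

Lemma comb_skew_tr w : (comb skewS w)^T = - comb skewS w.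
Proof.
rewrite /comb linear_sum -sumrN; apply: eq_bigr => t _ /=.
by rewrite linearZ /= skewS_tr scalerN.
Qed.

Lemma comb_skew_conj w : comb skewS (cv w) = map_mx cj (comb skewS w).
Proof.
rewrite /comb map_mx_sum; apply: eq_bigr => t _.
by rewrite map_mxZ skewS_conj mxE.
Qed.

Lemma comb_skew_coef w t : comb skewS w (enum_val t).1 (enum_val t).2 = w 0 t.
Proof.
have lt (s : 'I_#|pairs|) : ((enum_val s).1 < (enum_val s).2)%N.
  have : enum_val s \in pairs by exact: enum_valP.
  by rewrite inE.
rewrite summxE (bigD1 t)//= big1 ?addr0 => [|s st]; rewrite !mxE.
  rewrite !eqxx /= (_ : _ && _ = false) ?subr0 ?mulr1//.
  by apply/negbTE/negP => /andP[/eqP e _]; have := lt t; rewrite e ltnn.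
rewrite (_ : _ && _ = false); last first.
  apply/negbTE/negP => /andP[/eqP e1 /eqP e2]; move/negP: st; apply; apply/eqP/enum_val_inj.
  by rewrite [enum_val s]surjective_pairing -e1 -e2 -surjective_pairing.
rewrite (_ : _ && _ = false) ?subrr ?mulr0//.
apply/negbTE/negP => /andP[/eqP e1 /eqP e2].
by have := lt s; rewrite -e1 -e2 ltnNge ltnW// lt.
Qed.

Lemma comb_skew_inj w : comb skewS w = 0 -> w = 0.
Proof. by move=> h; apply/rowP => t; rewrite -comb_skew_coef h !mxE. Qed.

Lemma comb_skew_surj (M : 'M[C]_n) : M^T = - M ->
  comb skewS (\row_t M (enum_val t).1 (enum_val t).2) = M.
Proof.
move=> Msk; apply/eqP; rewrite -subr_eq0; apply/eqP/skew_ext.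
  by rewrite linearB /= comb_skew_tr Msk opprB addrC opprK.
move=> i j ij; have ijP : (i, j) \in pairs by rewrite inE.
have := comb_skew_coef (\row_t M (enum_val t).1 (enum_val t).2) (enum_rank_in ijP (i, j)).
by rewrite mxE enum_rankK_in//= !mxE => ->; rewrite subrr.
Qed.

Definition wedge (a b : 'rV[C]_n) : 'M[C]_n := a^T *m b - b^T *m a.

Lemma wedge_tr a b : (wedge a b)^T = - wedge a b.
Proof. by rewrite /wedge linearB /= !trmx_mul !trmxK opprB. Qed.

Lemma wedgeE a b i j : wedge a b i j = a 0 i * b 0 j - b 0 i * a 0 j.
Proof. by rewrite !mxE !big_ord1 !mxE. Qed.

Lemma comb_B_skew a b : comb skewS (B skewE a b) = ii *: wedge a b.
Proof.
rewrite -(@comb_skew_surj (ii *: wedge a b)); last by rewrite linearZ /= wedge_tr scalerN.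
congr (comb _ _); apply/rowP => t; rewrite BjE [RHS]mxE [RHS]mxE wedgeE /skewE /skewS.
rewrite -scalemxAr -scalemxAl mxE; congr (_ * _).
rewrite mulmxBr mulmxBl mxE [X in _ + X]mxE /skE1 trmx_delta.
have delta i' j' : (a *m delta_mx i' j' *m b^T) 0 0 = a 0 i' * b 0 j'.
  rewrite -(mul_delta_mx (0 : 'I_1)) mulmxA -colE -mulmxA -rowE.
  by rewrite mxE big_ord1 !mxE.
by rewrite !delta [X in _ - X]mulrC.
Qed.

End SkewFamily.

End MatrixFamilies.

(** * Skew matrices as sums of wedges *)

Section SkewMatrices.
Variables (C : numClosedFieldType) (n : nat).
Local Notation ii := ('i%R : C).
Local Notation V := 'rV[C]_n.

Definition nzrows (M : 'M[C]_n) : {set 'I_n} := finset (fun i => row i M != 0).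

(* Subtracting the wedge of two rows of M clears those two rows, and clears no
   more than it fills: the rows that vanish in M still vanish afterwards. *)
Lemma skew_decomposition N (M : 'M[C]_n) : M^T = - M ->
  (#|nzrows M| <= N)%N ->
  exists s : seq (V * V), [/\ (2 * size s <= N)%N, all (fun y => y.1 != 0) s &
    \sum_(y <- s) wedge y.1 y.2 = M].
Proof.
elim/ltn_ind: N M => N IH M Msk cM.
have sk i j : M j i = - M i j by have /matrixP/(_ i j) := Msk; rewrite !mxE.
have [->|M0] := eqVneq M 0; first by exists [::]; split=> //; rewrite big_nil.
have [k [l kl]] : exists k l, M k l != 0.
  apply: contrapT => h; case/eqP: M0; apply/matrixP => i j; rewrite mxE.
  by apply: contrapT => /eqP ij; apply: h; exists i, j.
have d0 i : M i i = 0.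
  by have /eqP := sk i i; rewrite -addr_eq0 -mulr2n mulrn_eq0 => /eqP.
have kNl : k != l by apply: contra_neq kl => ->.
pose c := M k l; pose M' := M - wedge (c^-1 *: row k M) (row l M).
have M'E i j : M' i j = M i j - c^-1 * (M k i * M l j - M l i * M k j).
  by rewrite mxE [X in _ + X]mxE wedgeE !mxE; ring.
have M'sk : M'^T = - M' by rewrite /M' linearB /= Msk wedge_tr -opprD.
have c0 : c != 0 by [].
have row0 i : row i M = 0 -> row i M' = 0.
  move=> /rowP Mi; apply/rowP => j; have h j' : M i j' = 0 by have := Mi j'; rewrite !mxE.
  by rewrite mxE [RHS]mxE M'E !(sk i) !h !(mul0r, oppr0, subrr, mulr0).
have rowk : row k M' = 0.
  apply/rowP => j; rewrite mxE [RHS]mxE M'E d0 (sk k l) -/c mul0r sub0r mulNr opprK.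
  by rewrite mulKf// subrr.
have rowl : row l M' = 0.
  by apply/rowP => j; rewrite mxE [RHS]mxE M'E d0 -/c mul0r subr0 mulKf// subrr.
pose A := nzrows M; pose A' := nzrows M'.
have Ak : k \in A by rewrite inE; apply: contraNneq kl => /rowP/(_ l); rewrite !mxE => ->.
have Al : l \in A.
  rewrite inE; apply: contraNneq kl => /rowP/(_ k); rewrite !mxE sk => /eqP.
  by rewrite oppr_eq0.
have cA' : (#|A'| + 2 <= #|A|)%N.
  have : A' \subset (A :\ k) :\ l.
    apply/fintype.subsetP => i; rewrite !inE => i0; apply/and3P; split.
    - by apply: contraNneq i0 => ->; rewrite rowl.
    - by apply: contraNneq i0 => ->; rewrite rowk.
    - by apply: contraNneq i0 => /row0 ->.
  move=> /subset_leq_card; rewrite (cardsD1 k A) Ak (cardsD1 l (A :\ k)) in_setD1 Al eq_sym kNl.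
  by move=> h; rewrite addnC; exact: (leq_add (leqnn 2) h).
have cN : (#|A| <= N)%N by exact: cM.
have N2 : (N - 2 < N)%N by move: cA' cN; clear; lia.
have [|s [ss s0 sE]] := IH _ N2 M' M'sk; first by move: cA' cN; rewrite -/A'; clear; lia.
exists ((c^-1 *: row k M, row l M) :: s); split.
- by move: ss cA' cN => /=; clear; lia.
- rewrite /= s0 andbT scaler_eq0 invr_eq0 (negPf c0) /=.
  by move: Ak; rewrite inE.
by rewrite big_cons sE /M' addrC subrK.
Qed.

Lemma skew_fill u : (2 < n)%N -> exists a a' s,
  [/\ (size s < n./2)%N, a != 0 & sumB (@skewE C n) ((a, a') :: s) = u].
Proof.
move=> n2; have n0 : (0 < n)%N by lia.
have cn : (#|nzrows (comb (@skewS C n) u)| <= n)%N.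
  by apply: leq_trans (max_card _) _; rewrite card_ord.
have [s [ss s0 sE]] := skew_decomposition (comb_skew_tr u) cn.
case: s ss s0 sE => [|[a b] s] /= ss s0 sE.
  (* Here u = 0 and the decomposition is empty; a term with second vector 0 supplies the nonzero
     first vector that is required. *)
  exists (delta_mx 0 (Ordinal n0)), 0, [::]; split => //=; first by lia.
    by apply/eqP => /rowP/(_ (Ordinal n0))/eqP; rewrite !mxE !eqxx oner_eq0.
  move: sE; rewrite big_nil => /esym/comb_skew_inj ->.
  by rewrite /sumB big_seq1 B0r.
have ii0 : ii != 0 by exact: neq0Ci.
(* By [comb_B_skew] a value of the form gives i times a wedge, whence the factor 1 / i on the first
   vectors. *)
have sB t : comb (@skewS C n) (sumB (@skewE C n) [seq (ii^-1 *: y.1, y.2) | y <- t]) =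
    \sum_(y <- t) wedge y.1 y.2.
  rewrite /sumB big_map comb_sum; apply: eq_bigr => y _ /=.
  by rewrite BZl combZ comb_B_skew scalerA mulVf// scale1r.
exists (ii^-1 *: a), b, [seq (ii^-1 *: y.1, y.2) | y <- s]; split.
- by rewrite size_map geq_half_double -mul2n.
- by case/andP: s0 => a0 _; rewrite scaler_eq0 invr_eq0 (negPf ii0).
apply/eqP; rewrite -subr_eq0; apply/eqP/comb_skew_inj; rewrite combB.
by rewrite (sB ((a, b) :: s)) sE subrr.
Qed.

Lemma skew_unit m : ~~ odd m -> exists2 K : 'M[C]_m, K^T = - K & K \in unitmx.
Proof.
move=> om; have -> : m = (m./2 + m./2)%N by rewrite addnn even_halfK.
move: m./2 => r; exists (block_mx 0 1%:M (- 1%:M) 0).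
  by rewrite tr_block_mx opp_block_mx !trmx0 linearN /= !trmx1 opprK !oppr0.
set K := block_mx _ _ _ _; have : K *m (- K) = 1%:M.
  rewrite mulmxN mulmx_block !(mul0mx, mulmx0, mul1mx, mulmx1, addr0, add0r).
  by rewrite opp_block_mx !opprK oppr0 -scalar_mx_block.
by move=> /mulmx1_unit[].
Qed.

(** An invertible skew matrix exists in the even size n + 1; its corner entry is 0, so it is itself
    a bordered matrix, and expanding along the border isolates a nonzero term. *)
Lemma bdet_skew_neq0 : odd n -> exists (a : V) (W : 'M[C]_n) j,
  W^T = - W /\ bdet (delta_mx 0 j) a^T W != 0.
Proof.
move=> on; have ev : ~~ odd (1 + n) by rewrite /= on.
have [K Ksk uK] := skew_unit ev.
have dW : (drsubmx K)^T = - drsubmx K.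
  by apply/matrixP => i j; have /matrixP/(_ (rshift 1 i) (rshift 1 j)) := Ksk; rewrite !mxE.
have ul0 : ulsubmx K = 0.
  apply/matrixP => i j; rewrite (ord1 i) (ord1 j) [RHS]mxE.
  have /matrixP/(_ (lshift n 0) (lshift n 0)) := Ksk; rewrite !mxE => /eqP.
  by rewrite -addr_eq0 -mulr2n mulrn_eq0 => /eqP.
have : bdet (ursubmx K) (dlsubmx K) (drsubmx K) != 0.
  by rewrite /bdet -ul0 submxK -unitfE -unitmxE.
rewrite bdet_sum => nz; exists (dlsubmx K)^T, (drsubmx K).
suff [j hj] : exists j, bdet (delta_mx 0 j) (dlsubmx K) (drsubmx K) != 0.
  by exists j; rewrite trmxK.
apply/existsP; apply: contra_neqT nz; rewrite negb_exists => /forallP h.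
by rewrite big1// => j _; have := h j; rewrite negbK => /eqP ->; rewrite mulr0.
Qed.

End SkewMatrices.

(** * Shears of the model quadrics *)

Section ModelShears.
Variables (R : realType) (p q x : nat).
Local Notation C := (R[i] : numClosedFieldType).
Local Notation V := 'rV[C]_(p + p + x + (q + 1 + x)).
Local Notation cj := (@Num.conj_op C).
Local Notation ii := ('i%R : C).
Variables (E S : 'I_q -> 'M[C]_p) (n : nat).
Variables (be : 'rV[C]_p -> 'M[C]_p -> 'rV[C]_p) (h : 'M[C]_p -> C).

Definition apart (y : V) : 'rV[C]_p := lsubmx (lsubmx (lsubmx y)).
Definition wpart (y : V) : 'rV[C]_q := lsubmx (lsubmx (rsubmx y)).
Definition shear (y : V) : V :=
  row_mx (mk 0 (be (apart y) (comb S (wpart y))) 0)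
    (row_mx (row_mx 0 (h (comb S (wpart y)))%:M) 0).

Hypothesis n0 : (0 < n)%N.
Hypothesis be_entire : forall j, entire (fun y : V => be (apart y) (comb S (wpart y)) 0 j).
Hypothesis h_entire : entire (fun y : V => h (comb S (wpart y))).
Hypothesis beZ : forall (c : C) a W, be (c *: a) (c *: W) = c ^+ n *: be a W.
Hypothesis hZ : forall (c : C) W, h (c *: W) = c ^+ n * h W.
Hypothesis inv : forall a w, w - cv w = (2 * ii) *: B E a (cv a) ->
  let b := (be a (comb S w) *m (cv a)^T) 0 0 in
  h (comb S w) - cj (h (comb S w)) = (2 * ii) * (b + cj b).
Hypothesis nz : exists a w, be a (comb S w) != 0 \/ h (comb S w) != 0.

Lemma apart_lin (c : C) y y' : apart (y + c *: y') = apart y + c *: apart y'.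
Proof. by rewrite /apart !linearD !linearZ. Qed.
Lemma wpart_lin (c : C) y y' : wpart (y + c *: y') = wpart y + c *: wpart y'.
Proof. by rewrite /wpart !linearD !linearZ. Qed.

Lemma apart_row a b c w : apart (row_mx (mk a b c) w) = a.
Proof. by rewrite /apart /mk !row_mxKl. Qed.
Lemma wpart_row z w w0 ws : wpart (row_mx z (row_mx (row_mx w w0) ws)) = w.
Proof. by rewrite /wpart row_mxKr !row_mxKl. Qed.

Lemma shear_entire i : entire (fun y => shear y 0 i).
Proof.
case: (split_ordP i) => j ->.
  under eq_fun do rewrite row_mxEl.
  case: (split_ordP j) => l ->.
    under eq_fun do rewrite row_mxEl.
    case: (split_ordP l) => t ->.
      by under eq_fun do rewrite row_mxEl mxE; exact: entire_cst.
    by under eq_fun do rewrite row_mxEr; exact: be_entire.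
  by under eq_fun do rewrite row_mxEr mxE; exact: entire_cst.
under eq_fun do rewrite row_mxEr.
case: (split_ordP j) => l ->.
  under eq_fun do rewrite row_mxEl.
  case: (split_ordP l) => t ->.
    by under eq_fun do rewrite row_mxEl mxE; exact: entire_cst.
  rewrite (_ : (fun y => _) = (fun y => h (comb S (wpart y)))); first exact: h_entire.
  by apply/funext => y; rewrite row_mxEr (ord1 t) mxE eqxx mulr1n.
by under eq_fun do rewrite row_mxEr mxE; exact: entire_cst.
Qed.

Lemma shearZ (c : C) y : shear (c *: y) = c ^+ n *: shear y.
Proof.
rewrite /shear /mk (_ : apart (c *: y) = c *: apart y); last by rewrite /apart !linearZ.
rewrite (_ : wpart (c *: y) = c *: wpart y); last by rewrite /wpart !linearZ.
by rewrite combZ beZ hZ !scale_row_mx !scaler0 scale_scalar_mx.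
Qed.

(** The shear reads a and w_1 and changes b and w_0 only. *)
Lemma shear_shear (c : C) y y' : shear (y + c *: shear y') = shear y.
Proof.
by rewrite /shear apart_lin wpart_lin apart_row wpart_row !scaler0 !addr0.
Qed.

Lemma cv_row_mx m1 m2 (u : 'rV[C]_m1) (v : 'rV[C]_m2) : cv (row_mx u v) = row_mx (cv u) (cv v).
Proof. exact: map_row_mx. Qed.

(** Only the equation of w_0 is affected, and there [inv] relates the increment of w_0 to that of
    b. *)
Lemma shear_quadric y : quadric (@modelH C p q x E) y -> quadric (@modelH C p q x E) (y + shear y).
Proof.
rewrite -[y]hsubmxK -[lsubmx y]hsubmxK -[lsubmx (lsubmx y)]hsubmxK.
rewrite -[rsubmx y]hsubmxK -[lsubmx (rsubmx y)]hsubmxK.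
move: (lsubmx (lsubmx (lsubmx y))) (rsubmx (lsubmx (lsubmx y))) (rsubmx (lsubmx y)) => a b c.
move: (lsubmx (lsubmx (rsubmx y))) (rsubmx (lsubmx (rsubmx y))) (rsubmx (rsubmx y)) => w w0 ws.
move=> /(quadricP _ _) hy; apply/quadricP; move: hy.
rewrite /shear apart_row wpart_row -/(mk a b c) !add_row_mx !addr0 !row_mxKl !row_mxKr.
rewrite !cv_row_mx !opp_row_mx !add_row_mx !B_model !scale_row_mx.
move=> /eq_row_mx[/eq_row_mx[hw h0] hs].
rewrite hw hs; congr (row_mx (row_mx _ _) _).
have := inv hw; set be' := be _ _; set h' := h _ => /= hinv.
apply/rowP => o; rewrite (ord1 o); move: h0 => /rowP/(_ 0).
have sE (u v : 'rV[C]_p) : (u *m (cv v)^T) 0 0 = cj ((v *m (cv u)^T) 0 0).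
  rewrite !mxE rmorph_sum; apply: eq_bigr => i _ /=.
  by rewrite !mxE rmorphM /= conjCK mulrC.
rewrite !rvE ![cv _ 0 0]mxE !rvE (sE a b) => h0.
rewrite rmorphD /= (sE a (b + be')) mulmxDl !rvE rmorphD /=.
rewrite [(h'%:M : 'rV_1) 0 0]mxE eqxx mulr1n.
rewrite opprD addrACA h0 hinv.
by rewrite -mulrDr; congr (_ * _); rewrite [X in _ + X = _]addrC addrACA.
Qed.

Lemma shear_nz : exists y, shear y != 0.
Proof.
have [a [w aw]] := nz.
exists (row_mx (mk a 0 0) (row_mx (row_mx w 0) 0)); rewrite /shear apart_row wpart_row.
apply/eqP => e.
have e1 : be a (comb S w) = 0.
  have := congr1 (fun v : V => rsubmx (lsubmx (lsubmx v))) e.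
  by rewrite /mk !row_mxKl row_mxKr !linear0.
have e2 : h (comb S w) = 0.
  have := congr1 (fun v : V => rsubmx (lsubmx (rsubmx v))) e.
  by rewrite row_mxKr row_mxKl row_mxKr !linear0 => /matrixP/(_ 0 0); rewrite !mxE eqxx mulr1n.
by case: aw; rewrite ?e1 ?e2 eqxx.
Qed.

Lemma model_not_determined : exists F G : V -> V,
  [/\ automorphism_germ 0 (quadric (@modelH C p q x E)) F,
    automorphism_germ 0 (quadric (@modelH C p q x E)) G,
    same_jet n.-1 0 F G & ~ germ_eq 0 F G].
Proof.
exact: shear_not_determined n0 shear_entire shearZ shear_shear shear_quadric shear_nz.
Qed.

Lemma entire_comb i j : entire (fun y : V => comb S (wpart y) i j).
Proof.
have -> : (fun y : V => comb S (wpart y) i j) = (fun y => \sum_t wpart y 0 t * S t i j).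
  by apply/funext => y; rewrite summxE; apply: eq_bigr => t _; rewrite mxE.
apply: entire_sum => t; apply: entireM; last exact: entire_cst.
have -> : (fun y : V => wpart y 0 t) = (fun y => y 0 (rshift _ (lshift x (lshift 1 t)))).
  by apply/funext => y; rewrite !mxE.
exact: entire_coord.
Qed.

Lemma entire_apart i : entire (fun y : V => apart y 0 i).
Proof.
have -> : (fun y : V => apart y 0 i) = (fun y => y 0 (lshift _ (lshift x (lshift p i)))).
  by apply/funext => y; rewrite !mxE.
exact: entire_coord.
Qed.

Lemma entire_bdet j : entire (fun y : V => bdet (delta_mx 0 j) (apart y)^T (comb S (wpart y))).
Proof.
apply: entire_det => a b; case: (split_ordP a) => a' ->; case: (split_ordP b) => b' ->.
- by under eq_fun do rewrite block_mxEul; exact: entire_cst.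
- by under eq_fun do rewrite block_mxEur; exact: entire_cst.
- rewrite (_ : (fun y => _) = (fun y => apart y 0 a')); first exact: entire_apart.
  by apply/funext => y; rewrite block_mxEdl (ord1 b') [LHS]mxE.
- by under eq_fun do rewrite block_mxEdr; exact: entire_comb.
Qed.

End ModelShears.

(** * The two families of examples *)

Section Examples.
Variables (R : realType).
Local Notation C := (R[i] : numClosedFieldType).
Local Notation cj := (@Num.conj_op C).
Local Notation ii := ('i%R : C).

Lemma bdet_row p (x : 'rV[C]_p) (c : C) z W :
  ((\row_j (c * bdet (delta_mx 0 j) z W)) *m x^T) 0 0 = c * bdet x z W.
Proof.
rewrite bdet_sum mxE mulr_sumr; apply: eq_bigr => j _.
by rewrite !mxE mulrAC -mulrA.
Qed.

Lemma full_model_not_determined m x : (0 < m)%N ->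
  exists F G, [/\ automorphism_germ 0 (quadric (@modelH C m _ x (@fullE C m))) F,
    automorphism_germ 0 (quadric (@modelH C m _ x (@fullE C m))) G,
    same_jet (2 * m).-1 0 F G & ~ germ_eq 0 F G].
Proof.
move=> m0.
pose be (a : 'rV[C]_m) (W : 'M[C]_m) : 'rV[C]_m :=
  \row_j (- \det W * bdet (delta_mx 0 j) a^T W).
pose h (W : 'M[C]_m) : C := \det W ^+ 2.
have detE : entire (fun y : 'rV[C]_(m + m + x + (m * m + 1 + x)) => \det (comb (@fullS C m) (wpart y))).
  by apply: entire_det => i j; exact: entire_comb.
apply: (@model_not_determined R m _ x _ (@fullS C m) (2 * m) be h).
- by rewrite muln_gt0.
- move=> j; under eq_fun do rewrite mxE.
  by apply: entireM; [exact: entireN|exact: entire_bdet].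
- exact: entireM.
- move=> c a W; apply/rowP => j; rewrite rvZ !mxE.
  have trZ : (c *: a)^T = c *: a^T by exact: linearZ.
  by rewrite trZ bdet_homog detZ mul2n -addnn exprD; ring.
- by move=> c W; rewrite /h detZ exprMn -exprM mulnC.
- move=> a w hw /=; rewrite bdet_row; apply: det_square_invariant.
  rewrite -comb_full_conj -combB hw combZ comb_B_full //.
have [a' [s [_ sE]]] := full_decomposition (0 : 'rV[C]_(m * m)) (Ordinal m0).
(* This w_1 has W equal to the identity, where (det W)^2 = 1. *)
exists 0, (\sum_l B (@fullE C m) (delta_mx 0 l) (delta_mx 0 l)); right.
rewrite comb_sum (_ : \sum_l _ = 1%:M) /h ?det1 ?expr1n ?oner_neq0//.
apply/matrixP => i j; rewrite summxE (bigD1 i)//= big1 ?addr0 => [|l li];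
  rewrite comb_B_full mxE big_ord1 !mxE ?eqxx ?mul1r ?[j == i]eq_sym//.
by rewrite [i == l]eq_sym (negPf li) mul0r.
Qed.

Lemma skew_model_not_determined n x : odd n ->
  exists F G, [/\ automorphism_germ 0 (quadric (@modelH C n _ x (@skewE C n))) F,
    automorphism_germ 0 (quadric (@modelH C n _ x (@skewE C n))) G,
    same_jet n.-1 0 F G & ~ germ_eq 0 F G].
Proof.
move=> on.
pose be (a : 'rV[C]_n) (W : 'M[C]_n) : 'rV[C]_n :=
  \row_j (ii * bdet (delta_mx 0 j) a^T W).
apply: (@model_not_determined R n _ x _ (@skewS C n) n be (fun=> 0)).
- by case: n on {be}.
- move=> j; under eq_fun do rewrite mxE.
  by apply: entireM; [exact: entire_cst|exact: entire_bdet].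
- exact: entire_cst.
- move=> c a W; apply/rowP => j; rewrite rvZ !mxE.
  have trZ : (c *: a)^T = c *: a^T by exact: linearZ.
  by rewrite trZ bdet_homog; ring.
- by move=> c W; rewrite mulr0.
(* The bordered determinant is real, so i times it is purely imaginary and w_0 can stay fixed. *)
- move=> a w hw /=; rewrite bdet_row rmorphM /= conjCi.
  rewrite bdet_skew_real ?rmorph0 ?subrr; [|by []|exact: comb_skew_tr|].
    by rewrite mulNr subrr mulr0.
  rewrite -comb_skew_conj -combB hw combZ comb_B_skew scalerA -mulrA mulCii mulrN1.
  by [].
have [a [W [j [Wsk nz]]]] := bdet_skew_neq0 C on.
exists a, (\row_t W (enum_val t).1 (enum_val t).2); left; rewrite comb_skew_surj//.
apply: contraNneq nz => /rowP/(_ j); rewrite !mxE => /eqP.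
by rewrite mulf_eq0 (negPf (neq0Ci _)).
Qed.

Lemma full_model m x : (0 < m)%N -> let H := @modelH C m _ x (@fullE C m) in
  [/\ hermitian_family H, generic H & jets_exactly_required (2 * m) 0 (quadric H)].
Proof.
move=> m0 H.
have herm : hermitian_family H by exact/modelH_herm/fullE_herm.
have ker : trivial_common_kernel H by exact: modelH_ker.
have fill : sums_fill H m.
  apply: model_fill => u; have [a' [s [ss sE]]] := full_decomposition u (Ordinal m0).
  exists (delta_mx 0 (Ordinal m0)), a', s; split=> //.
  by apply/eqP => /rowP/(_ (Ordinal m0))/eqP; rewrite !mxE !eqxx oner_eq0.
have detect : sums_detect H m by apply: model_detect m0 _; exact: full_decomposition.
split=> //; first by split=> //; exact: fill_real_independent fill.
split; last exact: full_model_not_determined.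
move=> F G; apply: (jets_determine herm ker fill) => //; last by lia.
(* Here r = m and the order is 2 m, the borderline case that calls for [sums_detect]. *)
by right.
Qed.

Lemma skew_model n x : odd n -> (3 <= n)%N -> let H := @modelH C n _ x (@skewE C n) in
  [/\ hermitian_family H, generic H & jets_exactly_required n 0 (quadric H)].
Proof.
move=> on n3 H.
have herm : hermitian_family H by exact/modelH_herm/skewE_herm.
have ker : trivial_common_kernel H by exact: modelH_ker.
have fill : sums_fill H n./2 by apply: model_fill => u; exact: skew_fill.
have n2 : (2 * n./2 < n)%N by rewrite -[X in (_ < X)%N]odd_double_half on mul2n add1n.
split=> //; first by split=> //; exact: fill_real_independent fill.
split; last exact: skew_model_not_determined.
move=> F G; apply: (jets_determine herm ker fill) => //; first exact: ltnW.
  by left.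
by lia.
Qed.

End Examples.

Theorem theorem18 (R : realType) :
  (forall m k : nat, (0 < m)%N -> (m ^ 2 < k)%N ->
     exists (d : nat) (H : 'I_k -> 'M[R[i]]_d),
       [/\ (d + k)%N%:Q = 2 * k%:Q - m%:Q ^+ 2 + 2 * m%:Q - 1,
           hermitian_family H,
           generic H
         & jets_exactly_required (2 * m) 0 (quadric H)])
  /\
  (forall n k : nat, odd n -> (3 <= n)%N -> (((n - 1) * n) %/ 2 < k)%N ->
     exists (d : nat) (H : 'I_k -> 'M[R[i]]_d),
       [/\ (d + k)%N%:Q
             = 2 * k%:Q - 1 / 2 * n%:Q ^+ 2 + 5 / 2 * n%:Q - 1,
           hermitian_family H,
           generic H
         & jets_exactly_required n 0 (quadric H)]).
Proof.
split=> [m k m0 mk|n k on n3 nk].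
  (* The number of variables c_s. With d = 2 m + x and k = m^2 + 1 + x, the sum d + k is 2 k + 2 m -
     m^2 - 1. *)
  have [x ->] : exists x, k = (m * m + 1 + x)%N.
    by exists (k - m * m - 1)%N; move: mk; rewrite expnS expn1; lia.
  have [herm gen jets] := full_model R x m0.
  exists (m + m + x)%N, (@modelH (R[i] : numClosedFieldType) m _ x (@fullE _ m)); split=> //.
  by rewrite !PoszD !PoszM !rmorphD !rmorphM /=; ring.
have qE : #|pairs n| = (((n - 1) * n) %/ 2)%N by rewrite card_pairs bin2 divn2 mulnC subn1.
(* A form without division of the count q of equations for w_1, to be used in d + k = 2 k + 2 n - q
   - 1. *)
have q2 : (2 * #|pairs n| + n = n * n)%N.
  have e2 : (2 %| (n - 1) * n)%N by rewrite dvdn2 oddM oddB ?on//; case: n on {n3 nk qE}.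
  by rewrite qE mulnC divnK//; nia.
have [x ->] : exists x, k = (#|pairs n| + 1 + x)%N.
  by exists (k - #|pairs n| - 1)%N; move: nk; rewrite -qE; lia.
have [herm gen jets] := skew_model R x on n3.
exists (n + n + x)%N, (@modelH (R[i] : numClosedFieldType) n _ x (@skewE _ n)); split=> //.
have := congr1 (fun a : nat => a%:Q) q2; rewrite !PoszD !PoszM !rmorphD !rmorphM /=.
by move: (#|pairs n|) => q h; lra.
Qed.
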